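(* Let $\theta>1$ and $\alpha,\beta\geq-\frac12$. For functions $f:(-1,1)\to\mathbb{C}$ with Fourier–Jacobi coefficients $$f_k=\int_{-1}^{1} f(x)\,p^{\alpha,\beta}_k(x)\,(1-x)^{\alpha}(1+x)^{\beta}\,dx,\qquad k=0,1,2,\dots,$$ the inequality $$\sum_{k=0}^{\infty}|f_k|^2\theta^k<\infty$$ holds true for all restrictions to the interval $(-1,1)$ of the elements of the Szegő space $AL_2(\partial E_\theta)$ and only for them.
   Context: $p^{\alpha,\beta}_k$ denotes the $k$-th orthonormal Jacobi polynomial, i.e. the polynomial of degree $k$ (with positive leading coefficient) such that $\int_{-1}^{1}p^{\alpha,\beta}_k(x)p^{\alpha,\beta}_m(x)(1-x)^\alpha(1+x)^\beta dx=\delta_{k,m}$. The functions $f$ considered are those on $(-1,1)$ for which the integrals defining $f_k$ exist. $E_\theta=\{z\in\mathbb{C}:|z-1|+|z+1|<\theta^{1/2}+\theta^{-1/2}\}$ is the open ellipse with foci $\pm1$, and $\partial E_\theta$ is its boundary. The Szegő space $AL_2(\partial E_\theta)$ is defined as the set of functions $f$ holomorphic in $E_\theta$, possessing non-tangential boundary values almost everywhere on $\partial E_\theta$ and having finite norm $\|f\|^2=\int_{\partial E_\theta}|f(z)|^2|dz|<\infty$, where $|dz|$ is arc length and the integral is taken over the boundary values. Statements about $f$ on $(-1,1)$ are understood almost everywhere: saying that $f$ is the restriction of a holomorphic function allows $f$ to differ from that restriction on a set of Lebesgue measure zero.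
   Formalization: Elements of the Szegő space are additionally required to equal the Cauchy integral of their boundary values (Smirnov class); with the literal definition the claim fails, e.g. for exp((1+φ)/(1−φ)) with φ mapping E_θ conformally onto the unit disc. *)

(* Defs.v *)
From HB Require Import structures.
From mathcomp Require Import all_boot all_order all_algebra.
From mathcomp Require Import complex.
From mathcomp Require Import all_classical all_reals all_analysis.
Set Implicit Arguments.
Unset Strict Implicit.
Unset Printing Implicit Defensive.
Import Order.TTheory GRing.Theory Num.Theory.
Import numFieldNormedType.Exports.
Local Open Scope classical_set_scope.
Local Open Scope ring_scope.
Local Open Scope complex_scope.

(* The library puts a topology on [K^o] for every numFieldType [K]; this makes
   it canonical on [R[i]] itself. *)
#[non_forgetful_inheritance]
HB.instance Definition _ (R : realType) := NormedModule.copy R[i] R[i]^o.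

Notation cmod := Normc.normc.

(* [completed_lebesgue_measure] lives on an alias of [R] whose sigma-algebra is
   the one of all Lebesgue measurable sets; [lebesgue_measure] is its
   restriction to the Borel sets. *)

Section ComplexIntegral.
Context {R : realType} d (T : measurableType d).
Variables (mu : {measure set T -> \bar R}) (D : set T).

Definition cintegrable (f : T -> R[i]) : Prop :=
  mu.-integrable D (fun x => (complex.Re (f x))%:E) /\
  mu.-integrable D (fun x => (complex.Im (f x))%:E).

Definition cintegral (f : T -> R[i]) : R[i] :=
  (\int[mu]_(x in D) complex.Re (f x)) +i* (\int[mu]_(x in D) complex.Im (f x)).

End ComplexIntegral.

Section Jacobi.
Context {R : realType}.
Implicit Types (alpha beta : R) (p : nat -> {poly R}) (f : R -> R[i]).

Definition jacobi_weight alpha beta (x : R) : R :=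
  (1 - x) `^ alpha * (1 + x) `^ beta.

Definition orthonormal_jacobi alpha beta p : Prop :=
  [/\ forall k, size (p k) = k.+1,
      forall k, 0 < lead_coef (p k) &
      forall k m, \int[lebesgue_measure]_(x in `]-1, 1[)
        ((p k).[x] * (p m).[x] * jacobi_weight alpha beta x) = (k == m)%:R].

Definition jacobi_integrand alpha beta p f (k : nat) (x : R) : R[i] :=
  f x * ((p k).[x] * jacobi_weight alpha beta x)%:C.

Definition has_jacobi_coefs alpha beta p f : Prop :=
  forall k, cintegrable (@completed_lebesgue_measure R) `]-1, 1[
    (jacobi_integrand alpha beta p f k).

Definition jacobi_coef alpha beta p f (k : nat) : R[i] :=
  cintegral (@completed_lebesgue_measure R) `]-1, 1[
    (jacobi_integrand alpha beta p f k).

End Jacobi.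

Section SzegoSpace.
Context {R : realType}.
Implicit Types (theta t M : R) (F : R[i] -> R[i]) (z w zeta l : R[i]).

Definition focal_sum z : R := cmod (z - 1) + cmod (z + 1).

Definition ellipse theta : set R[i] :=
  [set z | focal_sum z < Num.sqrt theta + (Num.sqrt theta)^-1].

Definition ellipse_boundary theta : set R[i] :=
  [set z | focal_sum z = Num.sqrt theta + (Num.sqrt theta)^-1].

(* Counterclockwise parametrization of the boundary by t in [0, 2 pi]; the
   semi-axes a and b below satisfy a^2 - b^2 = 1, so the foci are +-1. *)
Definition semi_major theta : R := (Num.sqrt theta + (Num.sqrt theta)^-1) / 2.
Definition semi_minor theta : R := (Num.sqrt theta - (Num.sqrt theta)^-1) / 2.

Definition ellipse_point theta t : R[i] :=
  (semi_major theta * cos t) +i* (semi_minor theta * sin t).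

(* The t-derivative of [ellipse_point]: dz is [ellipse_speed theta t] dt and
   arc length |dz| is its modulus times dt. *)
Definition ellipse_speed theta t : R[i] :=
  (- (semi_major theta * sin t)) +i* (semi_minor theta * cos t).

Definition holomorphic_on (U : set R[i]) F : Prop :=
  forall z, U z -> derivable F z 1.

(* Points z of the domain with |z - zeta| <= M dist(z, boundary); the usual
   approach regions at zeta are these for M > 1, and they are empty for M < 1. *)
Definition approach_region theta zeta M : set R[i] :=
  [set z | ellipse theta z /\
     forall w, ellipse_boundary theta w -> cmod (z - zeta) <= M * cmod (z - w)].

Definition nontangential_limit theta F zeta l : Prop :=
  forall M, F z @[z --> within (approach_region theta zeta M) (nbhs zeta)] --> l.

(* The boundary values are carried as a function of the parameter t.  They are
   only determined almost everywhere (null sets of t and of arc length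
   coincide), and a Borel representative always exists. *)
Definition boundary_values theta F (g : R -> R[i]) : Prop :=
  [/\ measurable_fun `[0, 2 * pi] (fun t => complex.Re (g t)),
      measurable_fun `[0, 2 * pi] (fun t => complex.Im (g t)) &
      {ae lebesgue_measure, forall t, t \in `[0, 2 * pi] ->
        nontangential_limit theta F (ellipse_point theta t) (g t)}].

Definition szego_norm2 theta (g : R -> R[i]) : \bar R :=
  (\int[lebesgue_measure]_(t in `[0%R, (2 * pi)%R])
     (cmod (g t) ^+ 2 * cmod (ellipse_speed theta t))%:E)%E.

Definition cauchy_integral theta (g : R -> R[i]) z : R[i] :=
  (0 +i* (2 * pi))^-1 * cintegral (@lebesgue_measure R) `[0, 2 * pi]
    (fun t => g t * ellipse_speed theta t / (ellipse_point theta t - z)).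

(* The last clause says that F is in the Smirnov class, i.e. that the boundary
   values determine F.  It is not implied by the others: if phi maps the
   ellipse conformally onto the unit disc, exp ((1 + phi) / (1 - phi)) is
   holomorphic and has unimodular boundary values except at one point, but it
   lies outside the Hilbert space of functions reproduced by the Szego
   kernel. *)
Definition szego_space theta : set (R[i] -> R[i]) :=
  [set F | holomorphic_on (ellipse theta) F /\
     exists g, [/\ boundary_values theta F g,
                   (szego_norm2 theta g < +oo)%E &
                   forall z, ellipse theta z -> F z = cauchy_integral theta g z]].

End SzegoSpace.

(* Main.v *)
(** Put [rho = sqrt theta] and [J v = (v + 1/v) / 2], which maps the circle
    [|v| = rho] onto the boundary of the ellipse and the unit circle onto
    [-1, 1].  In the coordinate [v] the Cauchy kernel of the ellipse is a sum of
    geometric series in [v / rho] and [1 / (v rho)], so Bessel's inequality on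
    one side, Riesz-Fischer and Fatou's theorem on the other, identify the Szego
    space with the functions [F (J v) = sum_k a_k rho^-k (v^k + v^-k)], [a] in
    l^2; on (-1, 1) this is [F = sum_k a_k rho^-k tau_k] with [tau_k] twice the
    Chebyshev polynomial.

    It remains to pass from Chebyshev to Jacobi coefficients.  Both change of
    basis matrices are triangular, so with the weights [rho^k] they act on l^2 by
    Young's inequality as soon as their entries are bounded by [C s^(n-j)] for
    some [s < rho].  The moments of [tau_k p_n] are bounded since [|tau_k| <= 2].
    For the Chebyshev coefficients of [p_n], those of [(1 - X^2)^N p_n] are
    bounded because [(1 - x^2)^m] is dominated by the weight, and each factor
    [1 - X^2] is removed by a recurrence on the coefficients, run down from the
    top degree.

    Finally, if [f] has the same coefficients as such an [F], then all moments of
    [(f - F) w] vanish and [f = F] almost everywhere. *)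

(* What makes the change of basis work is the strict gap between 1 and [rho]. The polynomials [p n]
   may grow on [-1, 1], but any rate [s] with 1 < [s] < [rho] is harmless, so every estimate may
   lose a constant such as 1 / (1 - r^2) and crude inequalities of the type |y| <= 1 + y^2 suffice
   throughout.

   On the boundary of the ellipse the obstacle is that the Cauchy kernel has two poles in the
   coordinate [v]. The boundary function is therefore an l^2 analytic part plus its reflection. The
   reflection is continuous up to the boundary; the analytic part converges by a comparison with the
   positive Poisson kernel, which is available because the Riesz-Fischer function has no negative
   frequencies.

   Rebuilding a function from its Jacobi coefficients leads to an iterated series whose order of
   summation has to be justified: truncation at [N] inverts the triangular matrices exactly, and the
   remainder is of order r^N.

   Finally [f] is merely Lebesgue measurable, so its coefficients live on the completed measure,
   whereas the series are integrated against the Borel one; the two are compared before uniqueness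
   is applied. *)
Require Import Defs.
From HB Require Import structures.
From mathcomp Require Import all_boot all_order all_algebra.
From mathcomp Require Import complex.
From mathcomp Require Import all_classical all_reals all_analysis.
From mathcomp Require Import measurable_realfun.
From mathcomp Require Import ring lra zify.
Set Implicit Arguments.
Unset Strict Implicit.
Unset Printing Implicit Defensive.
Import Order.TTheory GRing.Theory Num.Theory.
Import numFieldNormedType.Exports.
Local Open Scope classical_set_scope.
Local Open Scope ring_scope.
Local Open Scope complex_scope.
Local Notation Re := complex.Re.
Local Notation Im := complex.Im.

(** * Complex numbers and complex-valued integrals *)

Section Cmod.
Context {R : realType}.
Implicit Types (z w : R[i]) (x y : R).

Lemma cmodE z : cmod z = Num.sqrt (complex.Re z ^+ 2 + complex.Im z ^+ 2).
Proof. by case: z. Qed.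

Lemma cmod_ge0 z : 0 <= cmod z.
Proof. by rewrite cmodE sqrtr_ge0. Qed.

Lemma normcE z : `|z| = (cmod z)%:C.
Proof. by case: z. Qed.

Lemma cmodD z w : cmod (z + w) <= cmod z + cmod w.
Proof. exact: le_normcD. Qed.

Lemma cmodM z w : cmod (z * w) = cmod z * cmod w.
Proof. exact: Normc.normcM. Qed.

Lemma cmodV z : cmod z^-1 = (cmod z)^-1.
Proof. exact: Normc.normcV. Qed.

Lemma cmodN z : cmod (- z) = cmod z.
Proof. exact: normcN. Qed.

Lemma cmod1 : cmod (1 : R[i]) = 1.
Proof. exact: Normc.normc1. Qed.

Lemma cmod0 : cmod (0 : R[i]) = 0.
Proof. exact: Normc.normc0. Qed.

Lemma cmodX z n : cmod (z ^+ n) = cmod z ^+ n.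
Proof. by elim: n => [|n IH]; rewrite ?expr0 ?cmod1// !exprS cmodM IH. Qed.

Lemma cmodB z w : cmod (z - w) <= cmod z + cmod w.
Proof. by rewrite -(cmodN w) cmodD. Qed.

Lemma cmodBC z w : cmod (z - w) = cmod (w - z).
Proof. by rewrite -cmodN opprB. Qed.

Lemma cmodBD v z w : cmod (z - w) <= cmod (z - v) + cmod (v - w).
Proof. by rewrite (_ : z - w = z - v + (v - w)) ?cmodD//; ring. Qed.

Lemma cmod_ler_dist z w : cmod z - cmod w <= cmod (z - w).
Proof. by rewrite lerBlDr -{1}(subrK w z) cmodD. Qed.

Lemma cmod_eq0 z : (cmod z == 0) = (z == 0).
Proof. by apply/eqP/eqP => [/Normc.eq0_normc|->] //; rewrite cmod0. Qed.

Lemma cmod_gt0 z : (0 < cmod z) = (z != 0).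
Proof. by rewrite lt_def cmod_ge0 cmod_eq0 andbT. Qed.

Lemma cmodR x : cmod x%:C = `|x|.
Proof. by rewrite cmodE /= expr0n /= addr0 sqrtr_sqr. Qed.

Lemma cmod_conj z : cmod z^* = cmod z.
Proof. by case: z => a b; rewrite !cmodE /= sqrrN. Qed.

Lemma cmod_sqr z : cmod z ^+ 2 = complex.Re z ^+ 2 + complex.Im z ^+ 2.
Proof. by rewrite cmodE sqr_sqrtr// addr_ge0// sqr_ge0. Qed.

Lemma mul_conjc z : z * z^* = (cmod z ^+ 2)%:C.
Proof. by rewrite cmod_sqr; case: z => a b; simpc; congr (_ +i* _); ring. Qed.

Lemma cmod_Re z : `|complex.Re z| <= cmod z.
Proof.
rewrite -[leLHS]sqrtr_sqr cmodE ler_sqrt ?lerDl ?sqr_ge0//.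
by rewrite addr_ge0 ?sqr_ge0.
Qed.

Lemma cmod_Im z : `|complex.Im z| <= cmod z.
Proof.
rewrite -[leLHS]sqrtr_sqr cmodE ler_sqrt ?lerDr ?sqr_ge0//.
by rewrite addr_ge0 ?sqr_ge0.
Qed.

Lemma cmod_ReIm z : cmod z <= `|complex.Re z| + `|complex.Im z|.
Proof.
rewrite -ler_sqr ?nnegrE ?cmod_ge0 ?addr_ge0// cmod_sqr sqrrD !real_normK ?num_real//.
by rewrite lerD2r lerDl mulrn_wge0 // mulr_ge0.
Qed.

Lemma cmod_sum I (r : seq I) (P : pred I) (F : I -> R[i]) :
  cmod (\sum_(i <- r | P i) F i) <= \sum_(i <- r | P i) cmod (F i).
Proof.
elim/big_ind2: _ => [|x1 x2 y1 y2 h1 h2|//]; first by rewrite cmod0.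
exact: le_trans (cmodD _ _) (lerD h1 h2).
Qed.

Lemma cReD z w : complex.Re (z + w) = complex.Re z + complex.Re w.
Proof. by case: z; case: w. Qed.
Lemma cImD z w : complex.Im (z + w) = complex.Im z + complex.Im w.
Proof. by case: z; case: w. Qed.
Lemma cReN z : complex.Re (- z) = - complex.Re z. Proof. by case: z. Qed.
Lemma cImN z : complex.Im (- z) = - complex.Im z. Proof. by case: z. Qed.
Lemma cReM z w : complex.Re (z * w) =
  complex.Re z * complex.Re w - complex.Im z * complex.Im w.
Proof. by case: z; case: w. Qed.
Lemma cImM z w : complex.Im (z * w) =
  complex.Re z * complex.Im w + complex.Im z * complex.Re w.
Proof. by case: z => a b; case: w => c d; rewrite /= . Qed.
Lemma cReV z : complex.Re z^-1 = complex.Re z / cmod z ^+ 2.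
Proof. by rewrite cmod_sqr; case: z. Qed.
Lemma cImV z : complex.Im z^-1 = - complex.Im z / cmod z ^+ 2.
Proof. by rewrite cmod_sqr; case: z => a b /=; rewrite mulNr. Qed.

Lemma eqc z w : complex.Re z = complex.Re w -> complex.Im z = complex.Im w -> z = w.
Proof. by case: z; case: w => a b c d /= -> ->. Qed.

Lemma cconj_sub1 z : (1 - z)^* = 1 - z^*.
Proof. by case: z => a b; apply: eqc => /=; rewrite ?sub0r ?opprK. Qed.

(** The norm of [R[i]] takes values in [R[i]], so the radii of its balls are complex. A positive one
    has zero imaginary part, which allows real radii and [cmod] instead. *)
Lemma nbhsC (z : R[i]) (P : set R[i]) :
  nbhs z P <-> exists2 e : R, 0 < e & forall w, cmod (w - z) < e -> P w.
Proof.
rewrite -nbhs_ballE; split=> [[e /= e0 eP]|[e e0 eP]].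
  have ee : e = (complex.Re e)%:C by case: e e0 {eP} => a b; rewrite ltcE /= => /andP[/eqP -> _].
  exists (complex.Re e); first by move: e0; rewrite ltcE /= => /andP[_].
  move=> w we; apply: eP; rewrite /ball /= ee normcE ltcR cmodBC //.
exists e%:C => /=; first by rewrite ltcR.
by move=> w; rewrite /ball /= normcE ltcR cmodBC => /eP.
Qed.

Lemma cvgCP (T : Type) (F : set_system T) {FF : Filter F} (f : T -> R[i]) (l : R[i]) :
  f @ F --> l <-> forall e : R, 0 < e -> \forall x \near F, cmod (f x - l) < e.
Proof.
split=> [fl e e0|fl A /nbhsC[e e0 eA]].
  by apply: (fl [set w | cmod (w - l) < e]); apply/nbhsC; exists e.
by apply: filterS (fl e e0) => x; exact: eA.
Qed.
End Cmod.

Section CIntegral.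
Context {R : realType} d (T : measurableType d).
Variables (mu : {measure set T -> \bar R}) (D : set T) (mD : measurable D).
Implicit Types (f g h : T -> R[i]) (c : R[i]).

Definition cmeasurable f :=
  measurable_fun D (fun x => Re (f x)) /\ measurable_fun D (fun x => Im (f x)).

Lemma cmeasurableD f g : cmeasurable f -> cmeasurable g ->
  cmeasurable (fun x => f x + g x).
Proof.
move=> [f1 f2] [g1 g2]; split.
- by under eq_fun do rewrite cReD; apply: measurable_funD.
- by under eq_fun do rewrite cImD; apply: measurable_funD.
Qed.

Lemma cmeasurableM f g : cmeasurable f -> cmeasurable g ->
  cmeasurable (fun x => f x * g x).
Proof.
move=> [f1 f2] [g1 g2]; split.
- by under eq_fun do rewrite cReM; apply: measurable_funB; apply: measurable_funM.
- by under eq_fun do rewrite cImM; apply: measurable_funD; apply: measurable_funM.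
Qed.

Lemma cmeasurable_cst c : cmeasurable (fun=> c).
Proof. by split; exact: measurable_cst. Qed.

Lemma cmeasurable_sum I (r : seq I) (P : pred I) (F : I -> T -> R[i]) :
  (forall i, cmeasurable (F i)) -> cmeasurable (fun x => \sum_(i <- r | P i) F i x).
Proof.
move=> mF; elim: r => [|i r IH].
  by under eq_fun do rewrite big_nil; exact: cmeasurable_cst.
under eq_fun do rewrite big_cons.
by case: (P i) => //; exact: cmeasurableD.
Qed.

Lemma cmeasurable_cmod f : cmeasurable f -> measurable_fun D (fun x => cmod (f x)).
Proof.
move=> [f1 f2]; under eq_fun do rewrite cmodE.
have ms : measurable_fun setT (@Num.sqrt R) := continuous_measurable_fun (@sqrt_continuous R).
have mq : measurable_fun D (fun x => Re (f x) ^+ 2 + Im (f x) ^+ 2).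
  by apply: measurable_funD; apply: measurable_funX.
exact: (measurableT_comp ms mq).
Qed.

Lemma cmeasurable_real (u : T -> R) : measurable_fun D u -> cmeasurable (fun x => (u x)%:C).
Proof. by move=> mu_; split => //=; exact: measurable_cst. Qed.

Lemma cintegrable_cmeasurable f : cintegrable mu D f -> cmeasurable f.
Proof.
by move=> [/measurable_int/measurable_EFinP f1 /measurable_int/measurable_EFinP f2].
Qed.

Lemma cintegrable_le f (u : T -> R) : cmeasurable f ->
  mu.-integrable D (EFin \o u) -> (forall x, D x -> cmod (f x) <= u x) ->
  cintegrable mu D f.
Proof.
move=> [f1 f2] ui fu; split; apply: (le_integrable mD _ _ ui).
- exact/measurable_EFinP.
- move=> x Dx /=; rewrite lee_fin (le_trans (cmod_Re _))// (le_trans (fu _ Dx))//.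
  exact: ler_norm.
- exact/measurable_EFinP.
- move=> x Dx /=; rewrite lee_fin (le_trans (cmod_Im _))// (le_trans (fu _ Dx))//.
  exact: ler_norm.
Qed.

Lemma integrable_cmod f : cintegrable mu D f ->
  mu.-integrable D (EFin \o (fun x => cmod (f x))).
Proof.
move=> fi; have [f1 f2] := fi.
have f3 : mu.-integrable D (EFin \o (fun x => `|Re (f x)| + `|Im (f x)|)).
  have := integrableD mD (integrable_norm f1) (integrable_norm f2).
  by apply: eq_integrable.
apply: (le_integrable mD _ _ f3).
  exact/measurable_EFinP/cmeasurable_cmod/cintegrable_cmeasurable.
move=> x Dx /=; rewrite lee_fin (ger0_norm (cmod_ge0 _)) (le_trans (cmod_ReIm _))//.
exact: ler_norm.
Qed.

Lemma eq_cintegrable f g : {in D, f =1 g} -> cintegrable mu D f -> cintegrable mu D g.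
Proof.
move=> fg [f1 f2]; split; [apply: eq_integrable f1 => // x xD|
  apply: eq_integrable f2 => // x xD]; by rewrite fg.
Qed.

Lemma eq_cintegral f g : {in D, f =1 g} -> cintegral mu D f = cintegral mu D g.
Proof. by move=> fg; congr (_ +i* _); apply: eq_Rintegral => x xD; rewrite fg. Qed.

Lemma cintegrableMb f h M : cintegrable mu D f -> cmeasurable h ->
  (forall x, D x -> cmod (h x) <= M) -> cintegrable mu D (fun x => h x * f x).
Proof.
move=> fi mh hM; apply: (@cintegrable_le _ (fun x => M * cmod (f x))).
- by apply: cmeasurableM => //; exact: cintegrable_cmeasurable.
- by have := integrableZl mD M (integrable_cmod fi); apply: eq_integrable.
- by move=> x Dx; rewrite cmodM ler_wpM2r ?cmod_ge0 ?hM.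
Qed.

Lemma cintegrableD f g : cintegrable mu D f -> cintegrable mu D g ->
  cintegrable mu D (fun x => f x + g x).
Proof.
move=> [f1 f2] [g1 g2]; split.
- by have := integrableD mD f1 g1; apply: eq_integrable => // x _; rewrite cReD.
- by have := integrableD mD f2 g2; apply: eq_integrable => // x _; rewrite cImD.
Qed.

Lemma cintegrableZ c f : cintegrable mu D f -> cintegrable mu D (fun x => c * f x).
Proof. by move=> fi; apply: (cintegrableMb (M := cmod c)) => //; exact: cmeasurable_cst. Qed.

Lemma cintegrableN f : cintegrable mu D f -> cintegrable mu D (fun x => - f x).
Proof. by move=> /(cintegrableZ (-1)); apply: eq_cintegrable => x _; rewrite mulN1r. Qed.

Lemma cintegrableB f g : cintegrable mu D f -> cintegrable mu D g ->
  cintegrable mu D (fun x => f x - g x).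
Proof. by move=> fi gi; apply: cintegrableD => //; exact: cintegrableN. Qed.

Lemma cintegrable0 : cintegrable mu D (fun=> 0).
Proof. by split; exact: integrable0. Qed.

Lemma cintegral0 : cintegral mu D (fun=> 0) = 0.
Proof. by rewrite /cintegral /Rintegral /= integral0. Qed.

Lemma cintegrable_sum I (r : seq I) (P : pred I) (F : I -> T -> R[i]) :
  (forall i, cintegrable mu D (F i)) ->
  cintegrable mu D (fun x => \sum_(i <- r | P i) F i x).
Proof.
move=> iF; elim: r => [|i r IH].
  by apply: eq_cintegrable cintegrable0 => x _; rewrite big_nil.
case Pi : (P i); last by apply: eq_cintegrable IH => x _; rewrite big_cons Pi.
by apply: eq_cintegrable (cintegrableD (iF i) IH) => x _; rewrite big_cons Pi.
Qed.

Lemma integrableRD (u v : T -> R) : mu.-integrable D (EFin \o u) ->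
  mu.-integrable D (EFin \o v) -> mu.-integrable D (EFin \o (fun x => u x + v x)).
Proof. by move=> ui vi; have := integrableD mD ui vi; apply: eq_integrable. Qed.

Lemma integrableRZ r (u : T -> R) : mu.-integrable D (EFin \o u) ->
  mu.-integrable D (EFin \o (fun x => r * u x)).
Proof. by move=> ui; have := integrableZl mD r ui; apply: eq_integrable. Qed.

Lemma cintegralD f g : cintegrable mu D f -> cintegrable mu D g ->
  cintegral mu D (fun x => f x + g x) = cintegral mu D f + cintegral mu D g.
Proof.
move=> [f1 f2] [g1 g2]; apply: eqc; rewrite ?cReD ?cImD /= -RintegralD//;
  by apply: eq_Rintegral => x _; rewrite ?cReD ?cImD.
Qed.

Lemma cintegralZ c f : cintegrable mu D f ->
  cintegral mu D (fun x => c * f x) = c * cintegral mu D f.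
Proof.
move=> [f1 f2]; apply: eqc; rewrite ?cReM ?cImM /= -!RintegralZl//.
- rewrite -RintegralB//; try exact: integrableRZ.
  by apply: eq_Rintegral => x _; rewrite cReM.
- rewrite -RintegralD//; try exact: integrableRZ.
  by apply: eq_Rintegral => x _; rewrite cImM.
Qed.

Lemma cintegralN f : cintegrable mu D f ->
  cintegral mu D (fun x => - f x) = - cintegral mu D f.
Proof.
by move=> fi; rewrite -mulN1r -cintegralZ//; apply: eq_cintegral => x _; rewrite mulN1r.
Qed.

Lemma cintegralB f g : cintegrable mu D f -> cintegrable mu D g ->
  cintegral mu D (fun x => f x - g x) = cintegral mu D f - cintegral mu D g.
Proof.
by move=> fi gi; rewrite cintegralD ?cintegralN//; exact: cintegrableN.
Qed.

Lemma cintegral_sum I (r : seq I) (P : pred I) (F : I -> T -> R[i]) :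
  (forall i, cintegrable mu D (F i)) ->
  cintegral mu D (fun x => \sum_(i <- r | P i) F i x) =
  \sum_(i <- r | P i) cintegral mu D (F i).
Proof.
move=> iF; elim: r => [|i r IH].
  by rewrite big_nil -[RHS]cintegral0; apply: eq_cintegral => x _; rewrite big_nil.
rewrite big_cons -IH; case Pi : (P i).
  rewrite -cintegralD//; last exact: cintegrable_sum.
  by apply: eq_cintegral => x _; rewrite big_cons Pi.
by apply: eq_cintegral => x _; rewrite big_cons Pi.
Qed.

(* Rotating the integral onto the positive real axis reduces this to the real case. *)
Lemma cmod_cintegral f : cintegrable mu D f ->
  cmod (cintegral mu D f) <= \int[mu]_(x in D) cmod (f x).
Proof.
move=> fi; set I := cintegral mu D f.
have [->|I0] := eqVneq I 0; first by rewrite cmod0 Rintegral_ge0// => x _; exact: cmod_ge0.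
have cI0 : 0 < cmod I by rewrite cmod_gt0.
rewrite -(ler_pM2l cI0) -expr2 -RintegralZl//; last exact: integrable_cmod.
have -> : cmod I ^+ 2 = Re (cintegral mu D (fun x => I^* * f x)).
  by rewrite cintegralZ// -/I mulrC mul_conjc.
apply: le_Rintegral => //.
- by have [] := cintegrableZ (I^*) fi.
- by have := integrableZl mD (cmod I) (integrable_cmod fi); apply: eq_integrable.
- move=> x Dx; rewrite (le_trans (ler_norm _))// (le_trans (cmod_Re _))//.
  by rewrite cmodM cmod_conj.
Qed.

Lemma cintegralR (u : T -> R) : cintegral mu D (fun x => (u x)%:C) = (\int[mu]_(x in D) u x)%:C.
Proof. by rewrite /cintegral /=; congr (_ +i* _); rewrite /Rintegral integral0. Qed.

Lemma cintegrableR (u : T -> R) : mu.-integrable D (EFin \o u) ->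
  cintegrable mu D (fun x => (u x)%:C).
Proof. by move=> ui; split => //=; exact: integrable0. Qed.

Lemma cintegral_conj f : cintegrable mu D f ->
  cintegral mu D (fun x => (f x)^*) = (cintegral mu D f)^*.
Proof.
move=> [f1 f2]; rewrite /cintegral /=; congr (_ +i* _).
  by apply: eq_Rintegral => x _; case: (f x).
rewrite -mulN1r -RintegralZl//.
by apply: eq_Rintegral => x _; case: (f x) => a b /=; rewrite mulN1r.
Qed.

End CIntegral.

(** * Fourier coefficients on the circle *)

Section Circle.
Context {R : realType}.
Implicit Types (f g : R -> R[i]) (u v : R[i]).
Local Notation mu := (@lebesgue_measure R).
Local Notation mR := (measurableTypeR R).
Local Notation cmeasurable := (@cmeasurable R _ mR).

Lemma Rintegral_FTC (F f : R -> R) (a b : R) : a < b ->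
  (forall x : R, is_derive x 1 F (f x)) -> continuous f ->
  \int[mu]_(x in `[a, b]) f x = F b - F a.
Proof.
move=> ab dF cf; rewrite /Rintegral (continuous_FTC2 (F := F)) //.
- by apply: continuous_subspaceT.
- have cF x : {for x, continuous F}.
    by apply: differentiable_continuous; apply/derivable1_diffP; case: (dF x).
  split; first by move=> x _; case: (dF x).
  + by apply: cvg_at_right_filter; exact: cF.
  + by apply: cvg_at_left_filter; exact: cF.
- by move=> x _; rewrite derive1E; apply: derive_val.
Qed.

Lemma continuous_integrable (f : R -> R) (a b : R) : continuous f ->
  mu.-integrable `[a, b] (EFin \o f).
Proof.
move=> cf; apply: continuous_compact_integrable; first exact: segment_compact.
exact: continuous_subspaceT.
Qed.

(** Continuity is kept on the two real components, the form from which measurability and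
    integrability of real functions follow. *)
Definition ccontinuous f :=
  continuous (fun t => Re (f t) : R) /\ continuous (fun t => Im (f t) : R).

Lemma ccontinuousD f g : ccontinuous f -> ccontinuous g ->
  ccontinuous (fun t => f t + g t).
Proof.
move=> [f1 f2] [g1 g2]; split => t.
- by under eq_fun do rewrite cReD; apply: cvgD; [exact: f1|exact: g1].
- by under eq_fun do rewrite cImD; apply: cvgD; [exact: f2|exact: g2].
Qed.

Lemma ccontinuousN f : ccontinuous f -> ccontinuous (fun t => - f t).
Proof.
move=> [f1 f2]; split => t.
- by under eq_fun do rewrite cReN; apply: cvgN; exact: f1.
- by under eq_fun do rewrite cImN; apply: cvgN; exact: f2.
Qed.

Lemma ccontinuousM f g : ccontinuous f -> ccontinuous g ->
  ccontinuous (fun t => f t * g t).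
Proof.
move=> [f1 f2] [g1 g2]; split => t.
- under eq_fun do rewrite cReM.
  by apply: cvgB; apply: cvgM; [exact: f1|exact: g1|exact: f2|exact: g2].
- under eq_fun do rewrite cImM.
  by apply: cvgD; apply: cvgM; [exact: f1|exact: g2|exact: f2|exact: g1].
Qed.

Lemma ccontinuous_cst (c : R[i]) : ccontinuous (fun=> c).
Proof. by split => t; exact: cvg_cst. Qed.

Lemma ccontinuousX f n : ccontinuous f -> ccontinuous (fun t => f t ^+ n).
Proof.
move=> cf; elim: n => [|n IH]; first exact: ccontinuous_cst.
by under eq_fun do rewrite exprS; exact: ccontinuousM.
Qed.

Lemma ccontinuous_sum I (r : seq I) (P : pred I) (F : I -> R -> R[i]) :
  (forall i, ccontinuous (F i)) -> ccontinuous (fun x => \sum_(i <- r | P i) F i x).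
Proof.
move=> cF; elim: r => [|i r IH].
  by under eq_fun do rewrite big_nil; exact: ccontinuous_cst.
under eq_fun do rewrite big_cons.
by case: (P i) => //; exact: ccontinuousD.
Qed.

Lemma ccontinuousV f : ccontinuous f -> (forall t, f t != 0) ->
  ccontinuous (fun t => (f t)^-1).
Proof.
move=> [f1 f2] f0.
have cV : continuous (fun t => (cmod (f t) ^+ 2)^-1 : R).
  move=> t; apply: cvgV; first by rewrite expf_neq0// cmod_eq0.
  under eq_fun do rewrite cmod_sqr !expr2.
  by rewrite cmod_sqr !expr2; apply: cvgD; apply: cvgM; [exact: f1|exact: f1|exact: f2|exact: f2].
split => t.
- rewrite (_ : (fun t => _) = (fun t => Re (f t) * (cmod (f t) ^+ 2)^-1)).
    by apply: cvgM; [exact: f1|exact: cV].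
  by apply/funext => s; rewrite cReV.
- rewrite (_ : (fun t => _) = (fun t => - Im (f t) * (cmod (f t) ^+ 2)^-1)).
    by apply: cvgM; [apply: cvgN; exact: f2|exact: cV].
  by apply/funext => s; rewrite cImV.
Qed.

Lemma ccontinuous_conj f : ccontinuous f -> ccontinuous (fun t => (f t)^*).
Proof.
move=> [f1 f2]; split.
- by rewrite (_ : (fun t => _) = (fun t => Re (f t)))//; apply/funext => t; case: (f t).
- rewrite (_ : (fun t => _) = (fun t => - Im (f t))); last by apply/funext => t; case: (f t).
  by move=> t; apply: cvgN; exact: f2.
Qed.

Lemma ccontinuous_cmeasurable (D : set mR) f : measurable D -> ccontinuous f -> cmeasurable D f.
Proof.
by move=> mD [f1 f2]; split; apply: measurable_funTS; exact: continuous_measurable_fun.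
Qed.

Lemma ccontinuous_cintegrable a b f : ccontinuous f -> cintegrable mu `[a, b] f.
Proof. by move=> [f1 f2]; split; exact: continuous_integrable. Qed.

Definition cis (t : R) : R[i] := cos t +i* sin t.

Lemma cmod_cis t : cmod (cis t) = 1.
Proof. by rewrite cmodE /= cos2Dsin2 sqrtr1. Qed.

Lemma cis_neq0 t : cis t != 0.
Proof. by rewrite -cmod_eq0 cmod_cis oner_eq0. Qed.

Lemma cisD s t : cis (s + t) = cis s * cis t.
Proof. by apply: eqc; rewrite ?cReM ?cImM /= ?cosD ?sinD; ring. Qed.

Lemma cis0 : cis 0 = 1.
Proof. by rewrite /cis cos0 sin0. Qed.

Lemma cisX t n : cis t ^+ n = cis (n%:R * t).
Proof.
elim: n => [|n IH]; first by rewrite mul0r cis0.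
by rewrite exprS IH -cisD -[in RHS]natr1 mulrDl mul1r addrC.
Qed.

Lemma conj_cis t : (cis t)^* = (cis t)^-1.
Proof.
by apply: (mulfI (cis_neq0 t)); rewrite mul_conjc cmod_cis expr1n divff ?cis_neq0.
Qed.

Lemma ccontinuous_cis : ccontinuous cis.
Proof. by split => /= t; [exact: continuous_cos|exact: continuous_sin]. Qed.

Lemma ccontinuous_cisV : ccontinuous (fun t => (cis t)^-1).
Proof. by apply: ccontinuousV; [exact: ccontinuous_cis|exact: cis_neq0]. Qed.

Lemma pi2_gt0 : 0 < 2 * pi :> R.
Proof. by rewrite mulr_gt0// pi_gt0. Qed.

Lemma sin_2npi n : sin (n%:R * (2 * pi)) = 0 :> R.
Proof.
have -> : 2 * pi = pi *+ 2 :> R by rewrite mulr_natl.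
elim: n => [|n IH]; first by rewrite mul0r sin0.
by rewrite -natr1 mulrDl mul1r sinD IH sin2pi mulr0 mul0r addr0.
Qed.

Lemma cos_2npi n : cos (n%:R * (2 * pi)) = 1 :> R.
Proof.
have p2 : 2 * pi = pi *+ 2 :> R by rewrite mulr_natl.
elim: n => [|n IH]; first by rewrite mul0r cos0.
by rewrite -natr1 mulrDl mul1r cosD IH sin_2npi mul0r subr0 mul1r p2 cos2pi.
Qed.

Lemma Rintegral_itv_cst (a b c : R) : a <= b -> \int[mu]_(t in `[a, b]) c = c * (b - a).
Proof.
by move=> ab; rewrite Rintegral_cst//= lebesgue_measure_itv /= lte_fin; case: ltgtP ab => // -> _; rewrite subrr.
Qed.

Lemma Rintegral_cosn (n : nat) (a b : R) : a < b -> (0 < n)%N ->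
  \int[mu]_(t in `[a, b]) cos (n%:R * t) = n%:R^-1 * (sin (n%:R * b) - sin (n%:R * a)).
Proof.
move=> ab n0; have n0' : n%:R != 0 :> R by rewrite pnatr_eq0 -lt0n.
have dF (x : R) : is_derive x (1 : R) (fun t => n%:R^-1 * sin (n%:R * t)) (cos (n%:R * x)).
  apply: is_derive_eq; rewrite /GRing.scale /=.
  by rewrite !(mulr0, addr0, mulr1, add0r) mulrCA mulVf ?mulr1.
rewrite (Rintegral_FTC ab dF) ?mulrBr// => x.
apply: continuous_comp; last exact: continuous_cos.
by apply: cvgM; [exact: cvg_cst|exact: cvg_id].
Qed.

Lemma Rintegral_sinn (n : nat) (a b : R) : a < b -> (0 < n)%N ->
  \int[mu]_(t in `[a, b]) sin (n%:R * t) = - n%:R^-1 * (cos (n%:R * b) - cos (n%:R * a)).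
Proof.
move=> ab n0; have n0' : n%:R != 0 :> R by rewrite pnatr_eq0 -lt0n.
have dF (x : R) : is_derive x (1 : R) (fun t => - n%:R^-1 * cos (n%:R * t)) (sin (n%:R * x)).
  apply: is_derive_eq; rewrite /GRing.scale /=.
  rewrite !(mulr0, addr0, mulr1, add0r).
  by rewrite mulNr mulNr mulrN opprK mulrCA mulVf ?mulr1.
rewrite (Rintegral_FTC ab dF) ?mulrBr// => x.
apply: continuous_comp; last exact: continuous_sin.
by apply: cvgM; [exact: cvg_cst|exact: cvg_id].
Qed.

Local Notation T2 := `[0%R, (2 * pi)%R]%classic.

Lemma cintegral_cisX n : cintegral mu T2 (fun t => cis t ^+ n) =
  if n == 0%N then (2 * pi)%:C else 0.
Proof.
rewrite (_ : (fun t => _) = (fun t => cis (n%:R * t))); last by apply/funext => t; rewrite cisX.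
case: n => [|n] /=.
  rewrite (_ : (fun t => _) = (fun t => 1 +i* 0)); last by apply/funext => t; rewrite mul0r cis0.
  apply: eqc => /=; first by rewrite Rintegral_itv_cst ?ltW ?pi2_gt0// mul1r subr0.
  by rewrite Rintegral_itv_cst ?ltW ?pi2_gt0// mul0r.
apply: eqc => /=.
- by rewrite Rintegral_cosn ?pi2_gt0// sin_2npi mulr0 sin0 subr0 mulr0.
- by rewrite Rintegral_sinn ?pi2_gt0// cos_2npi mulr0 cos0 subrr mulr0.
Qed.

Lemma cintegral_cisVX n : cintegral mu T2 (fun t => (cis t)^-1 ^+ n) =
  if n == 0%N then (2 * pi)%:C else 0.
Proof.
rewrite (_ : (fun t => _) = (fun t => (cis t ^+ n)^*)); last first.
  by apply/funext => t; rewrite rmorphXn -conj_cis.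
rewrite (cintegral_conj (mu := mu) (measurable_itv _)); last first.
  by apply: ccontinuous_cintegrable; apply: ccontinuousX; exact: ccontinuous_cis.
rewrite cintegral_cisX; case: ifP => _; last by rewrite rmorph0.
by apply: eqc => //=; rewrite oppr0.
Qed.

Lemma cintegral_cis_ortho k l : cintegral mu T2 (fun t => cis t ^+ k * (cis t)^-1 ^+ l) =
  if k == l then (2 * pi)%:C else 0.
Proof.
have [lk|kl] := leqP l k.
  rewrite (_ : (fun t => _) = (fun t => cis t ^+ (k - l))); last first.
    apply/funext => t; rewrite exprVn -{1}(subnK lk) exprD mulfK//.
    by rewrite expf_neq0 ?cis_neq0.
  by rewrite cintegral_cisX subn_eq0 eqn_leq lk andbT.
rewrite (_ : (fun t => _) = (fun t => (cis t)^-1 ^+ (l - k))); last first.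
  apply/funext => t; rewrite -{1}(subnK (ltnW kl)) exprD mulrCA -exprMn.
  by rewrite divff ?cis_neq0// expr1n mulr1.
by rewrite cintegral_cisVX subn_eq0 leqNgt kl /= ltn_eqF.
Qed.

Definition trigpoly (c : nat -> R[i]) n t := \sum_(k < n) c k * cis t ^+ k.

Lemma ccontinuous_trigpoly c n : ccontinuous (trigpoly c n).
Proof.
apply: ccontinuous_sum => k; apply: ccontinuousM; first exact: ccontinuous_cst.
by apply: ccontinuousX; exact: ccontinuous_cis.
Qed.

Lemma ccontinuous_sqr f : ccontinuous f -> continuous (fun t => cmod (f t) ^+ 2 : R).
Proof.
move=> [f1 f2] t.
rewrite (_ : (fun t => _) = (fun t => Re (f t) * Re (f t) + Im (f t) * Im (f t))); last first.
  by apply/funext => s; rewrite cmod_sqr !expr2.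
by apply: cvgD; apply: cvgM; [exact: f1|exact: f1|exact: f2|exact: f2].
Qed.

Lemma parseval_trigpoly c n :
  \int[mu]_(t in T2) (cmod (trigpoly c n t) ^+ 2) = 2 * pi * \sum_(k < n) cmod (c k) ^+ 2.
Proof.
apply: (@complexI R); rewrite -cintegralR.
rewrite (_ : (fun t => _) = (fun t => \sum_(k < n) \sum_(l < n)
    c k * (c l)^* * (cis t ^+ k * (cis t)^-1 ^+ l))); last first.
  apply/funext => t; rewrite -mul_conjc /trigpoly rmorph_sum mulr_suml.
  apply: eq_bigr => k _; rewrite mulr_sumr; apply: eq_bigr => l _.
  by rewrite rmorphM rmorphXn -conj_cis mulrACA.
have iF (k l : nat) : cintegrable mu T2 (fun t => c k * (c l)^* * (cis t ^+ k * (cis t)^-1 ^+ l)).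
  apply: ccontinuous_cintegrable; apply: ccontinuousM; first exact: ccontinuous_cst.
  by apply: ccontinuousM; apply: ccontinuousX; [exact: ccontinuous_cis|exact: ccontinuous_cisV].
rewrite cintegral_sum //; last by move=> k; exact: cintegrable_sum.
rewrite rmorphM rmorph_sum /= mulr_sumr; apply: eq_bigr => k _.
rewrite cintegral_sum// (bigD1 k) //= big1 ?addr0; last first.
  move=> l lk; rewrite cintegralZ//; last first.
    apply: ccontinuous_cintegrable.
    by apply: ccontinuousM; apply: ccontinuousX; [exact: ccontinuous_cis|exact: ccontinuous_cisV].
  by rewrite cintegral_cis_ortho eq_sym (negbTE lk : (l == k :> nat) = _) mulr0.
rewrite cintegralZ//; last first.
  apply: ccontinuous_cintegrable.
  by apply: ccontinuousM; apply: ccontinuousX; [exact: ccontinuous_cis|exact: ccontinuous_cisV].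
by rewrite cintegral_cis_ortho eqxx mul_conjc mulrC.
Qed.

(** Since [(cis t)^-1 ^+ k] is e^(-ikt), this is the usual Fourier coefficient, recorded for
    frequencies k >= 0 only: these are the ones that the Cauchy transform sees. *)
Definition fcoef g k : R[i] :=
  ((2 * pi)^-1)%:C * cintegral mu T2 (fun t => g t * (cis t)^-1 ^+ k).

Lemma cmod_cisVX t k : cmod ((cis t)^-1 ^+ k) = 1.
Proof. by rewrite cmodX cmodV cmod_cis invr1 expr1n. Qed.

Lemma cintegrable_mul_cisVX g k : cintegrable mu T2 g ->
  cintegrable mu T2 (fun t => g t * (cis t)^-1 ^+ k).
Proof.
move=> gi; rewrite (_ : (fun t => _) = (fun t => (cis t)^-1 ^+ k * g t)); last by apply/funext => t; rewrite mulrC.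
apply: (cintegrableMb (mu := mu) (measurable_itv _) (M := 1)) => //.
  by apply: ccontinuous_cmeasurable => //; apply: ccontinuousX; exact: ccontinuous_cisV.
by move=> t _; rewrite cmod_cisVX.
Qed.

(** On a bounded interval the constant 1 is integrable, and |g| <= 1 + |g|^2. *)
Lemma sqr_cintegrable (D : set mR) g (a b : R) : D = `[a, b]%classic -> cmeasurable D g ->
  mu.-integrable D (EFin \o (fun t => cmod (g t) ^+ 2)) -> cintegrable mu D g.
Proof.
move=> DE mg g2; have mD : measurable D by rewrite DE.
apply: (cintegrable_le (mu := mu) mD mg (u := fun t => 1 + cmod (g t) ^+ 2)).
  have i1 : mu.-integrable D (EFin \o (fun=> 1 : R)).
    by rewrite DE; apply: continuous_integrable => t; exact: cvg_cst.
  exact: integrableRD.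
move=> t _; have := sqr_ge0 (1 - cmod (g t)); have := cmod_ge0 (g t); nra.
Qed.

(** With [S] the partial Fourier sum, the integrals of g conj(S) and of |S|^2 both equal
    [2 * pi * s]. Integrating |g conj(S)| <= (|g|^2 + |S|^2) / 2 then gives the claim. *)
Lemma bessel g n : cmeasurable T2 g ->
  mu.-integrable T2 (EFin \o (fun t => cmod (g t) ^+ 2)) ->
  2 * pi * \sum_(k < n) cmod (fcoef g k) ^+ 2 <= \int[mu]_(t in T2) (cmod (g t) ^+ 2).
Proof.
move=> mg g2; have gi := sqr_cintegrable erefl mg g2.
set S := trigpoly (fcoef g) n; set s := \sum_(k < n) _.
have cS : ccontinuous S by exact: ccontinuous_trigpoly.
have mS : cmeasurable T2 S by exact: ccontinuous_cmeasurable.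
have S2 : mu.-integrable T2 (EFin \o (fun t => cmod (S t) ^+ 2)).
  by apply: continuous_integrable; exact: ccontinuous_sqr.
have IgS : cintegral mu T2 (fun t => g t * (S t)^*) = (2 * pi * s)%:C.
  rewrite (_ : (fun t => _) =
      (fun t => \sum_(k < n) (fcoef g k)^* * (g t * (cis t)^-1 ^+ k))); last first.
    apply/funext => t; rewrite rmorph_sum mulr_sumr; apply: eq_bigr => k _.
    by rewrite rmorphM rmorphXn -conj_cis mulrCA.
  have igk (k : nat) := cintegrable_mul_cisVX k gi.
  have fE k : cintegral mu T2 (fun t => g t * (cis t)^-1 ^+ k) = (2 * pi)%:C * fcoef g k.
    by rewrite /fcoef mulrA -rmorphM /= divff ?mul1r// gt_eqF ?pi2_gt0.
  rewrite cintegral_sum//; last by move=> k; apply: cintegrableZ => //; exact: igk.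
  rewrite /s mulr_sumr rmorph_sum; apply: eq_bigr => k _.
  rewrite (cintegralZ (mu := mu) (measurable_itv _)); last exact: igk.
  rewrite fE; move: (fcoef g k) => z; transitivity ((2 * pi)%:C * (z * z^*)); first by ring.
  by rewrite mul_conjc; apply: eqc; rewrite ?cReM ?cImM /=; ring.
have gSle t : cmod (g t * (S t)^*) <= 2^-1 * (cmod (g t) ^+ 2 + cmod (S t) ^+ 2).
  by rewrite cmodM cmod_conj; have := sqr_ge0 (cmod (g t) - cmod (S t)); nra.
have igS : mu.-integrable T2 (EFin \o (fun t => cmod (g t) ^+ 2 + cmod (S t) ^+ 2)).
  exact: integrableRD.
have gSi : cintegrable mu T2 (fun t => g t * (S t)^*).
  apply: (cintegrable_le (mu := mu) _ _ (integrableRZ (mu := mu) (measurable_itv _) 2^-1 igS)) => //.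
  by apply: cmeasurableM => //; apply: ccontinuous_cmeasurable => //; exact: ccontinuous_conj.
have := @cmod_cintegral _ _ _ mu _ (measurable_itv _) _ gSi; rewrite IgS cmodR => h1.
have h2 : \int[mu]_(t in T2) cmod (g t * (S t)^*) <=
    \int[mu]_(t in T2) (2^-1 * (cmod (g t) ^+ 2 + cmod (S t) ^+ 2)).
  apply: le_Rintegral => //; first exact: (integrable_cmod (mu := mu)).
  exact: (integrableRZ (mu := mu)).
move: (le_trans (ler_norm _) (le_trans h1 h2)).
rewrite RintegralZl// RintegralD// parseval_trigpoly -/s; lra.
Qed.

(** The remainder of the geometric series is (uU)^N / (1 - uU), and |1 - uU| >= 1 - |u|. Taking [U]
    to be the inverse of [cis] gives the Cauchy kernel of the disc, and [U] = [cis] its conjugate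
    counterpart. *)
Lemma geo_remainder (D : set mR) (U g : R -> R[i]) u N : measurable D ->
  ccontinuous U -> (forall t, cmod (U t) = 1) -> cmod u < 1 -> cintegrable mu D g ->
  cintegrable mu D (fun t => g t / (1 - u * U t)) /\
  cmod (cintegral mu D (fun t => g t / (1 - u * U t)) -
        \sum_(m < N) u ^+ m * cintegral mu D (fun t => g t * U t ^+ m)) <=
  cmod u ^+ N / (1 - cmod u) * \int[mu]_(t in D) cmod (g t).
Proof.
move=> mD cU U1 u1 gi.
have d0 t : 1 - cmod u <= cmod (1 - u * U t).
  by rewrite (le_trans _ (cmod_ler_dist _ _))// cmodM U1 mulr1 cmod1.
have u1' : 0 < 1 - cmod u by rewrite subr_gt0.
have n0 t : 1 - u * U t != 0 by rewrite -cmod_gt0 (lt_le_trans u1').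
have mV : cmeasurable D (fun t => (1 - u * U t)^-1).
  apply: ccontinuous_cmeasurable => //; apply: ccontinuousV => //.
  apply: ccontinuousD; first exact: ccontinuous_cst.
  by apply: ccontinuousN; apply: ccontinuousM => //; exact: ccontinuous_cst.
have mU m : cmeasurable D (fun t => U t ^+ m).
  by apply: ccontinuous_cmeasurable => //; exact: ccontinuousX.
have i1 : cintegrable mu D (fun t => g t / (1 - u * U t)).
  rewrite (_ : (fun t => _) = (fun t => (1 - u * U t)^-1 * g t)); last by apply/funext => t; rewrite mulrC.
  apply: (cintegrableMb (mu := mu) mD (M := (1 - cmod u)^-1)) => // t _.
  by rewrite cmodV lef_pV2 ?posrE// (lt_le_trans u1').
have i2 m : cintegrable mu D (fun t => g t * U t ^+ m).
  rewrite (_ : (fun t => _) = (fun t => U t ^+ m * g t)); last by apply/funext => t; rewrite mulrC.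
  by apply: (cintegrableMb (mu := mu) mD (M := 1)) => // t _; rewrite cmodX U1 expr1n.
split => //.
under eq_bigr => m _ do rewrite -cintegralZ//.
rewrite -cintegral_sum//; last by move=> m; exact: cintegrableZ.
rewrite -cintegralB//; last by apply: cintegrable_sum => // m; exact: cintegrableZ.
have iB : cintegrable mu D (fun t => g t / (1 - u * U t) -
    \sum_(m < N) u ^+ m * (g t * U t ^+ m)).
  by apply: cintegrableB => //; apply: cintegrable_sum => // m; exact: cintegrableZ.
apply: (le_trans (cmod_cintegral (mu := mu) mD iB)).
rewrite -RintegralZl//; last exact: integrable_cmod.
apply: le_Rintegral => //; first exact: integrable_cmod.
  by have := integrableZl mD (cmod u ^+ N / (1 - cmod u)) (integrable_cmod (mu := mu) mD gi); apply: eq_integrable.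
move=> t Dt; rewrite (_ : _ - _ = g t * ((u * U t) ^+ N / (1 - u * U t))); last first.
  apply: (mulIf (n0 t)); rewrite -[RHS]mulrA divfK// mulrBl divfK//.
  have -> : \sum_(m < N) u ^+ m * (g t * U t ^+ m) = g t * \sum_(m < N) (u * U t) ^+ m.
    by rewrite mulr_sumr; apply: eq_bigr => m _; rewrite exprMn mulrCA.
  have := subrX1 (u * U t) N; move: (\sum_(m < N) _) => s hs.
  have -> : (u * U t) ^+ N = 1 + (u * U t - 1) * s by rewrite -hs; ring.
  ring.
rewrite cmodM mulrC ler_wpM2r ?cmod_ge0// cmodM cmodX cmodM U1 mulr1 cmodV.
by rewrite ler_wpM2l ?exprn_ge0 ?cmod_ge0// lef_pV2 ?posrE// (lt_le_trans u1').
Qed.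

End Circle.

(** * Limits of complex functions and dominated convergence *)

Section ComplexLimits.
Context {R : realType}.

Lemma cvgC_ReIm (T : Type) (F : set_system T) {FF : Filter F} (f : T -> R[i]) (l : R[i]) :
  (fun x => Re (f x)) @ F --> Re l -> (fun x => Im (f x)) @ F --> Im l -> f @ F --> l.
Proof.
move=> f1 f2; apply/cvgCP => e e0.
have e2 : 0 < e / 2 by rewrite divr_gt0.
move/cvgrPdist_lt : f1 => /(_ _ e2) f1; move/cvgrPdist_lt : f2 => /(_ _ e2) f2.
near=> x; rewrite (le_lt_trans (cmod_ReIm _))// cReD cImD cReN cImN.
have h1 : `|Re (f x) - Re l| < e / 2 by rewrite distrC; near: x.
have h2 : `|Im (f x) - Im l| < e / 2 by rewrite distrC; near: x.
by rewrite [ltRHS]splitr ltrD.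
Unshelve. all: by end_near. Qed.

Lemma cvgC_Re (T : Type) (F : set_system T) {FF : Filter F} (f : T -> R[i]) (l : R[i]) :
  f @ F --> l -> (fun x => Re (f x)) @ F --> Re l.
Proof.
move=> /cvgCP h; apply/cvgrPdist_lt => e /h; apply: filterS => x.
by apply: le_lt_trans; rewrite distrC -cReN -cReD cmod_Re.
Qed.

Lemma cvgC_Im (T : Type) (F : set_system T) {FF : Filter F} (f : T -> R[i]) (l : R[i]) :
  f @ F --> l -> (fun x => Im (f x)) @ F --> Im l.
Proof.
move=> /cvgCP h; apply/cvgrPdist_lt => e /h; apply: filterS => x.
by apply: le_lt_trans; rewrite distrC -cImN -cImD cmod_Im.
Qed.

Lemma cvgC_cmod (T : Type) (F : set_system T) {FF : Filter F} (f : T -> R[i]) (l : R[i]) :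
  f @ F --> l -> (fun x => cmod (f x) : R) @ F --> (cmod l : R).
Proof.
move=> /cvgCP h; apply/cvgrPdist_lt => e /h; apply: filterS => x.
apply: le_lt_trans; rewrite ler_norml cmodBC cmod_ler_dist andbT.
by rewrite lerNl opprB cmodBC cmod_ler_dist.
Qed.

Lemma cvgC_cmod_sqr (T : Type) (F : set_system T) {FF : Filter F} (f : T -> R[i]) (l : R[i]) :
  f @ F --> l -> (fun x => cmod (f x) ^+ 2 : R) @ F --> (cmod l ^+ 2 : R).
Proof.
move=> /cvgC_cmod h; rewrite (_ : (fun x => _) = (fun x => cmod (f x) * cmod (f x))).
  by rewrite expr2; exact: cvgM.
by apply/funext => x; rewrite expr2.
Qed.

Lemma cvgC_unique (x : nat -> R[i]) (l l' : R[i]) :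
  x @ \oo --> l -> x @ \oo --> l' -> l = l'.
Proof.
move=> /cvgCP h /cvgCP h'; apply/eqP; rewrite -subr_eq0 -cmod_eq0 eq_le cmod_ge0 andbT.
apply/ler_addgt0Pr => e e0; rewrite add0r.
have e2 : 0 < e / 2 by rewrite divr_gt0.
near \oo => n; rewrite (le_trans (cmodBD (x n) _ _))// [leRHS]splitr lerD//.
  by rewrite cmodBC ltW//; near: n; exact: h.
by rewrite ltW//; near: n; exact: h'.
Unshelve. all: by end_near.
Qed.

Lemma bounded_series_cvg (x : nat -> R) (B : R) :
  (forall n, \sum_(j < n) `|x j| <= B) -> cvgn (series x).
Proof.
move=> xB; apply: normed_cvg; apply: nondecreasing_is_cvgn.
  exact: (@nondecreasing_series _ (fun k => `|x k|) xpredT).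
by exists B => _ [n _ <-]; have := xB n; rewrite -(big_mkord xpredT (fun j => `|x j|)).
Qed.

Lemma bounded_variation_cvgR (x : nat -> R) (B : R) :
  (forall n, \sum_(j < n) `|x j.+1 - x j| <= B) -> cvgn x.
Proof.
move=> xB; have cu := @bounded_series_cvg (fun j => x j.+1 - x j) B xB.
rewrite (_ : x = (fun n => series (fun j => x j.+1 - x j) n + x 0%N)); last first.
  by apply/funext => n; rewrite /series /= telescope_sumr// subrK.
by apply: is_cvgD => //; exact: is_cvg_cst.
Qed.

Lemma bounded_variation_cvg (x : nat -> R[i]) (B : R) :
  (forall n, \sum_(j < n) cmod (x j.+1 - x j) <= B) -> exists l : R[i], x @ \oo --> l.
Proof.
move=> xB; exists (limn (fun n => Re (x n)) +i* limn (fun n => Im (x n))).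
apply: cvgC_ReIm => /=; apply: (@bounded_variation_cvgR _ B) => n;
  apply: le_trans (xB n); apply: ler_sum => j _.
  by rewrite -cReN -cReD cmod_Re.
by rewrite -cImN -cImD cmod_Im.
Qed.

Lemma csum_cvg (u : nat -> R[i]) (B : R) : (forall n, \sum_(j < n) cmod (u j) <= B) ->
  exists l : R[i], (fun n => \sum_(j < n) u j : R[i]) @ \oo --> l.
Proof.
move=> uB; apply: (@bounded_variation_cvg _ B) => n.
apply: le_trans (uB n); apply: ler_sum => j _.
by rewrite big_ord_recr /= addrAC subrr add0r.
Qed.

Lemma cvgC_le (x : nat -> R[i]) (l y : R[i]) (B : R) : x @ \oo --> l ->
  (\forall n \near \oo, cmod (x n - y) <= B) -> cmod (l - y) <= B.
Proof.
move=> /cvgCP xl xB; apply/ler_addgt0Pr => e e0.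
near \oo => n; rewrite (le_trans (cmodBD (x n) _ _))// addrC lerD//.
  by near: n; exact: xB.
by rewrite cmodBC ltW//; near: n; exact: xl.
Unshelve. all: by end_near. Qed.

Lemma cvgC_subr (T : Type) (F : set_system T) {FF : Filter F} (f : T -> R[i]) (l y : R[i]) :
  f @ F --> l -> (fun x => f x - y) @ F --> l - y.
Proof.
move=> /cvgCP h; apply/cvgCP => e /h; apply: filterS => x.
by rewrite (_ : f x - y - (l - y) = f x - l)//; ring.
Qed.

Lemma cvgC_mulr (T : Type) (F : set_system T) {FF : Filter F} (f : T -> R[i]) (l y : R[i]) :
  f @ F --> l -> (fun x => f x * y) @ F --> l * y.
Proof.
move=> /cvgCP h; apply/cvgCP => e e0.
have y0 : 0 < cmod y + 1 by rewrite ltr_wpDl ?cmod_ge0.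
apply: filterS (h _ (divr_gt0 e0 y0)) => x.
rewrite ltr_pdivlMr// -mulrBl cmodM => /le_lt_trans; apply.
by rewrite ler_wpM2l ?cmod_ge0// lerDl.
Qed.

Lemma cvgCD (T : Type) (F : set_system T) {FF : Filter F} (f g : T -> R[i]) (l m : R[i]) :
  f @ F --> l -> g @ F --> m -> (fun x => f x + g x) @ F --> l + m.
Proof.
move=> /cvgCP h /cvgCP k; apply/cvgCP => e e0.
have e2 : 0 < e / 2 by rewrite divr_gt0.
near=> x; rewrite opprD addrACA (le_lt_trans (cmodD _ _))// [ltRHS]splitr.
by apply: ltrD; near: x; [exact: h|exact: k].
Unshelve. all: by end_near. Qed.

End ComplexLimits.

Lemma aeS {R : realType} d (T : measurableType d) (mu : {measure set T -> \bar R})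
  (P Q : T -> Prop) :
  (forall x, P x -> Q x) -> {ae mu, forall x, P x} -> {ae mu, forall x, Q x}.
Proof. by move=> PQ; apply: filterS. Qed.

Lemma aeI {R : realType} d (T : measurableType d) (mu : {measure set T -> \bar R})
  (P Q : T -> Prop) :
  {ae mu, forall x, P x} -> {ae mu, forall x, Q x} -> {ae mu, forall x, P x /\ Q x}.
Proof. by move=> aP aQ; apply: filterS2 aP aQ. Qed.

Section CDominated.
Context {R : realType} d (T : measurableType d).
Variables (mu : {measure set T -> \bar R}) (D : set T) (mD : measurable D).

Lemma cdominated_convergence (f_ : nat -> T -> R[i]) (f : T -> R[i]) (G : T -> \bar R) :
  (forall n, cmeasurable D (f_ n)) -> cmeasurable D f ->
  {ae mu, forall x, D x -> (fun n => f_ n x) @ \oo --> f x} ->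
  mu.-integrable D G ->
  (forall n x, D x -> ((cmod (f_ n x))%:E <= G x)%E) ->
  cintegrable mu D f /\ (fun n => cintegral mu D (f_ n)) @ \oo --> cintegral mu D f.
Proof.
move=> mf_ mf ff Gi fG.
(* Used for [Re] and [Im], both dominated by [cmod]. *)
have key (P : R[i] -> R) : (forall z, `|P z| <= cmod z) ->
    (forall n, measurable_fun D (fun x => P (f_ n x))) ->
    measurable_fun D (fun x => P (f x)) ->
    {ae mu, forall x, D x -> (fun n => P (f_ n x)) @ \oo --> P (f x)} ->
    mu.-integrable D (EFin \o (fun x => P (f x))) /\
    (fun n => \int[mu]_(x in D) P (f_ n x)) @ \oo --> \int[mu]_(x in D) P (f x).
  move=> Ple m1 m2 PP.
  have [] := @dominated_convergence _ _ _ mu D mD (fun n x => (P (f_ n x))%:E)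
    (fun x => (P (f x))%:E) G.
  - by move=> n; exact/measurable_EFinP.
  - exact/measurable_EFinP.
  - by move: PP; apply: filterS => x h Dx; apply: cvg_EFin; [near=> n|exact: h].
  - exact: Gi.
  - apply: aeW => x n Dx; apply: le_trans (fG n x Dx).
    by rewrite lee_fin.
  move=> Pi _ cP; split => //; apply: fine_cvg => /=.
  by rewrite /Rintegral fineK//; exact: integrable_fin_num.
have [||||i1 c1] := key (@Re R); first exact: cmod_Re.
- by move=> n; case: (mf_ n).
- by case: mf.
- by move: ff; apply: filterS => x h Dx; apply: cvgC_Re; exact: h.
have [||||i2 c2] := key (@Im R); first exact: cmod_Im.
- by move=> n; case: (mf_ n).
- by case: mf.
- by move: ff; apply: filterS => x h Dx; apply: cvgC_Im; exact: h.
by split=> //; apply: cvgC_ReIm.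
Unshelve. all: by end_near. Qed.
End CDominated.

(** * The Riesz-Fischer theorem for one-sided Fourier series *)

Section RieszFischer.
Context {R : realType}.
Implicit Types (c : nat -> R[i]).
Local Notation mu := (@lebesgue_measure R).
Local Notation mR := (measurableTypeR R).
Local Notation cmeasurable := (@cmeasurable R _ mR).
Local Notation T2 := `[0%R, (2 * pi)%R]%classic.

Let cut m c k := if (k < m)%N then 0 else c k.

Lemma trigpolyB c m n t : (m <= n)%N ->
  trigpoly c n t - trigpoly c m t = trigpoly (cut m c) n t.
Proof.
move=> mn; rewrite /trigpoly -!(big_mkord xpredT (fun k => c k * cis t ^+ k)).
rewrite -(big_mkord xpredT (fun k => cut m c k * cis t ^+ k)).
rewrite (@big_cat_nat _ _ _ m)//= addrAC subrr add0r.
rewrite [RHS](@big_cat_nat _ _ _ m)//=.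
have -> : \sum_(0 <= k < m) cut m c k * cis t ^+ k = 0.
  by rewrite big_nat big1// => k /andP[_ km]; rewrite /cut km mul0r.
rewrite add0r.
by apply: eq_big_nat => k /andP[mk _]; rewrite /cut ltnNge mk.
Qed.

Lemma sum_cut c m n : (m <= n)%N ->
  \sum_(k < n) cmod (cut m c k) ^+ 2 =
  \sum_(k < n) cmod (c k) ^+ 2 - \sum_(k < m) cmod (c k) ^+ 2.
Proof.
move=> mn; rewrite -!(big_mkord xpredT (fun k => cmod (c k) ^+ 2)).
rewrite -(big_mkord xpredT (fun k => cmod (cut m c k) ^+ 2)).
rewrite [X in _ = X - _](@big_cat_nat _ _ _ m)//= addrAC subrr add0r.
rewrite [LHS](@big_cat_nat _ _ _ m)//=.
have -> : \sum_(0 <= k < m) cmod (cut m c k) ^+ 2 = 0.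
  by rewrite big_nat big1// => k /andP[_ km]; rewrite /cut km cmod0 expr0n.
rewrite add0r.
by apply: eq_big_nat => k /andP[mk _]; rewrite /cut ltnNge mk.
Qed.

(** Tails of order 4^-j for sums of squares become L^1 bounds of order 2^-j for the increments of
    the partial sums. The condition [j <= nn j] ensures that every fixed frequency eventually enters
    the subsequence. *)
Lemma subsequence_tails (s : nat -> R) (B : R) : {homo s : n m / (n <= m)%N >-> n <= m} ->
  (forall n, s n <= B) ->
  exists nn : nat -> nat, [/\ {homo nn : i j / (i <= j)%N}, forall j, (j <= nn j)%N &
    forall j n, (nn j <= n)%N -> s n - s (nn j) <= 4^-1 ^+ j].
Proof.
move=> sm sB.
have cs : cvgn s by apply: nondecreasing_is_cvgn => //; exists B => _ [n _ <-].
have sl n : s n <= limn s by exact: nondecreasing_cvgn_le.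
have H j : exists N, forall n, (N <= n)%N -> s n - s N <= 4^-1 ^+ j.
  have e0 : 0 < 4^-1 ^+ j :> R by rewrite exprn_gt0.
  move/cvgrPdist_lt : cs => /(_ _ e0) [N _ hN]; exists N => n Nn.
  have /= := hN N (leqnn _); have := sl n; rewrite ger0_norm ?subr_ge0//; lra.
have [Nf hNf] := choice H.
(* The running maximum makes the choice monotone, and including [i] itself makes it at least [j]. *)
exists (fun j => \max_(i < j.+1) maxn i (Nf i)); split.
- move=> i j ij; apply/bigmax_leqP => k _.
  have kj : (k < j.+1)%N by rewrite (leq_trans (ltn_ord k)).
  exact: (leq_bigmax_cond (Ordinal kj)).
- move=> j; apply: leq_trans (leq_bigmax_cond (ord_max : 'I_j.+1) _) => //=.
  exact: leq_maxl.
- move=> j n jn; have h : (Nf j <= \max_(i < j.+1) maxn i (Nf i))%N.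
    by apply: leq_trans (leq_bigmax_cond (ord_max : 'I_j.+1) _) => //=; exact: leq_maxr.
  have := hNf j n (leq_trans h jn); have := sm _ _ h; lra.
Qed.

(* Along a subsequence with [|S (j+1) - S j|_1 <= 2 pi 2^-j] the partial sums are
   dominated by the integrable [|S 0| + D], so they converge almost everywhere. *)
Lemma riesz_fischer c (B : R) : (forall n, \sum_(k < n) cmod (c k) ^+ 2 <= B) ->
  exists g : R -> R[i], [/\ cmeasurable T2 g,
    mu.-integrable T2 (EFin \o (fun t => cmod (g t) ^+ 2)),
    forall k, fcoef g k = c k &
    forall k, cintegral mu T2 (fun t => g t * cis t ^+ k.+1) = 0].
Proof.
move=> cB; set s := fun n => \sum_(k < n) cmod (c k) ^+ 2.
have sm : {homo s : n m / (n <= m)%N >-> n <= m}.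
  by apply/nondecreasing_seqP => n; rewrite /s big_ord_recr /= lerDl sqr_ge0.
have [nn [nnm nnj nnt]] := subsequence_tails sm cB.
pose S j := trigpoly c (nn j).
have cS j : ccontinuous (S j) by exact: ccontinuous_trigpoly.
have mS j : cmeasurable T2 (S j) by exact: ccontinuous_cmeasurable.
pose u j t := S j.+1 t - S j t.
have cu j : ccontinuous (u j) by apply: ccontinuousD => //; exact: ccontinuousN.
have mu_ j : cmeasurable T2 (u j) by exact: ccontinuous_cmeasurable.
have mT2 : measurable (T2 : set mR) by exact: measurable_itv.
have p0 := @pi2_gt0 R.
have u1 j : \int[mu]_(t in T2) cmod (u j t) <= 2 * pi * 2^-1 ^+ j.
  have i2 := continuous_integrable 0 (2 * pi) (ccontinuous_sqr (cu j)).
  have ic : mu.-integrable T2 (EFin \o (fun=> 2^-1 ^+ j.+1 : R)).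
    by apply: continuous_integrable => t; exact: cvg_cst.
  (* This is y <= e y^2 / 2 + 1 / (2e) with e = 2^j: as the integral of y^2 is at most 2 pi 4^-j,
     both terms contribute at most pi 2^-j. *)
  apply: (@le_trans _ _ (\int[mu]_(t in T2) (2 ^+ j / 2 * cmod (u j t) ^+ 2 + 2^-1 ^+ j.+1))).
    apply: le_Rintegral => //.
    - by apply: (integrable_cmod (mu := mu)) => //; exact: ccontinuous_cintegrable.
    - by apply: (integrableRD (mu := mu)) => //; exact: (integrableRZ (mu := mu)).
    - move=> t _; have e0 : 0 < 2 ^+ j :> R by rewrite exprn_gt0.
      rewrite [2^-1 ^+ j.+1]exprS [2^-1 ^+ j]exprVn; set e := 2 ^+ j in e0 *; set y := cmod _.
      have := sqr_ge0 (e * y - 1); move=> h; rewrite -subr_ge0; move: h.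
      have -> : e / 2 * y ^+ 2 + 2^-1 * e^-1 - y = (e * y - 1) ^+ 2 / (2 * e).
        by field; rewrite gt_eqF.
      by move=> h; rewrite divr_ge0// mulr_ge0// ltW.
  rewrite RintegralD//; last exact: (integrableRZ (mu := mu)).
  rewrite RintegralZl// Rintegral_itv_cst ?(ltW p0)// subr0.
  have -> : \int[mu]_(t in T2) (cmod (u j t) ^+ 2) = 2 * pi * (s (nn j.+1) - s (nn j)).
    rewrite -(sum_cut c (nnm _ _ (leqnSn j))) -parseval_trigpoly.
    by apply: eq_Rintegral => t _; rewrite /u /S trigpolyB// nnm.
  have := nnt j _ (nnm _ _ (leqnSn j)).
  have -> : 4^-1 ^+ j = 2^-1 ^+ j * 2^-1 ^+ j :> R.
    by rewrite -exprMn; congr (_ ^+ _); field.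
  rewrite [2^-1 ^+ j.+1]exprS ![2^-1 ^+ j]exprVn.
  have e0 : 0 < 2 ^+ j :> R by rewrite exprn_gt0.
  set e := 2 ^+ j in e0 *; set d := s _ - _ => hd.
  have : e / 2 * d <= 2^-1 * e^-1.
    have -> : 2^-1 * e^-1 = e / 2 * (e^-1 * e^-1) by field; rewrite gt_eqF.
    by rewrite ler_pM2l// divr_gt0.
  move=> hd2; rewrite (_ : 2 * pi / e = 2 * pi * (2^-1 * e^-1) + 2^-1 / e * (2 * pi)); last first.
    by field; rewrite gt_eqF.
  by rewrite lerD2r mulrCA ler_pM2l.
pose D t := (\sum_(0 <= j <oo) (cmod (u j t))%:E)%E.
have D0 t : (0 <= D t)%E by apply: nneseries_ge0 => j _ _; rewrite lee_fin cmod_ge0.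
have mcu j : measurable_fun (T2 : set mR) (fun t => (cmod (u j t))%:E).
  by apply/measurable_EFinP; exact: cmeasurable_cmod.
have mDD : measurable_fun (T2 : set mR) D.
  by apply: ge0_emeasurable_sum => // j t _ _; rewrite lee_fin cmod_ge0.
have iD : mu.-integrable T2 D.
  apply/integrableP; split => //.
  apply: (@le_lt_trans _ _ (2 * pi * 2)%:E); last exact: ltry.
  have -> : (\int[mu]_(t in T2) `|D t| = \int[mu]_(t in T2) D t)%E.
    by apply: eq_integral => t _; rewrite gee0_abs.
  rewrite integral_nneseries//; last by move=> j t _; rewrite lee_fin cmod_ge0.
  apply: lime_le.
    by apply: is_cvg_nneseries => j _ _; apply: integral_ge0 => t _; rewrite lee_fin cmod_ge0.
  near=> n; apply: (@le_trans _ _ (\sum_(0 <= j < n) (2 * pi * 2^-1 ^+ j)%:E)%E).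
    apply: lee_sum => j _; rewrite -(@fineK _ (integral _ _ _)) ?lee_fin; first exact: u1.
    apply: integrable_fin_num => //; apply: (integrable_cmod (mu := mu)) => //.
    exact: ccontinuous_cintegrable.
  rewrite sumEFin lee_fin -mulr_sumr ler_pM2l// big_mkord.
  have := subrX1 (2^-1 : R) n; have : 0 <= 2^-1 ^+ n :> R by rewrite exprn_ge0.
  set q := _ ^+ n; set z := \sum_(_ < _) _ => q0 hq.
  lra.
have Dae : {ae mu, forall t, T2 t -> D t \is a fin_num} by exact: integrable_ae.
(* Upper limits are measurable whether or not the sequence converges; where [D t] is finite they are
   the true limits. *)
pose g t : R[i] := fine (limn_esup (fun j => (Re (S j t))%:E)) +i*
                   fine (limn_esup (fun j => (Im (S j t))%:E)).
have mg : cmeasurable T2 g.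
  split => /=; (apply: measurableT_comp; first exact: fine_measurable);
    apply: measurable_fun_limn_esup => j; apply/measurable_EFinP; by case: (mS j).
have Sg t : D t \is a fin_num -> (fun j => S j t) @ \oo --> g t.
  move=> Dt; have [l Sl] : exists l : R[i], (fun j => S j t) @ \oo --> l.
    apply: (@bounded_variation_cvg _ _ (fine (D t))) => n.
    rewrite -lee_fin fineK// -sumEFin -(big_mkord xpredT (fun j => (cmod (u j t))%:E)).
    by apply: nneseries_lim_ge => j _ _; rewrite lee_fin cmod_ge0.
  suff -> : g t = l by [].
  rewrite /g; apply: eqc => /=.
    rewrite (@cvg_limn_einf_sup _ _ (Re l)%:E)//; apply: cvg_EFin; first by near=> n.
    exact: cvgC_Re.
  rewrite (@cvg_limn_einf_sup _ _ (Im l)%:E)//; apply: cvg_EFin; first by near=> n.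
  exact: cvgC_Im.
have Sdom j t : ((cmod (S j t))%:E <= (cmod (S 0%N t))%:E + D t)%E.
  apply: (@le_trans _ _ ((cmod (S 0%N t))%:E + \sum_(0 <= i < j) (cmod (u i t))%:E)%E).
    rewrite sumEFin -EFinD lee_fin -lerBlDl (le_trans (cmod_ler_dist _ _))//.
    rewrite -(telescope_sumr (fun i => S i t))//.
    exact: cmod_sum.
  by rewrite leeD2l//; apply: nneseries_lim_ge => i _ _; rewrite lee_fin cmod_ge0.
have iG : mu.-integrable T2 (fun t => ((cmod (S 0%N t))%:E + D t)%E).
  apply: integrableD => //; apply: (integrable_cmod (mu := mu)) => //.
  exact: ccontinuous_cintegrable.
(* A unimodular factor leaves the majorant unchanged, so the same passage to the limit handles the
   nonnegative and the negative frequencies of [g]. *)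
have lim_mul w : ccontinuous w -> (forall t, cmod (w t) = 1) ->
    (fun j => cintegral mu T2 (fun t => S j t * w t)) @ \oo --> cintegral mu T2 (fun t => g t * w t).
  move=> cw w1; apply: (cdominated_convergence mT2 (mu := mu) (G := fun t => ((cmod (S 0%N t))%:E + D t)%E) _ _ _ iG _).2.
  - move=> n; apply: ccontinuous_cmeasurable => //; exact: ccontinuousM.
  - by apply: cmeasurableM => //; exact: ccontinuous_cmeasurable.
  - move: Dae; apply: (aeS (mu := mu)) => t h Dt.
    by apply: cvgC_mulr; exact: (Sg _ (h Dt)).
  - by move=> n t _; rewrite cmodM w1 mulr1.
have iSw (k : nat) w : ccontinuous w -> cintegrable mu T2 (fun t => c k * (cis t ^+ k * w t)).
  move=> cw; apply: ccontinuous_cintegrable; apply: ccontinuousM; first exact: ccontinuous_cst.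
  by apply: ccontinuousM => //; apply: ccontinuousX; exact: ccontinuous_cis.
have intS w j : ccontinuous w -> cintegral mu T2 (fun t => S j t * w t) =
    \sum_(k < nn j) c k * cintegral mu T2 (fun t => cis t ^+ k * w t).
  move=> cw; transitivity (cintegral mu T2 (fun t => \sum_(k < nn j) c k * (cis t ^+ k * w t))).
    apply: eq_cintegral => t _; rewrite /S /trigpoly mulr_suml.
    by apply: eq_bigr => k _; rewrite mulrA.
  rewrite (cintegral_sum (mu := mu) mT2); last by move=> k; exact: (iSw k w cw).
  apply: eq_bigr => k _; rewrite (cintegralZ (mu := mu) mT2)//.
  apply: ccontinuous_cintegrable; apply: ccontinuousM => //.
  by apply: ccontinuousX; exact: ccontinuous_cis.
exists g; split => //.
- apply/integrableP; split.
    apply/measurable_EFinP; apply: measurable_funX; exact: cmeasurable_cmod.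
  have -> : (\int[mu]_(t in T2) `|(EFin \o (fun t => cmod (g t) ^+ 2)%R) t| =
      \int[mu]_(t in T2) (cmod (g t) ^+ 2)%:E)%E.
    by apply: eq_integral => t _ /=; rewrite ger0_norm// sqr_ge0.
  pose h j t := (cmod (S j t) ^+ 2)%:E.
  have mh j : measurable_fun (T2 : set mR) (h j).
    by apply/measurable_EFinP; apply: measurable_funX; exact: cmeasurable_cmod.
  have hge n (t : mR) : T2 t -> (0 <= h n t)%E by rewrite lee_fin sqr_ge0.
  (* Fatou's lemma: |g|^2 is almost everywhere the lower limit of |S j|^2, whose integrals are at
     most 2 pi B by Parseval. *)
  apply: (@le_lt_trans _ _ (\int[mu]_(t in T2) limn_einf (h^~ t))%E).
    apply: ae_ge0_le_integral => //.
    + by move=> t _; rewrite lee_fin sqr_ge0.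
    + by apply/measurable_EFinP; apply: measurable_funX; exact: cmeasurable_cmod.
    + move=> t Dt; rewrite limn_einf_lim; apply: lime_ge; first exact: is_cvg_einfs.
      by near=> n; apply: le_ereal_inf_tmp => _ [k _ <-]; rewrite lee_fin sqr_ge0.
    + rewrite /limn_einf; apply: measurableT_comp => //.
      by apply: measurable_fun_limn_esup => j; exact: measurableT_comp.
    + move: Dae; apply: (aeS (mu := mu)) => t H Dt.
      rewrite (@cvg_limn_einf_sup _ (h^~ t) (cmod (g t) ^+ 2)%:E)//.
      apply: cvg_EFin; first by near=> n.
      have K := cvgC_cmod_sqr (Sg _ (H Dt)).
      exact: K.
  apply: (le_lt_trans (fatou mu mT2 mh hge)).
  apply: (@le_lt_trans _ _ (2 * pi * B)%:E); last exact: ltry.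
  rewrite limn_einf_lim; apply: lime_le; first exact: is_cvg_einfs.
  near=> n; apply: (@le_trans _ _ (\int[mu]_(t in T2) h n t)%E).
    by apply: ereal_inf_lbound; exists n => //=.
  rewrite -(@fineK _ (integral _ _ _)); last first.
    apply: integrable_fin_num => //; apply: continuous_integrable.
    exact: ccontinuous_sqr.
  by rewrite lee_fin [leLHS]parseval_trigpoly ler_pM2l.
- move=> k; have cw := ccontinuousX k (@ccontinuous_cisV R).
  have w1 t : cmod ((cis t)^-1 ^+ k : R[i]) = 1 by exact: cmod_cisVX.
  have h2 : (fun j => cintegral mu T2 (fun t => S j t * (cis t)^-1 ^+ k)) @ \oo -->
      ((2 * pi)%:C * c k : R[i]).
    apply: cvg_near_cst; near=> j; rewrite intS//.
    have kj : (k < nn j)%N by apply: leq_trans (nnj j); near: j; exact: nbhs_infty_gt.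
    rewrite (bigD1 (Ordinal kj)) //= cintegral_cis_ortho eqxx mulrC big1 ?addr0//.
    move=> l lk; rewrite cintegral_cis_ortho; case: eqP => [lk'|_]; last by rewrite mulr0.
    by move/eqP : lk; case; exact: val_inj.
  rewrite /fcoef (cvgC_unique (lim_mul _ cw w1) h2) mulrA.
  rewrite (_ : _ * _%:C = 1) ?mul1r//.
  by apply: eqc; rewrite ?cReM ?cImM /= ?(mulr0, mul0r, subr0, addr0)// mulVf// gt_eqF.
- move=> k; have cw := ccontinuousX k.+1 (@ccontinuous_cis R).
  have w1 t : cmod (cis t ^+ k.+1 : R[i]) = 1 by rewrite cmodX cmod_cis expr1n.
  have h2 : (fun j => cintegral mu T2 (fun t => S j t * cis t ^+ k.+1)) @ \oo --> (0 : R[i]).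
    apply: cvg_near_cst; near=> j; rewrite intS// big1// => l _.
    rewrite (_ : (fun t => _) = (fun t => cis t ^+ (l + k.+1))).
      by rewrite cintegral_cisX addnS mulr0.
    by apply/funext => t; rewrite exprD.
  exact: (cvgC_unique (lim_mul _ cw w1) h2).
Unshelve. all: by end_near. Qed.

End RieszFischer.

(** * Comparison of chord and arc on the circle *)

Section SinBound.
Context {R : realType}.

(** By the mean value theorem sin y = y cos w for some w < y <= c, and the cosine decreases on
    [0, pi / 2]. *)
Lemma sin_ge_mul_cos (y c : R) : 0 <= y -> y <= c -> c <= pi / 2 -> y * cos c <= sin y.
Proof.
move=> y0 yc cp.
have cosd (x z : R) : 0 <= x -> x < z -> z <= pi / 2 -> cos z <= cos x.
  move=> x0 xz zp; have dc (w : R) : w \in `]x, z[ -> is_derive w 1 cos (- sin w).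
    by move=> _; exact: is_derive_cos.
  have [|w] := MVT xz dc; first by apply: continuous_subspaceT => w; exact: continuous_cos.
  rewrite in_itv /= => /andP[xw wz] h.
  have : 0 <= sin w * (z - x).
    rewrite mulr_ge0 ?subr_ge0 ?(ltW xz)// ltW// sin_gt0_pihalf//.
    by rewrite (le_lt_trans x0 xw) (lt_le_trans wz zp).
  by move: h; rewrite mulNr; lra.
move: y0; rewrite le_eqVlt => /predU1P[<-|y0]; first by rewrite mul0r sin0.
have ds (w : R) : w \in `]0, y[ -> is_derive w 1 sin (cos w).
  by move=> _; exact: is_derive_sin.
have [|w] := MVT y0 ds; first by apply: continuous_subspaceT => w; exact: continuous_sin.
rewrite in_itv /= => /andP[w0 wy]; rewrite sin0 !subr0 => ->.
rewrite mulrC ler_wpM2r ?(ltW y0)//; apply: cosd => //; first exact: ltW.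
exact: lt_le_trans wy yc.
Qed.

Lemma cmod_cisB (s t : R) : cmod (cis s - cis t) = 2 * `|sin ((s - t) / 2)|.
Proof.
apply/eqP; rewrite -(eqrXn2 (n := 2))// ?cmod_ge0 ?mulr_ge0//.
rewrite exprMn real_normK ?num_real// cmod_sqr !cReD !cImD !cReN !cImN /=.
have h1 : cos (s - t) = 1 - 2 * sin ((s - t) / 2) ^+ 2.
  by rewrite {1}(splitr (s - t)) cosD -!expr2 cos2sin2; ring.
have := h1; rewrite cosB => h2.
have := cos2Dsin2 s; have := cos2Dsin2 t => h3 h4.
apply/eqP; rewrite (_ : _ + _ = (cos s ^+ 2 + sin s ^+ 2) + (cos t ^+ 2 + sin t ^+ 2) -
  2 * (cos s * cos t + sin s * sin t)); last by ring.
by rewrite h3 h4 h2; ring.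
Qed.

(* [sin x = 2 sin (x/2) cos (x/2)], and both half-angle factors are controlled on [0, b/2]. *)
Lemma cisB_ge (t0 : R) : 0 < t0 -> t0 < 2 * pi ->
  exists k : R, [/\ 0 < k, k <= 1 &
    forall t, 0 <= t -> t <= 2 * pi -> k * `|t - t0| <= cmod (cis t - cis t0)].
Proof.
(* The largest value of |t - t0| / 2 over [0, 2 pi]. It is below pi because [t0] is interior; at the
   endpoints the bound would fail, as 0 and 2 pi give the same point of the circle. *)
move=> t00 t02; pose b := Num.max t0 (2 * pi - t0) / 2.
have b0 : 0 < b by rewrite divr_gt0// lt_max t00.
have bp : b < pi.
  rewrite ltr_pdivrMr// gt_max mulrC t02 /=; have := @pi_gt0 R; lra.
have c0 : 0 < cos (b / 2).
  by have p0 := @pi_gt0 R; apply: cos_gt0_pihalf; apply/andP; split; lra.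
exists (cos (b / 2) ^+ 2); split.
- by rewrite exprn_gt0.
- by rewrite exprn_ile1 ?cos_le1// ltW.
move=> t t1 t2; rewrite cmod_cisB.
have -> : `|sin ((t - t0) / 2)| = `|sin (`|t - t0| / 2)|.
  by have [h|h] := ger0P (t - t0) => //; rewrite mulNr sinN normrN.
set x := `|t - t0| / 2.
have xb : x <= b.
  rewrite /x /b ler_pM2r ?invr_gt0// le_max; have [h|h] := ger0P (t - t0); lra.
have x0 : 0 <= x by rewrite divr_ge0.
have h1 := @sin_ge_mul_cos (x / 2) (b / 2).
have h2 := @sin_ge_mul_cos (x / 2) (x / 2).
have {h1} h1 : x / 2 * cos (b / 2) <= sin (x / 2) by apply: h1; lra.
have cc : cos (b / 2) <= cos (x / 2).
  move: x0; rewrite le_eqVlt => /predU1P[<-|x0]; first by rewrite mul0r cos0 cos_le1.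
  have [->//|xb'] := eqVneq x b.
  have dc (w : R) : w \in `](x / 2), (b / 2)[ -> is_derive w 1 cos (- sin w).
    by move=> _; exact: is_derive_cos.
  have xb2 : x / 2 < b / 2 by rewrite ltr_pM2r ?invr_gt0// lt_neqAle xb' xb.
  have [|w] := MVT xb2 dc; first by apply: continuous_subspaceT => w; exact: continuous_cos.
  rewrite in_itv /= => /andP[xw wz] h.
  have : 0 <= sin w * (b / 2 - x / 2).
    rewrite mulr_ge0 ?subr_ge0 ?(ltW xb2)// ltW// sin_gt0_pihalf//.
    by apply/andP; split; lra.
  by move: h; rewrite mulNr; lra.
apply: (@le_trans _ _ (2 * sin x)); last by rewrite ler_pM2l// ler_norm.
have -> : sin x = 2 * (sin (x / 2) * cos (x / 2)).
  by rewrite {1}(splitr x) sinD; ring.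
have -> : `|t - t0| = 4 * (x / 2) by rewrite /x; field.
have : x / 2 * cos (b / 2) * cos (b / 2) <= sin (x / 2) * cos (x / 2).
  by apply: ler_pM => //; [rewrite mulr_ge0//; [lra|exact: ltW]|exact: ltW].
lra.
Qed.
End SinBound.

(** * Lebesgue points and nontangential limits *)

Section LebesguePoints.
Context {R : realType}.
Local Notation mu := (@lebesgue_measure R).
Local Notation mR := (measurableTypeR R).
Implicit Types (f : R -> R).

(** The Lebesgue point condition in quantitative form, with [r] in place of the length 2r of the
    ball. The inclusion keeps the balls inside the interval where [phi] is integrable. *)
Definition vanishing_mean (a b x : R) (phi : R -> R) :=
  forall e : R, 0 < e -> exists2 d : R, 0 < d & forall r, 0 < r -> r <= d ->
    (ball x r `<=` `]a, b[%classic) /\ (\int[mu]_(y in ball x r) phi y <= e * r).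

(** The Lebesgue differentiation theorem is applied to the extension of [f] by zero, which agrees
    with [f] on all sufficiently small balls around an interior point. *)
Lemma lebesgue_pt_itv f (a b : R) : a < b -> mu.-integrable `[a, b] (EFin \o f) ->
  {ae mu, forall x, x \in `]a, b[ -> vanishing_mean a b x (fun y => `|f y - f x|)}.
Proof.
move=> ab fi; set A := `[a, b]%classic.
have mA : measurable (A : set mR) by exact: measurable_itv.
have lf : locally_integrable setT (f \_ A) by exact: integrable_locally_restrict.
apply: (aeS (mu := mu)) (lebesgue_differentiation lf) => x fx xab e e0.
have fAx y : y \in `]a, b[ -> (f \_ A) y = f y.
  move=> yab; rewrite patchE mem_set//; rewrite /A /=; move: yab; rewrite !in_itv /=.
  by case/andP => /ltW -> /ltW ->.
move: fx => /fine_cvgP[fin /cvgr_lt] => /(_ (e / 2)) h.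
have {}h := h (divr_gt0 e0 (ltr0n _ 2)).
have [d1 /= d10 hd1] := fin; have [d2 /= d20 hd2] := h.
move: (xab); rewrite in_itv /= => /andP[ax xb].
pose d := Num.min (Num.min (d1 / 2) (d2 / 2)) (Num.min (x - a) (b - x)).
have d0 : 0 < d by rewrite !lt_min !subr_gt0 ax xb !divr_gt0.
exists d => // r r0; rewrite !le_min => /andP[/andP[rd1 rd2] /andP[rxa rbx]].
have sub : ball x r `<=` `]a, b[.
  by rewrite ball_itv => y; rewrite /= !in_itv /= => /andP[h1 h2]; apply/andP; split; lra.
split => //.
have F : davg (f \_ A) x r \is a fin_num.
  by apply: hd1 => //; rewrite /ball /= sub0r normrN gtr0_norm//; lra.
have L : fine (davg (f \_ A) x r) < e / 2.
  by apply: hd2 => //; rewrite /ball /= sub0r normrN gtr0_norm//; lra.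
have r2 : 0 < r *+ 2 by rewrite mulrn_wgt0.
have E : davg (f \_ A) x r = ((r *+ 2)^-1%:E * \int[mu]_(y in ball x r) (`|f y - f x|)%:E)%E.
  rewrite /davg /iavg (lebesgue_measure_ball _ (ltW r0)) inver gt_eqF//; congr (_ * _)%E.
  apply: eq_integral => y yB; rewrite -[in RHS](fAx x)// -[in RHS](fAx y)//.
  exact/sub/set_mem.
have I : (\int[mu]_(y in ball x r) (`|f y - f x|)%:E)%E \is a fin_num.
  move: F; rewrite E ge0_fin_numE; last by rewrite mule_ge0 ?lee_fin ?invr_ge0 ?(ltW r2)// integral_ge0.
  rewrite ge0_fin_numE ?integral_ge0// => h3; rewrite ltey; apply/eqP => h4.
  by move: h3; rewrite h4 gt0_muley ?lte_fin ?invr_gt0.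
move: L; rewrite E fineM// /= -/(Rintegral _ _ _) mulrC ltr_pdivrMr// => /ltW.
by rewrite (_ : e / 2 * (r *+ 2) = e * r)//; rewrite -mulr_natr; field.
Qed.

Lemma clebesgue_pt_itv (g : R -> R[i]) (a b : R) : a < b -> cintegrable mu `[a, b] g ->
  {ae mu, forall x, x \in `]a, b[ -> vanishing_mean a b x (fun y => cmod (g y - g x))}.
Proof.
move=> ab gi; have [g1 g2] := gi.
have := aeI (lebesgue_pt_itv ab g1) (lebesgue_pt_itv ab g2).
apply: (aeS (mu := mu)) => x [h1 h2] xab e e0.
have e2 : 0 < e / 2 by rewrite divr_gt0.
have [d1 d10 k1] := h1 xab _ e2; have [d2 d20 k2] := h2 xab _ e2.
exists (Num.min d1 d2); first by rewrite lt_min d10.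
move=> r r0; rewrite le_min => /andP[r1 r2].
have [sub k1'] := k1 _ r0 r1; have [_ k2'] := k2 _ r0 r2; split => //.
have mB : measurable (ball x r : set mR) by exact: measurable_ball.
have subc : ball x r `<=` `[a, b].
  by move=> y /sub /=; rewrite !in_itv /= => /andP[/ltW -> /ltW ->].
have igx : cintegrable mu (ball x r) (fun y => g y - g x).
  apply: (cintegrableB (mu := mu)) => //.
    by case: gi => i1 i2; split; [apply: integrableS i1|apply: integrableS i2].
  have : cintegrable mu `[a, b] (fun=> g x).
    by apply: ccontinuous_cintegrable; exact: ccontinuous_cst.
  by case=> i1 i2; split; [apply: integrableS i1|apply: integrableS i2].
have [i1 i2] := igx.
have j1 : mu.-integrable (ball x r) (EFin \o (fun y => `|Re (g y - g x)|)).
  exact: (integrable_norm (mu := mu) i1).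
have j2 : mu.-integrable (ball x r) (EFin \o (fun y => `|Im (g y - g x)|)).
  exact: (integrable_norm (mu := mu) i2).
apply: (@le_trans _ _ (\int[mu]_(y in ball x r) (`|Re (g y - g x)| + `|Im (g y - g x)|))).
  apply: le_Rintegral => //; first exact: (integrable_cmod (mu := mu)).
    exact: (integrableRD (mu := mu)).
  by move=> y _; exact: cmod_ReIm.
rewrite RintegralD//.
have <- : \int[mu]_(y in ball x r) `|Re (g y) - Re (g x)| = \int[mu]_(y in ball x r) `|Re (g y - g x)|.
  by apply: eq_Rintegral => y _; rewrite cReD cReN.
have <- : \int[mu]_(y in ball x r) `|Im (g y) - Im (g x)| = \int[mu]_(y in ball x r) `|Im (g y - g x)|.
  by apply: eq_Rintegral => y _; rewrite cImD cImN.
by have := lerD k1' k2'; rewrite -mulrDl -splitr.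
Qed.

Lemma ge0_Rintegral_subset (phi : R -> R) (D E : set mR) : measurable D -> measurable E ->
  D `<=` E -> (forall y, 0 <= phi y) -> mu.-integrable E (EFin \o phi) ->
  \int[mu]_(y in D) phi y <= \int[mu]_(y in E) phi y.
Proof.
move=> mD mE DE p0 ip; have ipD := integrableS mE mD DE ip.
rewrite /Rintegral fine_le//; [exact: integrable_fin_num|exact: integrable_fin_num|].
apply: ge0_subset_integral => //; first exact: measurable_int ip.
by move=> y _; rewrite lee_fin.
Qed.

(** The shape of the Poisson kernel on the line, up to constants: a plateau of height 1/d on |t - x|
    <= d, then decay like d / |t - x|^2. The parameter [d] will be 1 - |u|. *)
Definition approx_kernel (d x t : R) : R := d / Num.max d `|t - x| ^+ 2.

Lemma approx_kernel_ge0 d x t : 0 < d -> 0 <= approx_kernel d x t.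
Proof. by move=> d0; rewrite divr_ge0 ?sqr_ge0 ?ltW. Qed.

Lemma approx_kernel_le d x t r : 0 < d -> 0 < r -> r <= Num.max d `|t - x| ->
  approx_kernel d x t <= d / r ^+ 2.
Proof.
move=> d0 r0 h; rewrite ler_pM2l// lef_pV2 ?posrE ?exprn_gt0// ?(lt_le_trans r0 h)//.
by rewrite ler_sqr ?nnegrE ?(ltW r0)// (le_trans (ltW r0) h).
Qed.

Lemma approx_kernel_le_inv d x t : 0 < d -> approx_kernel d x t <= d^-1.
Proof.
move=> d0; apply: le_trans (approx_kernel_le (x := x) (t := t) d0 d0 _) _.
  by rewrite le_max lexx.
by rewrite expr2 invfM mulrA divff ?mul1r// gt_eqF.
Qed.

Lemma approx_kernel_continuous d x : 0 < d -> continuous (approx_kernel d x).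
Proof.
move=> d0 t; apply: cvgM; first exact: cvg_cst.
have cm : (fun s : R => Num.max d `|s - x|) @ t --> Num.max d `|t - x|.
  have cn : (fun s : R => `|s - x|) @ t --> `|t - x|.
    by apply: cvg_norm; apply: cvgB; [exact: cvg_id|exact: cvg_cst].
  rewrite maxr_absE (_ : (fun s => _) = (fun s : R => (d + `|s - x| + `|d - `|s - x| |) / 2)).
    apply: cvgM; last exact: cvg_cst.
    apply: cvgD; first by apply: cvgD => //; exact: cvg_cst.
    by apply: cvg_norm; apply: cvgB => //; exact: cvg_cst.
  by apply/funext => s; rewrite maxr_absE.
apply: cvgV; first by rewrite expf_neq0// gt_eqF// lt_max d0.
rewrite (_ : (fun s => _) = (fun s : R => Num.max d `|s - x| * Num.max d `|s - x|)).
  by rewrite expr2; exact: cvgM.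
by apply/funext => s; rewrite expr2.
Qed.

Lemma approx_kernel_integral_le (phi : R -> R) x d : 0 < d -> (forall y, 0 <= phi y) ->
  forall (D : set mR) c, measurable D -> mu.-integrable D (EFin \o phi) ->
    (forall y, D y -> approx_kernel d x y <= c) ->
    mu.-integrable D (EFin \o (fun y => phi y * approx_kernel d x y)) /\
    \int[mu]_(y in D) (phi y * approx_kernel d x y) <= c * \int[mu]_(y in D) phi y.
Proof.
move=> d0 p0 D c mD ip kc.
have mk : measurable_fun (setT : set mR) (approx_kernel d x).
  by apply: continuous_measurable_fun; exact: approx_kernel_continuous.
have ic : mu.-integrable D (EFin \o (fun y => c * phi y)) by exact: (integrableRZ (mu := mu)).
have i1 : mu.-integrable D (EFin \o (fun y => phi y * approx_kernel d x y)).
  apply: (le_integrable mD _ _ ic).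
    apply/measurable_EFinP; apply: measurable_funM.
      by apply/measurable_EFinP; exact: measurable_int ip.
    exact: measurable_funTS.
  move=> y Dy; rewrite lee_fin (normrM (phi y)) (normrM c) (ger0_norm (p0 y)) mulrC ler_wpM2r//.
  rewrite (ger0_norm (approx_kernel_ge0 _ _ d0)) (le_trans (kc _ Dy))//.
  exact: ler_norm.
split => //; rewrite -RintegralZl//; apply: le_Rintegral => // y Dy.
by rewrite mulrC ler_wpM2r// kc.
Qed.

(* The mass of the kernel on the dyadic shell between the radii [2^n d] and
   [2^(n+1) d] is at most [2 e / 2^n]; the shells sum up geometrically. *)
Lemma approx_kernel_dyadic (phi : R -> R) (a b x e d eta : R) n : 0 < d ->
  2 ^+ n * d <= eta ->
  (forall y, 0 <= phi y) -> mu.-integrable `[a, b] (EFin \o phi) ->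
  (forall r, 0 < r -> r <= eta -> (ball x r `<=` `]a, b[%classic) /\
    (\int[mu]_(y in ball x r) phi y <= e * r)) ->
  \int[mu]_(y in ball x (2 ^+ n * d)) (phi y * approx_kernel d x y) <= e * (5 - 4 / 2 ^+ n).
Proof.
move=> d0 + p0 pi_ h.
have mB r : measurable (ball x r : set mR) by exact: measurable_ball.
have ipB r : 0 < r -> r <= eta -> mu.-integrable (ball x r) (EFin \o phi).
  move=> r0 re; apply: (integrableS _ _ _ pi_) => // y.
  by move=> /(h r r0 re).1; rewrite /= !in_itv /= => /andP[/ltW -> /ltW ->].
have ikD := approx_kernel_integral_le (x := x) d0 p0.
elim: n => [|n IH] hn.
  rewrite expr0 mul1r in hn *; have [sub hd] := h _ d0 hn.
  have [|_ hk] := ikD (ball x d) d^-1 (mB d) (ipB _ d0 hn).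
    by move=> y _; exact: approx_kernel_le_inv.
  apply: (le_trans hk); rewrite mulrC ler_pdivrMr//.
  apply: le_trans hd _; rewrite divr1 (_ : 5 - 4 = 1) ?mulr1//; ring.
set r := 2 ^+ n * d in IH *; have e2r : 2 ^+ n.+1 * d = 2 * r by rewrite exprS mulrA.
rewrite e2r in hn *.
have r0 : 0 < r by rewrite mulr_gt0// exprn_gt0.
have rn : r <= eta by apply: le_trans hn; lra.
have r20 : 0 < 2 * r by lra.
have BU : ball x (2 * r) = ball x r `|` (ball x (2 * r) `\` ball x r).
  rewrite setDUK//; apply: le_ball; lra.
have mS : measurable (ball x (2 * r) `\` ball x r : set mR) by exact: measurableD.
have iS : mu.-integrable (ball x (2 * r) `\` ball x r) (EFin \o phi).
  by apply: integrableS (ipB _ r20 hn) => // y [].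
have [|iB _] := ikD (ball x (2 * r)) d^-1 (mB _) (ipB _ r20 hn); first by move=> y _; exact: approx_kernel_le_inv.
rewrite BU Rintegral_setU//=; last 2 first.
  by rewrite -BU.
  by apply/disj_setPS => y [] h1 [].
have [|_ hS] := ikD _ (d / r ^+ 2) mS iS.
  move=> y [_] /negP; rewrite /ball /= -leNgt distrC => ry.
  by apply: approx_kernel_le => //; rewrite le_max ry orbT.
(* The new shell adds 2 e d / r = 2 e / 2^n, which is exactly the increase of e (5 - 4 / 2^n) from n
   to n + 1; the induction closes with equality. *)
apply: (@le_trans _ _ (e * (5 - 4 / 2 ^+ n) + d / r ^+ 2 * (e * (2 * r)))).
  apply: lerD; first exact: IH.
  apply: le_trans hS _.
  rewrite ler_wpM2l ?divr_ge0 ?sqr_ge0 ?(ltW d0)//; apply: le_trans (h _ r20 hn).2.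
  by apply: ge0_Rintegral_subset => //; exact: ipB.
rewrite /r [2 ^+ n.+1]exprS.
have q0 : 0 < 2 ^+ n :> R by rewrite exprn_gt0.
set q := 2 ^+ n in q0 *.
rewrite le_eqVlt; apply/orP; left; apply/eqP; field.
by rewrite !gt_eqF.
Qed.

(** Near [x] the dyadic shells bound the mass by the small means of [phi]. Away from [x] the kernel
    is at most d / (eta / 2)^2, which beats the total mass of [phi] for small d. *)
Lemma approx_kernel_bound (phi : R -> R) (a b x : R) :
  (forall y, 0 <= phi y) -> mu.-integrable `[a, b] (EFin \o phi) ->
  vanishing_mean a b x phi ->
  forall e : R, 0 < e -> exists2 d0 : R, 0 < d0 & forall d, 0 < d -> d < d0 ->
    mu.-integrable `[a, b] (EFin \o (fun y => phi y * approx_kernel d x y)) /\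
    \int[mu]_(y in `[a, b]) (phi y * approx_kernel d x y) <= e.
Proof.
move=> p0 pi_ vm e e0.
set I := \int[mu]_(y in `[a, b]) phi y.
have I0 : 0 <= I by apply: Rintegral_ge0.
(* The dyadic estimate has total factor below 5, so [e / 10] leaves half of [e]. The second entry of
   the minimum that follows makes 4 d I / eta^2 at most the other half, with I + 1 guarding against
   I = 0. *)
have [|eta eta0 h] := vm (e / 10); first by rewrite divr_gt0.
exists (Num.min eta (e * eta ^+ 2 / (8 * (I + 1)))).
  by rewrite lt_min eta0 divr_gt0 ?mulr_gt0 ?exprn_gt0//; lra.
move=> d d0; rewrite lt_min => /andP[de].
rewrite ltr_pdivlMr => [dI|]; last by lra.
have mA : measurable (`[a, b]%classic : set mR) by exact: measurable_itv.
have ikD := approx_kernel_integral_le (x := x) d0 p0.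
have [|iA _] := ikD `[a, b]%classic d^-1 mA pi_; first by move=> y _; exact: approx_kernel_le_inv.
split => //.
(* The last dyadic radius not exceeding [eta]; it is then larger than eta / 2. *)
have [n n1 n2] : exists2 n, 2 ^+ n * d <= eta & eta < 2 ^+ n.+1 * d.
  have ex : exists n, eta < 2 ^+ n.+1 * d.
    exists (Num.bound (eta / d)); rewrite -ltr_pdivrMr//.
    apply: (@lt_le_trans _ _ (Num.bound (eta / d))%:R).
      by rewrite archi_boundP// divr_ge0 ?ltW.
    by rewrite -natrX ler_nat ltnW// (leq_trans (ltn_expl _ (ltnSn 1)))// leq_exp2l.
  case: (ex_minnP ex) => n hn hmin; exists n => //.
  case: n hn hmin => [|n] hn hmin; first by rewrite mul1r ltW.
  by rewrite leNgt; apply/negP => /hmin; rewrite ltnn.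
set r := 2 ^+ n * d in n1 *.
have {}n2 : eta < 2 * r by rewrite /r mulrA -exprS.
have r0 : 0 < r by rewrite mulr_gt0// exprn_gt0.
have [sub _] := h _ r0 n1.
have subc : ball x r `<=` `[a, b].
  by move=> y /sub /=; rewrite !in_itv /= => /andP[/ltW -> /ltW ->].
have mB : measurable (ball x r : set mR) by exact: measurable_ball.
have mS : measurable (`[a, b]%classic `\` ball x r : set mR) by exact: measurableD.
have iS : mu.-integrable (`[a, b]%classic `\` ball x r) (EFin \o phi).
  by apply: integrableS pi_ => // y [].
have BU : `[a, b]%classic = ball x r `|` (`[a, b]%classic `\` ball x r) by rewrite setDUK.
rewrite BU Rintegral_setU//=; last 2 first.
  by rewrite -BU.
  by apply/disj_setPS => y [] h1 [].
have h1 := approx_kernel_dyadic d0 n1 p0 pi_ h.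
have [|_ h2] := ikD _ (d / (eta / 2) ^+ 2) mS iS.
  move=> y [_] /negP; rewrite /ball /= -leNgt distrC => ry.
  apply: approx_kernel_le => //; first by rewrite divr_gt0.
  by rewrite le_max (le_trans _ ry) ?orbT//; lra.
have h3 : \int[mu]_(y in `[a, b]%classic `\` ball x r) phi y <= I.
  by apply: ge0_Rintegral_subset => // y [].
have h4 : e / 10 * (5 - 4 / 2 ^+ n) <= e / 2.
  have : 0 <= 4 / 2 ^+ n :> R by rewrite divr_ge0// exprn_ge0.
  set z := 4 / _ => z0; nra.
have h5 : d / (eta / 2) ^+ 2 * I <= e / 2.
  rewrite (_ : d / (eta / 2) ^+ 2 * I = 4 * d * I / eta ^+ 2); last by field; rewrite gt_eqF.
  rewrite ler_pdivrMr ?exprn_gt0//; nra.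
rewrite [leRHS]splitr; apply: lerD; first exact: le_trans h1 h4.
apply: le_trans h2 _; apply: le_trans h5.
by rewrite ler_wpM2l// divr_ge0 ?sqr_ge0 ?ltW.
Qed.

End LebesguePoints.

(** * Cauchy transform, Poisson kernel and Fatou's theorem on the disc *)

Section Poisson.
Context {R : realType}.
Implicit Types (g : R -> R[i]) (u v : R[i]).
Local Notation mu := (@lebesgue_measure R).
Local Notation mR := (measurableTypeR R).
Local Notation cmeasurable := (@cmeasurable R _ mR).
Local Notation T2 := `[0%R, (2 * pi)%R]%classic.

Lemma le_geometric0 (x c q : R) : 0 <= q -> q < 1 -> (forall n, x <= q ^+ n.+1 * c) -> x <= 0.
Proof.
move=> q0 q1 h; have cv : (fun n => q ^+ n * c : R) @ \oo --> (0 : R).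
  rewrite -(mul0r c); apply: cvgM; last exact: cvg_cst.
  have := @cvg_geometric R 1 q; rewrite ger0_norm// => /(_ q1).
  by apply: cvg_trans; apply: near_eq_cvg; near=> n; rewrite /geometric /= mul1r.
rewrite -(cvg_lim (@norm_hausdorff _ _) cv); apply: limr_ge; first by apply/cvg_ex; exists 0.
near=> n; have -> : n = n.-1.+1 by rewrite prednK//; near: n; exact: nbhs_infty_gt.
exact: h.
Unshelve. all: by end_near. Qed.

(** Identifies a quantity whose partial sums are constant once they contain the term of index 0.
    Hence the exponent [n.+1]: the empty sum is excluded. *)
Lemma eq_geometric (z w : R[i]) (c q : R) : 0 <= q -> q < 1 ->
  (forall n, cmod (z - w) <= q ^+ n.+1 * c) -> z = w.
Proof.
move=> q0 q1 h; apply/eqP; rewrite -subr_eq0 -cmod_eq0 eq_le cmod_ge0 andbT.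
exact: le_geometric0 q0 q1 h.
Qed.

Lemma pi2C_neq0 : (2 * pi)%:C != 0 :> R[i].
Proof. by rewrite -cmod_eq0 cmodR gtr0_norm ?pi2_gt0// gt_eqF ?pi2_gt0. Qed.

Lemma pi2CV : ((2 * pi)^-1)%:C = ((2 * pi)%:C)^-1 :> R[i].
Proof.
apply: (mulfI pi2C_neq0); rewrite divff ?pi2C_neq0//.
by apply: eqc; rewrite ?cReM ?cImM /= ?(mulr0, mul0r, subr0, addr0)// divff// gt_eqF ?pi2_gt0.
Qed.

(** The Cauchy integral of [g] over the unit circle: for zeta = [cis t], d zeta / (zeta - u) is i dt
    / (1 - u / zeta). Its Taylor coefficients are the numbers [fcoef g m]. *)
Definition cauchy_transform g u : R[i] :=
  ((2 * pi)^-1)%:C * cintegral mu T2 (fun t => g t / (1 - u * (cis t)^-1)).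

Let mean g := (2 * pi)^-1 * \int[mu]_(t in T2) cmod (g t).

Lemma cmod_cisV t : cmod (cis t)^-1 = 1 :> R.
Proof. by rewrite cmodV cmod_cis invr1. Qed.

Lemma pi2V_ge0 : 0 <= (2 * pi)^-1 :> R.
Proof. by rewrite invr_ge0 ltW// pi2_gt0. Qed.

Lemma cauchy_transform_series g u N : cintegrable mu T2 g -> cmod u < 1 ->
  cmod (cauchy_transform g u - \sum_(m < N) u ^+ m * fcoef g m) <=
  cmod u ^+ N * (mean g / (1 - cmod u)).
Proof.
move=> gi u1.
have [_ h] := geo_remainder N (measurable_itv _) (@ccontinuous_cisV R) cmod_cisV u1 gi.
rewrite /cauchy_transform (_ : \sum_(m < N) _ = ((2 * pi)^-1)%:C *
    \sum_(m < N) u ^+ m * cintegral mu T2 (fun t => g t * (cis t)^-1 ^+ m)); last first.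
  by rewrite mulr_sumr; apply: eq_bigr => m _; rewrite /fcoef mulrCA.
rewrite -mulrBr cmodM cmodR ger0_norm ?pi2V_ge0// /mean.
apply: le_trans (ler_wpM2l pi2V_ge0 h) _.
by rewrite le_eqVlt; apply/orP; left; apply/eqP; ring.
Qed.

Lemma cauchy_transform_integrable g u : cintegrable mu T2 g -> cmod u < 1 ->
  cintegrable mu T2 (fun t => g t / (1 - u * (cis t)^-1)).
Proof.
move=> gi u1.
by have [] := geo_remainder 0 (measurable_itv _) (@ccontinuous_cisV R) cmod_cisV u1 gi.
Qed.

Lemma one_sub_neq0 u v : cmod u < 1 -> cmod v = 1 -> 1 - u * v != 0.
Proof.
move=> u1 v1; rewrite -cmod_gt0 (lt_le_trans _ (cmod_ler_dist _ _))//.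
by rewrite cmodM v1 mulr1 cmod1 subr_gt0.
Qed.

Lemma one_sub_ge u v : cmod v = 1 -> 1 - cmod u <= cmod (1 - u * v).
Proof.
by move=> v1; rewrite (le_trans _ (cmod_ler_dist _ _))// cmodM v1 mulr1 cmod1.
Qed.

(** On any smaller concentric disc the constant is uniform. This gives the continuity of the
    reflected part up to the boundary of the ellipse. *)
Lemma cauchy_transform_lipschitz g u v : cintegrable mu T2 g -> cmod u < 1 -> cmod v < 1 ->
  cmod (cauchy_transform g u - cauchy_transform g v) <=
  cmod (u - v) * (mean g / ((1 - cmod u) * (1 - cmod v))).
Proof.
move=> gi u1 v1; rewrite -mulrBr cmodM cmodR ger0_norm ?pi2V_ge0//.
have iu := cauchy_transform_integrable gi u1; have iv := cauchy_transform_integrable gi v1.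
have mT : measurable (T2 : set mR) by exact: measurable_itv.
rewrite -(cintegralB (mu := mu) mT iu iv).
have iB := cintegrableB (mu := mu) mT iu iv.
have u1' : 0 < 1 - cmod u by rewrite subr_gt0.
have v1' : 0 < 1 - cmod v by rewrite subr_gt0.
set L := cmod (u - v) / ((1 - cmod u) * (1 - cmod v)).
have h : \int[mu]_(t in T2) cmod (g t / (1 - u * (cis t)^-1) - g t / (1 - v * (cis t)^-1)) <=
    L * \int[mu]_(t in T2) cmod (g t).
  rewrite -RintegralZl//; last exact: (integrable_cmod (mu := mu)).
  apply: le_Rintegral => //; first exact: (integrable_cmod (mu := mu)).
    by apply: (integrableRZ (mu := mu)) => //; exact: (integrable_cmod (mu := mu)).
  move=> t _; have a0 := one_sub_neq0 u1 (cmod_cisV t); have b0 := one_sub_neq0 v1 (cmod_cisV t).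
  have -> : g t / (1 - u * (cis t)^-1) - g t / (1 - v * (cis t)^-1) =
      g t * ((u - v) * (cis t)^-1 / ((1 - u * (cis t)^-1) * (1 - v * (cis t)^-1))).
    by move: a0 b0; set e := (cis t)^-1 => a0 b0; field; rewrite a0 b0.
  rewrite cmodM mulrC ler_wpM2r ?cmod_ge0// cmodM cmodM cmod_cisV mulr1 /L.
  rewrite ler_wpM2l ?cmod_ge0// cmodV cmodM lef_pV2 ?posrE ?mulr_gt0 ?cmod_gt0//.
  by apply: ler_pM; rewrite ?(ltW u1') ?(ltW v1')// one_sub_ge ?cmod_cisV.
apply: le_trans (ler_wpM2l pi2V_ge0 (le_trans (cmod_cintegral (mu := mu) mT iB) h)) _.
by rewrite le_eqVlt; apply/orP; left; apply/eqP; rewrite /L /mean; ring.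
Qed.

Definition poisson u (t : R) : R := (1 - cmod u ^+ 2) / cmod (cis t - u) ^+ 2.

Lemma conj_kernel u v : 1 - u^* * v = (1 - u * v^*)^*.
Proof. by case: u => x y; case: v => a b; apply: eqc => /=; ring. Qed.

(** For a = 1 - u / zeta with |zeta| = 1 one has |zeta - u| = |a| and |u|^2 = (1 - a)(1 - conj a).
    The claim becomes the rational identity (1 - (1 - x)(1 - y)) / (xy) = 1/x + 1/y - 1. *)
Lemma poissonE u t : cmod u < 1 ->
  (poisson u t)%:C = (1 - u * (cis t)^-1)^-1 + (1 - u^* * cis t)^-1 - 1.
Proof.
move=> u1; set a := 1 - u * (cis t)^-1.
have ca : 1 - u^* * cis t = a^*.
  by rewrite /a -(conj_cis t); exact: conj_kernel.
have a0 : a != 0 by apply: one_sub_neq0 => //; exact: cmod_cisV.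
have ac0 : a^* != 0 by rewrite conjc_eq0.
have na : cmod (cis t - u) = cmod a.
  have -> : cis t - u = cis t * a by rewrite /a mulrBr mulr1 mulrCA divff ?mulr1 ?cis_neq0.
  by rewrite cmodM cmod_cis mul1r.
have nu : (cmod u ^+ 2)%:C = (1 - a) * (1 - a^*).
  have -> : 1 - a^* = (1 - a)^* by rewrite cconj_sub1.
  rewrite mul_conjc /a opprB addrCA subrr addr0 cmodM cmod_cisV mulr1 //.
rewrite ca /poisson na.
have -> : ((1 - cmod u ^+ 2) / cmod a ^+ 2)%:C = (1 - (cmod u ^+ 2)%:C) / (cmod a ^+ 2)%:C.
  have n0 : cmod a ^+ 2 != 0 by rewrite expf_neq0// cmod_eq0.
  have n0' : (cmod a ^+ 2)%:C != 0 by rewrite -cmod_eq0 cmodR normr_eq0.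
  apply: (mulIf n0'); rewrite divfK//.
  by apply: eqc; rewrite ?cReM ?cImM /= ?(mulr0, mul0r, subr0, addr0)// ?divfK// addrC; ring.
have key (x y : R[i]) : x != 0 -> y != 0 -> (1 - (1 - x) * (1 - y)) / (x * y) = x^-1 + y^-1 - 1.
  by move=> x0 y0; field; rewrite x0 y0.
by rewrite nu -mul_conjc; exact: key.
Qed.

Lemma poisson_ge0 u t : cmod u < 1 -> 0 <= poisson u t.
Proof.
by move=> u1; rewrite divr_ge0 ?sqr_ge0// subr_ge0 exprn_ile1 ?cmod_ge0 ?ltW.
Qed.

Lemma cauchy_transform_cst u (c : R[i]) : cmod u < 1 -> cauchy_transform (fun=> c) u = c.
Proof.
move=> u1; have gi : cintegrable mu T2 (fun=> c).
  by apply: ccontinuous_cintegrable; exact: ccontinuous_cst.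
apply: (@eq_geometric _ _ (mean (fun=> c) / (1 - cmod u)) (cmod u)); rewrite ?cmod_ge0// => n.
have := cauchy_transform_series n.+1 gi u1.
have -> : \sum_(m < n.+1) u ^+ m * fcoef (fun=> c) m = c => //.
have fE m : fcoef (fun=> c) m = if m == 0%N then c else 0.
  rewrite /fcoef (cintegralZ (mu := mu)) //; last first.
    by apply: ccontinuous_cintegrable; apply: ccontinuousX; exact: ccontinuous_cisV.
  rewrite cintegral_cisVX; case: eqP => _; last by rewrite !mulr0.
  by rewrite pi2CV mulrCA mulVf ?mulr1// pi2C_neq0.
rewrite big_ord_recl fE /= mul1r big1 ?addr0// => m _.
by rewrite fE mulr0.
Qed.

(** The hypothesis says that [g] has no negative frequencies. The conjugate Cauchy kernel then
    integrates to the plain integral of [g], which cancels the -1 in the Poisson kernel. The gain is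
    a nonnegative kernel in place of the Cauchy kernel. *)
Lemma poisson_transform g u : cintegrable mu T2 g -> cmod u < 1 ->
  (forall k, cintegral mu T2 (fun t => g t * cis t ^+ k.+1) = 0) ->
  cintegrable mu T2 (fun t => g t * (poisson u t)%:C) /\
  cauchy_transform g u = ((2 * pi)^-1)%:C * cintegral mu T2 (fun t => g t * (poisson u t)%:C).
Proof.
move=> gi u1 g0.
have mT : measurable (T2 : set mR) by exact: measurable_itv.
have uc1 : cmod u^* < 1 by rewrite cmod_conj.
have i1 := cauchy_transform_integrable gi u1.
have [i2 _] := geo_remainder 0 mT (@ccontinuous_cis R) (@cmod_cis R) uc1 gi.
have e2 : cintegral mu T2 (fun t => g t / (1 - u^* * cis t)) = cintegral mu T2 g.
  apply: (@eq_geometric _ _ ((1 - cmod u^*)^-1 * \int[mu]_(t in T2) cmod (g t)) (cmod u^*));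
    rewrite ?cmod_ge0// => n.
  have [_] := geo_remainder n.+1 mT (@ccontinuous_cis R) (@cmod_cis R) uc1 gi.
  rewrite big_ord_recl /= mul1r big1 ?addr0; last first.
    by move=> m _; rewrite g0 mulr0.
  rewrite -mulrA (_ : cintegral mu T2 (fun t => g t * cis t ^+ 0) = cintegral mu T2 g)//.
  by apply: eq_cintegral => t _; rewrite expr0 mulr1.
have E t : g t * (poisson u t)%:C = g t / (1 - u * (cis t)^-1) + g t / (1 - u^* * cis t) - g t.
  by rewrite poissonE// !mulrDr mulrN mulr1.
have iE : cintegrable mu T2 (fun t => g t / (1 - u * (cis t)^-1) + g t / (1 - u^* * cis t) - g t).
  by apply: (cintegrableB (mu := mu)) => //; exact: (cintegrableD (mu := mu)).
split.
  by apply: (eq_cintegrable (mu := mu) mT) iE => t _; rewrite E.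
congr (_ * _); rewrite [RHS](_ : _ = cintegral mu T2
   (fun t => g t / (1 - u * (cis t)^-1) + g t / (1 - u^* * cis t) - g t)).
  rewrite (cintegralB (mu := mu) mT)//; last exact: (cintegrableD (mu := mu)).
  by rewrite (cintegralD (mu := mu) mT)// e2 addrK.
by apply: eq_cintegral => t _; rewrite E.
Qed.

(** In the approach region both 1 - |u| and |t - t0| are at most (1 + M) / k times |zeta - u|: the
    first trivially, the second through the chord bound and the triangle inequality. The factor 2
    comes from 1 - |u|^2 <= 2 (1 - |u|). *)
Lemma poisson_approx_kernel (t0 k M : R) u t : 0 < k -> k <= 1 -> 0 <= M -> cmod u < 1 ->
  cmod (u - cis t0) <= M * (1 - cmod u) -> k * `|t - t0| <= cmod (cis t - cis t0) ->
  poisson u t <= 2 * ((1 + M) / k) ^+ 2 * approx_kernel (1 - cmod u) t0 t.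
Proof.
move=> k0 k1 M0 u1 uM kt; set D := cmod (cis t - u); set d := 1 - cmod u.
have d0 : 0 < d by rewrite subr_gt0.
have dD : d <= D by rewrite /d /D -(cmod_cis t) cmod_ler_dist.
have D0 : 0 < D by exact: lt_le_trans dD.
set L := (1 + M) / k.
have L0 : 0 < L by rewrite divr_gt0//; lra.
have mx : Num.max d `|t - t0| <= L * D.
  rewrite ge_max; apply/andP; split.
    apply: le_trans dD _; rewrite -{1}(mul1r D) ler_pM2r// /L ler_pdivlMr//; lra.
  rewrite /L mulrAC ler_pdivlMr// mulrC (le_trans kt)//.
  apply: le_trans (cmodBD u _ _) _; rewrite -/D mulrDl mul1r lerD2l.
  by apply: le_trans uM _; rewrite ler_wpM2l.
rewrite /poisson /approx_kernel -/D -/d.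
have m0 : 0 < Num.max d `|t - t0| by rewrite lt_max d0.
set m := Num.max _ _ in mx m0 *.
have h1 : 1 - cmod u ^+ 2 <= 2 * d by have := sqr_ge0 (1 - cmod u); rewrite /d; lra.
have h2 : (D ^+ 2)^-1 <= L ^+ 2 / m ^+ 2.
  rewrite ler_pdivlMr ?exprn_gt0// mulrC ler_pdivrMr ?exprn_gt0// -exprMn.
  by rewrite ler_sqr ?nnegrE ?(ltW m0)// ltW// mulr_gt0.
have -> : 2 * L ^+ 2 * (d / m ^+ 2) = 2 * d * (L ^+ 2 / m ^+ 2) by ring.
apply: ler_pM => //; last by rewrite invr_ge0 sqr_ge0.
by rewrite subr_ge0 exprn_ile1 ?cmod_ge0 ?ltW.
Qed.

(** The transform reproduces constants, so [g t0] may be subtracted under the integral. At a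
    Lebesgue point the Poisson integral of the difference is controlled by [approx_kernel_bound]. *)
Theorem fatou_nontangential g : cintegrable mu T2 g ->
  (forall k, cintegral mu T2 (fun t => g t * cis t ^+ k.+1) = 0) ->
  {ae mu, forall t0, t0 \in `]0, (2 * pi)[ -> forall M e : R, 0 < e ->
    exists2 d : R, 0 < d & forall u, cmod u < 1 -> cmod (u - cis t0) <= M * (1 - cmod u) ->
      1 - cmod u < d -> cmod (cauchy_transform g u - g t0) <= e}.
Proof.
move=> gi g0; have mT : measurable (T2 : set mR) by exact: measurable_itv.
apply: (aeS (mu := mu)) (clebesgue_pt_itv pi2_gt0 gi) => t0 vm t0I M e e0.
have {}vm := vm t0I; move: (t0I); rewrite in_itv /= => /andP[t00 t02].
have [k [k0 k1 kt]] := cisB_ge t00 t02.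
pose h t := g t - g t0.
have ic : cintegrable mu T2 (fun=> g t0).
  by apply: ccontinuous_cintegrable; exact: ccontinuous_cst.
have hi : cintegrable mu T2 h by exact: (cintegrableB (mu := mu)).
(* Subtracting a constant creates no negative frequency, so the Poisson representation also applies
   to [h]. *)
have h0 n : cintegral mu T2 (fun t => h t * cis t ^+ n.+1) = 0.
  have iX : cintegrable mu T2 (fun t => cis t ^+ n.+1).
    by apply: ccontinuous_cintegrable; apply: ccontinuousX; exact: ccontinuous_cis.
  have iGX : cintegrable mu T2 (fun t => g t * cis t ^+ n.+1).
    rewrite (_ : (fun t => _) = (fun t => cis t ^+ n.+1 * g t)); last by apply/funext => t; rewrite mulrC.
    apply: (cintegrableMb (mu := mu) mT (M := 1)) => //.
      by apply: ccontinuous_cmeasurable => //; apply: ccontinuousX; exact: ccontinuous_cis.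
    by move=> t _; rewrite cmodX cmod_cis expr1n.
  rewrite (_ : (fun t => _) = (fun t => g t * cis t ^+ n.+1 - g t0 * cis t ^+ n.+1)); last first.
    by apply/funext => t; rewrite /h mulrBl.
  rewrite (cintegralB (mu := mu) mT)//; last exact: (cintegrableZ (mu := mu)).
  by rewrite g0 (cintegralZ (mu := mu) mT)// cintegral_cisX mulr0 subrr.
pose N := Num.max M 0.
have N0 : 0 <= N by rewrite le_max lexx orbT.
pose L := 2 * ((1 + N) / k) ^+ 2.
have L0 : 0 < L by rewrite mulr_gt0// exprn_gt0// divr_gt0//; lra.
(* Chosen to cancel the comparison constant [L] and the normalisation 1 / (2 pi). *)
have e1 : 0 < 2 * pi * e / L by rewrite divr_gt0// mulr_gt0// pi2_gt0.
have [d0 d00 hd] := approx_kernel_bound (fun y => cmod_ge0 (g y - g t0))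
  (integrable_cmod (mu := mu) mT hi) vm e1.
exists d0 => // u u1 uM ud.
have {}uM : cmod (u - cis t0) <= N * (1 - cmod u).
  by apply: le_trans uM _; rewrite ler_wpM2r ?subr_ge0 ?(ltW u1)// le_max lexx.
have [||ik Ik] := hd (1 - cmod u) => //; first by rewrite subr_gt0.
have E : cauchy_transform g u - g t0 = cauchy_transform h u.
  rewrite -{1}(cauchy_transform_cst (g t0) u1) /cauchy_transform -mulrBr.
  have iu := cauchy_transform_integrable gi u1; have iv := cauchy_transform_integrable ic u1.
  rewrite -(cintegralB (mu := mu) mT iu iv); congr (_ * _).
  by apply: eq_cintegral => t _; rewrite /h mulrBl.
have [iP ->] : cintegrable mu T2 (fun t => h t * (poisson u t)%:C) /\
    cauchy_transform g u - g t0 =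
    ((2 * pi)^-1)%:C * cintegral mu T2 (fun t => h t * (poisson u t)%:C).
  by rewrite E; exact: poisson_transform.
rewrite cmodM cmodR ger0_norm ?pi2V_ge0//.
rewrite mulrC ler_pdivrMr ?pi2_gt0//.
apply: le_trans (cmod_cintegral (mu := mu) mT iP) _.
apply: (@le_trans _ _ (\int[mu]_(t in T2) (L * (cmod (g t - g t0) * approx_kernel (1 - cmod u) t0 t)))).
  apply: le_Rintegral => //; first exact: (integrable_cmod (mu := mu)).
    exact: (integrableRZ (mu := mu)).
  move=> t; rewrite /= in_itv /= => /andP[t1 t2].
  rewrite cmodM cmodR (ger0_norm (poisson_ge0 _ u1)) [leRHS]mulrCA ler_wpM2l ?cmod_ge0//.
  by apply: poisson_approx_kernel => //; exact: kt.
rewrite RintegralZl// mulrC -ler_pdivlMr//; apply: le_trans Ik _.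
by rewrite (mulrC e).
Qed.

End Poisson.

(** * The ellipse and its Cauchy kernel *)

Section Joukowski.
Context {R : realType}.
Implicit Types (z w v u : R[i]).

Definition joukowski v : R[i] := (v + v^-1) / 2%:R.

Lemma twoC : 2%:R = (2%:R : R)%:C :> R[i].
Proof. by apply: eqc; rewrite -[(2%:R : R[i])]/(1 + 1) ?cReD ?cImD /= ?addr0. Qed.

Lemma cmod2 : cmod (2%:R : R[i]) = 2.
Proof. by rewrite twoC cmodR ger0_norm. Qed.

Lemma two_neq0 : (2%:R : R[i]) != 0.
Proof. by rewrite -cmod_eq0 cmod2. Qed.

(** The two preimages z + s and z - s, with s^2 = z^2 - 1, are inverse to each other, so one of them
    has modulus at least 1. *)
Lemma joukowski_ex z : exists2 v, 1 <= cmod v & z = joukowski v.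
Proof.
pose s := sqrtc (z ^+ 2 - 1); have s2 : s ^+ 2 = z ^+ 2 - 1 by exact: sqr_sqrtc.
have h : (z + s) * (z - s) = 1
  by have -> : (z + s) * (z - s) = z ^+ 2 - s ^+ 2; [ring|rewrite s2; ring].
have m : cmod (z + s) * cmod (z - s) = 1 by rewrite -cmodM h cmod1.
have v0 : z + s != 0.
  by apply/eqP => v0; move: h; rewrite v0 mul0r => /esym/eqP; rewrite oner_eq0.
have vi : z - s = (z + s)^-1 by apply: (mulfI v0); rewrite h divff.
have [c|c] := leP 1 (cmod (z + s)).
  exists (z + s) => //; rewrite /joukowski -vi.
  by have := two_neq0 => t0; field.
exists (z - s); last by rewrite /joukowski {2}vi invrK; have := two_neq0 => t0; field.
by rewrite vi cmodV invf_ge1 ?cmod_gt0// ltW.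
Qed.

Lemma joukowskiB v w : v != 0 -> w != 0 ->
  joukowski v - joukowski w = (v - w) * (1 - (v * w)^-1) / 2%:R.
Proof. by move=> v0 w0; rewrite /joukowski; have := two_neq0 => t0; field; rewrite ?v0 ?w0 ?t0. Qed.

(** The distances to the foci are |v - 1|^2 / (2|v|) and |v + 1|^2 / (2|v|); the parallelogram law
    adds them up. *)
Lemma focal_sum_joukowski v : v != 0 -> focal_sum (joukowski v) = cmod v + (cmod v)^-1.
Proof.
move=> v0; have cv : cmod v != 0 by rewrite cmod_eq0.
have t0 := two_neq0.
have e1 : joukowski v - 1 = (v - 1) ^+ 2 / (2%:R * v) by rewrite /joukowski; field; rewrite ?v0 ?t0.
have e2 : joukowski v + 1 = (v + 1) ^+ 2 / (2%:R * v) by rewrite /joukowski; field; rewrite ?v0 ?t0.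
rewrite /focal_sum e1 e2 cmodM cmodV cmodX (cmodM 2%:R) cmod2 cmodM cmodV cmodX.
rewrite (cmodM 2%:R) cmod2 -mulrDl.
have -> : cmod (v - 1) ^+ 2 + cmod (v + 1) ^+ 2 = 2 * (cmod v ^+ 2 + 1).
  by rewrite !cmod_sqr; case: v {v0 cv e1 e2} => a b /=; ring.
by field.
Qed.

Lemma focal_sum_lipschitz z w : focal_sum z - focal_sum w <= 2 * cmod (z - w).
Proof.
rewrite /focal_sum.
have h1 := cmod_ler_dist (z - 1) (w - 1); have h2 := cmod_ler_dist (z + 1) (w + 1).
have e1 : z - 1 - (w - 1) = z - w by ring.
have e2 : z + 1 - (w + 1) = z - w by ring.
move: h1 h2; rewrite e1 e2; lra.
Qed.
End Joukowski.

Section Ellipse.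
Context {R : realType} (theta : R) (theta1 : 1 < theta).
Implicit Types (z w v u : R[i]) (g : R -> R[i]).
Local Notation mu := (@lebesgue_measure R).
Local Notation mR := (measurableTypeR R).
Local Notation cmeasurable := (@cmeasurable R _ mR).
Local Notation T2 := `[0%R, (2 * pi)%R]%classic.
Local Notation rho := (Num.sqrt theta).

Lemma rho_gt1 : 1 < rho.
Proof. by rewrite -[ltLHS]sqrtr1 ltr_sqrt// (lt_trans ltr01). Qed.

Lemma rho_gt0 : 0 < rho.
Proof. exact: lt_trans ltr01 rho_gt1. Qed.

Lemma rhoC_neq0 : rho%:C != 0 :> R[i].
Proof. by rewrite -cmod_eq0 cmodR normr_eq0 gt_eqF// rho_gt0. Qed.

Lemma cmod_rho : cmod (rho%:C : R[i]) = rho.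
Proof. by rewrite cmodR gtr0_norm// rho_gt0. Qed.

Lemma realCV (x : R) : x != 0 -> (x^-1)%:C = (x%:C)^-1 :> R[i].
Proof.
move=> x0; have c0 : x%:C != 0 :> R[i] by rewrite -cmod_eq0 cmodR normr_eq0.
apply: (mulfI c0); rewrite divff//.
by apply: eqc; rewrite ?cReM ?cImM /= ?(mulr0, mul0r, subr0, addr0)// divff.
Qed.

Lemma ellipse_pointE t : ellipse_point theta t = joukowski (rho%:C * cis t).
Proof.
have r0 : rho != 0 by rewrite gt_eqF// rho_gt0.
rewrite /joukowski invfM -realCV// -conj_cis.
have -> : (2%:R : R[i])^-1 = (2^-1)%:C.
  by rewrite realCV ?pnatr_eq0// twoC.
apply: eqc; rewrite /ellipse_point /semi_major /semi_minor !(cReM, cImM, cReD, cImD) /=; ring.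
Qed.

Lemma ellipse_speedE t : ellipse_speed theta t =
  (0 +i* 1) * ((rho%:C * cis t - (rho%:C * cis t)^-1) / 2%:R).
Proof.
have r0 : rho != 0 by rewrite gt_eqF// rho_gt0.
rewrite invfM -realCV// -conj_cis.
have -> : (2%:R : R[i])^-1 = (2^-1)%:C.
  by rewrite realCV ?pnatr_eq0// twoC.
apply: eqc; rewrite /ellipse_speed /semi_major /semi_minor
  !(cReM, cImM, cReD, cImD, cReN, cImN) /=; ring.
Qed.

Lemma cisr_neq0 t : rho%:C * cis t != 0.
Proof. by rewrite mulf_neq0 ?rhoC_neq0 ?cis_neq0. Qed.

Lemma cmod_cisr t : cmod (rho%:C * cis t) = rho.
Proof. by rewrite cmodM cmod_cis mulr1 cmod_rho. Qed.

(** With x = |v| the gap rho + 1/rho - x - 1/x factors as (rho - x)(1 - 1/(x rho)), and the second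
    factor is positive for x >= 1. *)
Lemma ellipse_joukowski v : 1 <= cmod v -> ellipse theta (joukowski v) <-> cmod v < rho.
Proof.
move=> v1; have v0 : 0 < cmod v by exact: lt_le_trans ltr01 v1.
rewrite /ellipse /= focal_sum_joukowski -?cmod_gt0//.
have r1 := rho_gt1; have r0 := rho_gt0; set r := rho in r1 r0 *; set x := cmod v in v1 v0 *.
have -> : (x + x^-1 < r + r^-1) = (0 < (r - x) * (1 - (x * r)^-1)).
  by rewrite -subr_gt0; congr (0 < _); field; rewrite !gt_eqF.
have xr : 0 < 1 - (x * r)^-1.
  by rewrite subr_gt0 invf_lt1 ?mulr_gt0//; nra.
by rewrite pmulr_lgt0// subr_gt0.
Qed.

Lemma ellipse_boundary_joukowski v : cmod v = rho -> ellipse_boundary theta (joukowski v).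
Proof. by move=> vr; rewrite /ellipse_boundary /= focal_sum_joukowski ?vr// -cmod_gt0 vr rho_gt0. Qed.

Lemma ellipse_point_dist z t :
  (rho + rho^-1 - focal_sum z) / 2 <= cmod (ellipse_point theta t - z).
Proof.
have := focal_sum_lipschitz (ellipse_point theta t) z.
have /= -> : focal_sum (ellipse_point theta t) = rho + rho^-1.
  by rewrite ellipse_pointE; exact: (ellipse_boundary_joukowski (cmod_cisr t)).
by move=> h; rewrite ler_pdivrMr// mulrC.
Qed.

(** Partial fractions in zeta = [cis t]: the poles v / rho and 1 / (v rho) both lie in the unit
    disc, so the Cauchy integral over the ellipse splits into two Cauchy transforms of the disc. *)
Lemma ellipse_kernel v t : 1 <= cmod v -> cmod v < rho ->
  ellipse_speed theta t / (ellipse_point theta t - joukowski v) =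
  (0 +i* 1) * ((1 - v / rho%:C * (cis t)^-1)^-1 + (1 - (v * rho%:C)^-1 * (cis t)^-1)^-1 - 1).
Proof.
move=> v1 vr; have v0 : v != 0 by rewrite -cmod_gt0 (lt_le_trans ltr01).
rewrite ellipse_speedE ellipse_pointE joukowskiB ?cisr_neq0//.
have r0 := rhoC_neq0; have c0 := cis_neq0 t; have t0 := @two_neq0 R.
have n1 : rho%:C * cis t - v != 0.
  rewrite -cmod_gt0 (lt_le_trans _ (cmod_ler_dist _ _))// cmod_cisr subr_gt0//.
have n2 : v * rho%:C * cis t - 1 != 0.
  rewrite -cmod_gt0 (lt_le_trans _ (cmod_ler_dist _ _))// cmod1 subr_gt0.
  by rewrite -mulrA cmodM cmod_cisr (lt_le_trans rho_gt1)// ler_peMl// ltW// rho_gt0.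
set r := rho%:C in r0 n1 n2 *; set c := cis t in c0 n1 n2 *.
move: (0 +i* 1) => ii; field.
by apply/and5P; split.
Qed.

Lemma fcoef0E g : fcoef g 0 = ((2 * pi)^-1)%:C * cintegral mu T2 g.
Proof. by rewrite /fcoef; congr (_ * _); apply: eq_cintegral => t _; rewrite expr0 mulr1. Qed.

Lemma cmod_div_rho v : cmod v < rho -> cmod (v / rho%:C) < 1.
Proof. by move=> vr; rewrite cmodM cmodV cmod_rho ltr_pdivrMr ?rho_gt0// mul1r. Qed.

Lemma cmod_inv_rho v : 1 <= cmod v -> cmod ((v * rho%:C)^-1) < 1.
Proof.
move=> v1; rewrite cmodV cmodM cmod_rho invf_lt1 ?mulr_gt0 ?rho_gt0 ?(lt_le_trans ltr01)//.
by rewrite (lt_le_trans rho_gt1)// ler_peMl// ltW// rho_gt0.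
Qed.

Lemma cauchy_integralE g v : cintegrable mu T2 g -> 1 <= cmod v -> cmod v < rho ->
  cauchy_integral theta g (joukowski v) =
  cauchy_transform g (v / rho%:C) + cauchy_transform g ((v * rho%:C)^-1) - fcoef g 0.
Proof.
move=> gi v1 vr; have mT : measurable (T2 : set mR) by exact: measurable_itv.
have i1 := cauchy_transform_integrable gi (cmod_div_rho vr).
have i2 := cauchy_transform_integrable gi (cmod_inv_rho v1).
rewrite fcoef0E /cauchy_transform -mulrDr -mulrBr.
rewrite -(cintegralD (mu := mu) mT i1 i2) -(cintegralB (mu := mu) mT)//; last first.
  exact: (cintegrableD (mu := mu)).
rewrite /cauchy_integral.
have -> : 0 +i* (2 * pi) = (0 +i* 1) * (2 * pi)%:C :> R[i].
  by apply: eqc; rewrite ?cReM ?cImM /=; ring.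
have i0 : (0 +i* 1) != 0 :> R[i] by rewrite -cmod_eq0 cmodE /= expr0n expr1n add0r sqrtr1 oner_eq0.
rewrite invfM -pi2CV -mulrA mulrCA; congr (_ * _).
rewrite (_ : cintegral _ _ _ = cintegral mu T2 (fun t => (0 +i* 1) *
  (g t / (1 - v / rho%:C * (cis t)^-1) + g t / (1 - (v * rho%:C)^-1 * (cis t)^-1) - g t))).
  rewrite (cintegralZ (mu := mu) mT).
    by rewrite mulrA mulVf ?mul1r.
  by apply: (cintegrableB (mu := mu)) => //; exact: (cintegrableD (mu := mu)).
apply: eq_cintegral => t _.
by rewrite -mulrA ellipse_kernel// mulrCA !mulrDr mulrN1.
Qed.

Lemma ccontinuous_ellipse_point : ccontinuous (ellipse_point theta).
Proof.
split => t /=; apply: cvgM; try exact: cvg_cst; [exact: continuous_cos|exact: continuous_sin].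
Qed.

Lemma ccontinuous_ellipse_speed : ccontinuous (ellipse_speed theta).
Proof.
split => t /=; [apply: cvgN|]; apply: cvgM; try exact: cvg_cst;
  [exact: continuous_sin|exact: continuous_cos].
Qed.

Lemma semi_minor_gt0 : 0 < semi_minor theta.
Proof.
rewrite divr_gt0// subr_gt0 (lt_trans _ rho_gt1)// invf_lt1 ?rho_gt0//; exact: rho_gt1.
Qed.

Lemma semi_major_ge : semi_minor theta <= semi_major theta.
Proof.
rewrite /semi_minor /semi_major ler_pM2r ?invr_gt0// lerD2l.
by have := rho_gt0; rewrite -invr_gt0; lra.
Qed.

Lemma ellipse_speed_sqr t : cmod (ellipse_speed theta t) ^+ 2 =
  semi_major theta ^+ 2 * sin t ^+ 2 + semi_minor theta ^+ 2 * cos t ^+ 2.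
Proof. by rewrite cmod_sqr /=; ring. Qed.

Lemma ellipse_speed_ge t : semi_minor theta <= cmod (ellipse_speed theta t).
Proof.
have b0 := semi_minor_gt0; have ab := semi_major_ge.
rewrite -ler_sqr ?nnegrE ?cmod_ge0 ?(ltW b0)// ellipse_speed_sqr.
rewrite -[leLHS]mulr1 -(cos2Dsin2 t).
have h : semi_minor theta ^+ 2 <= semi_major theta ^+ 2.
  by rewrite ler_sqr ?nnegrE ?(ltW b0)// (le_trans (ltW b0)).
have := ler_wpM2r (sqr_ge0 (sin t)) h; lra.
Qed.

Lemma ellipse_speed_le t : cmod (ellipse_speed theta t) <= semi_major theta.
Proof.
have b0 := semi_minor_gt0; have ab := semi_major_ge.
have a0 : 0 <= semi_major theta by apply: le_trans ab; exact: ltW.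
rewrite -ler_sqr ?nnegrE ?cmod_ge0// ellipse_speed_sqr.
rewrite -[leRHS]mulr1 -(cos2Dsin2 t).
have h : semi_minor theta ^+ 2 <= semi_major theta ^+ 2.
  by rewrite ler_sqr ?nnegrE ?(ltW b0)//.
have := ler_wpM2r (sqr_ge0 (cos t)) h; lra.
Qed.

(** The speed of the parametrization stays between the two semi-axes, so arc length and the
    parameter define the same L^2 space. *)
Lemma szego_norm2_fin g : cmeasurable T2 g ->
  (szego_norm2 theta g < +oo)%E <-> mu.-integrable T2 (EFin \o (fun t => cmod (g t) ^+ 2)).
Proof.
move=> mg; have mT : measurable (T2 : set mR) by exact: measurable_itv.
have ms : cmeasurable T2 (ellipse_speed theta).
  by apply: ccontinuous_cmeasurable => //; exact: ccontinuous_ellipse_speed.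
have mg2 : measurable_fun (T2 : set mR) (fun t => cmod (g t) ^+ 2).
  by apply: measurable_funX; exact: cmeasurable_cmod.
have mh : measurable_fun (T2 : set mR) (fun t => cmod (g t) ^+ 2 * cmod (ellipse_speed theta t)).
  by apply: measurable_funM => //; exact: cmeasurable_cmod.
have b0 := semi_minor_gt0.
have ihP : (szego_norm2 theta g < +oo)%E <-> mu.-integrable T2
    (EFin \o (fun t => cmod (g t) ^+ 2 * cmod (ellipse_speed theta t))).
  have E : szego_norm2 theta g = (\int[mu]_(t in T2)
      `|(EFin \o (fun t => cmod (g t) ^+ 2 * cmod (ellipse_speed theta t))%R) t|)%E.
    apply: eq_integral => t _ /=; rewrite ger0_norm// mulr_ge0 ?sqr_ge0//; exact: cmod_ge0.
  rewrite E; split => [h|/integrableP[]//]; apply/integrableP; split => //.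
  exact/measurable_EFinP.
rewrite ihP; split=> h.
- have := integrableRZ (mu := mu) mT (semi_minor theta)^-1 h.
  apply: le_integrable => //; first exact/measurable_EFinP.
  move=> t _; rewrite /= lee_fin ger0_norm ?sqr_ge0// ger0_norm; last first.
    by rewrite !mulr_ge0 ?sqr_ge0 ?invr_ge0 ?(ltW b0) ?cmod_ge0.
  rewrite mulrC -mulrA -[leLHS]mulr1 ler_wpM2l ?sqr_ge0// ler_pdivlMr// mul1r.
  exact: ellipse_speed_ge.
- have := integrableRZ (mu := mu) mT (semi_major theta) h.
  apply: le_integrable => //; first exact/measurable_EFinP.
  have a0 : 0 <= semi_major theta by apply: le_trans semi_major_ge; exact: ltW.
  move=> t _; rewrite /= lee_fin ger0_norm ?mulr_ge0 ?sqr_ge0 ?cmod_ge0// ger0_norm; last first.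
    by rewrite mulr_ge0 ?sqr_ge0.
  by rewrite mulrC ler_wpM2r ?sqr_ge0// ellipse_speed_le.
Qed.

(** For the kernels k1 at z and k2 at z + h, (k2 - k1) / h - k1^2 = h k1^2 k2 holds exactly. The
    Lipschitz bound on the focal sum keeps z at distance [d] from the boundary, so the right side is
    O(h) uniformly in t. *)
Lemma cauchy_integral_holomorphic g : cintegrable mu T2 g ->
  holomorphic_on (ellipse theta) (cauchy_integral theta g).
Proof.
move=> gi z zE; have mT : measurable (T2 : set mR) by exact: measurable_itv.
set d := (rho + rho^-1 - focal_sum z) / 2.
have d0 : 0 < d by rewrite divr_gt0// subr_gt0.
pose P := ellipse_point theta; pose S := ellipse_speed theta.
have dP t : d <= cmod (P t - z) by exact: ellipse_point_dist.
have dPh h t : cmod h < d / 2 -> d / 2 <= cmod (P t - (h + z)).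
  move=> hd; have -> : P t - (h + z) = (P t - z) - h by ring.
  have := cmod_ler_dist (P t - z) h; have := dP t; lra.
have iGS : cintegrable mu T2 (fun t => S t * g t).
  apply: (cintegrableMb (mu := mu) mT (M := semi_major theta)) => //.
    by apply: ccontinuous_cmeasurable => //; exact: ccontinuous_ellipse_speed.
  by move=> t _; exact: ellipse_speed_le.
have ik (k : R -> R[i]) c : ccontinuous k -> (forall t, cmod (k t) <= c) ->
    cintegrable mu T2 (fun t => k t * (S t * g t)).
  move=> ck kc; apply: (cintegrableMb (mu := mu) mT (M := c)) => //.
  exact: ccontinuous_cmeasurable.
have cPz w : ccontinuous (fun t => P t - w).
  by apply: ccontinuousD; [exact: ccontinuous_ellipse_point|exact: ccontinuous_cst].
have Pz0 t : P t - z != 0 by rewrite -cmod_gt0 (lt_le_trans d0).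
have Ph0 h t : cmod h < d / 2 -> P t - (h + z) != 0.
  by move=> hd; rewrite -cmod_gt0 (lt_le_trans _ (dPh h t hd))// divr_gt0.
pose c : R[i] := (0 +i* (2 * pi))^-1.
pose k1 t := (P t - z)^-1; pose k2 h t := (P t - (h + z))^-1.
have ck1 : ccontinuous k1 by apply: ccontinuousV.
have ck2 h : cmod h < d / 2 -> ccontinuous (k2 h).
  by move=> hd; apply: ccontinuousV => // t; exact: Ph0.
have bk1 t : cmod (k1 t) <= d^-1 by rewrite cmodV lef_pV2 ?posrE// (lt_le_trans d0).
have bk2 h t : cmod h < d / 2 -> cmod (k2 h t) <= (d / 2)^-1.
  move=> hd; have d20 : 0 < d / 2 by rewrite divr_gt0.
  by rewrite /k2 cmodV lef_pV2 ?posrE ?dPh// (lt_le_trans d20 (dPh h t hd)).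
have FE w : cauchy_integral theta g w = c * cintegral mu T2 (fun t => (P t - w)^-1 * (S t * g t)).
  by congr (_ * _); apply: eq_cintegral => t _; rewrite [RHS]mulrC (mulrC (g t)).
pose D := c * cintegral mu T2 (fun t => k1 t * k1 t * (S t * g t)).
apply/cvg_ex; exists D; apply/cvgCP => e e0.
set I := \int[mu]_(t in T2) cmod (S t * g t).
have I0 : 0 <= I by apply: Rintegral_ge0 => t _; exact: cmod_ge0.
pose K := cmod c * (d^-1 * d^-1 * (d / 2)^-1 * I).
have di0 : 0 <= d^-1 by rewrite invr_ge0 ltW.
have d2i0 : 0 <= (d / 2)^-1 by rewrite invr_ge0 divr_ge0// ltW.
have K0 : 0 <= K by rewrite mulr_ge0 ?cmod_ge0// mulr_ge0// mulr_ge0// mulr_ge0.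
pose d' := Num.min (d / 2) (e / (K + 1)).
have K1 : 0 < K + 1 by lra.
have d'0 : 0 < d' by rewrite lt_min divr_gt0//= divr_gt0.
apply/nbhsC; exists d' => // h; rewrite subr0 => hd' h0.
move: hd'; rewrite lt_min => /andP[hd he].
rewrite /= (_ : h *: 1 + z = h + z); last by rewrite /GRing.scale /= mulr1.
rewrite !FE.
have i1 := ik _ _ ck1 bk1; have i2 := ik _ _ (ck2 _ hd) (fun t => bk2 h t hd).
have i11 : cintegrable mu T2 (fun t => k1 t * k1 t * (S t * g t)).
  apply: (ik _ (d^-1 * d^-1)); first exact: ccontinuousM.
  by move=> t; rewrite cmodM; apply: ler_pM; rewrite ?cmod_ge0.
have i112 : cintegrable mu T2 (fun t => k1 t * k1 t * k2 h t * (S t * g t)).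
  apply: (ik _ (d^-1 * d^-1 * (d / 2)^-1)).
    by apply: ccontinuousM; [exact: ccontinuousM|exact: ck2].
  by move=> t; rewrite !cmodM; apply: ler_pM; rewrite ?mulr_ge0 ?cmod_ge0 ?bk2//;
     apply: ler_pM; rewrite ?cmod_ge0.
have E : h^-1 *: (c * cintegral mu T2 (fun t => k2 h t * (S t * g t)) -
      c * cintegral mu T2 (fun t => k1 t * (S t * g t))) - D =
    h * (c * cintegral mu T2 (fun t => k1 t * k1 t * k2 h t * (S t * g t))).
  have h00 : h != 0 by [].
  rewrite /D -mulrBr -(cintegralB (mu := mu) mT i2 i1) /GRing.scale /=.
  rewrite mulrCA -mulrBr mulrCA; congr (_ * _).
  rewrite -(cintegralZ (mu := mu) mT); last exact: (cintegrableB (mu := mu)).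
  rewrite -(cintegralB (mu := mu) mT)//; last first.
    by apply: (cintegrableZ (mu := mu) mT); exact: (cintegrableB (mu := mu)).
  rewrite -(cintegralZ (mu := mu) mT)//.
  apply: eq_cintegral => t _; rewrite /k1 /k2.
  have p0 := Pz0 t; have q0 := Ph0 h t hd.
  have hq : P t - (h + z) = P t - z - h by ring.
  rewrite hq in q0 *; move: (P t - z) p0 q0 => p p0 q0; move: (S t * g t) => y.
  by field; rewrite p0 q0 h00.
rewrite E cmodM cmodM.
have hB : cmod (cintegral mu T2 (fun t => k1 t * k1 t * k2 h t * (S t * g t))) <=
    d^-1 * d^-1 * (d / 2)^-1 * I.
  apply: le_trans (cmod_cintegral (mu := mu) mT i112) _.
  rewrite -RintegralZl//; last exact: (integrable_cmod (mu := mu)).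
  apply: le_Rintegral => //; first exact: (integrable_cmod (mu := mu)).
    by apply: (integrableRZ (mu := mu)) => //; exact: (integrable_cmod (mu := mu)).
  move=> t _; rewrite [X in X <= _]cmodM; apply: ler_wpM2r; first exact: cmod_ge0.
  rewrite cmodM [X in X * _ <= _]cmodM; apply: ler_pM; rewrite ?mulr_ge0 ?cmod_ge0 ?bk2//.
  by apply: ler_pM; rewrite ?cmod_ge0.
apply: (@le_lt_trans _ _ (cmod h * K)).
  by rewrite ler_wpM2l ?cmod_ge0// ler_wpM2l ?cmod_ge0.
have : cmod h * (K + 1) < e by rewrite -ltr_pdivlMr.
by have := cmod_ge0 h; nra.
Qed.

End Ellipse.

(** * The Szego space described by square summable coefficients *)

Section SzegoSpace.
Context {R : realType} (theta : R) (theta1 : 1 < theta).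
Implicit Types (z w v u : R[i]) (g : R -> R[i]).
Local Notation mu := (@lebesgue_measure R).
Local Notation mR := (measurableTypeR R).
Local Notation cmeasurable := (@cmeasurable R _ mR).
Local Notation T2 := `[0%R, (2 * pi)%R]%classic.
Local Notation rho := (Num.sqrt theta).
Local Notation mean g := ((2 * pi)^-1 * \int[mu]_(t in T2) cmod (g t)).

Lemma mean_ge0 g : 0 <= mean g.
Proof. by rewrite mulr_ge0 ?pi2V_ge0//; apply: Rintegral_ge0 => t _; exact: cmod_ge0. Qed.

Lemma cmod_fcoef g k : cintegrable mu T2 g -> cmod (fcoef g k) <= mean g.
Proof.
move=> gi; have mT : measurable (T2 : set mR) by exact: measurable_itv.
have ik := cintegrable_mul_cisVX k gi.
rewrite /fcoef cmodM cmodR ger0_norm ?pi2V_ge0// ler_wpM2l ?pi2V_ge0//.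
apply: le_trans (cmod_cintegral (mu := mu) mT ik) _.
rewrite le_eqVlt; apply/orP; left; apply/eqP.
by apply: eq_Rintegral => t _; rewrite cmodM cmod_cisVX mulr1.
Qed.

Lemma fcoefD g h k : cintegrable mu T2 g -> cintegrable mu T2 h ->
  fcoef (fun t => g t + h t) k = fcoef g k + fcoef h k.
Proof.
move=> gi hi; have mT : measurable (T2 : set mR) by exact: measurable_itv.
rewrite /fcoef -mulrDr -(cintegralD (mu := mu) mT); try exact: cintegrable_mul_cisVX.
by congr (_ * _); apply: eq_cintegral => t _; rewrite mulrDl.
Qed.

Lemma fcoefB g h k : cintegrable mu T2 g -> cintegrable mu T2 h ->
  fcoef (fun t => g t - h t) k = fcoef g k - fcoef h k.
Proof.
move=> gi hi; have mT : measurable (T2 : set mR) by exact: measurable_itv.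
rewrite /fcoef -mulrBr -(cintegralB (mu := mu) mT); try exact: cintegrable_mul_cisVX.
by congr (_ * _); apply: eq_cintegral => t _; rewrite mulrBl.
Qed.

Lemma cauchy_transformD g h u : cintegrable mu T2 g -> cintegrable mu T2 h -> cmod u < 1 ->
  cauchy_transform (fun t => g t + h t) u = cauchy_transform g u + cauchy_transform h u.
Proof.
move=> gi hi u1; have mT : measurable (T2 : set mR) by exact: measurable_itv.
rewrite /cauchy_transform -mulrDr -(cintegralD (mu := mu) mT); try exact: cauchy_transform_integrable.
by congr (_ * _); apply: eq_cintegral => t _; rewrite mulrDl.
Qed.

Lemma cauchy_transform_cvg g u : cintegrable mu T2 g -> cmod u < 1 ->
  (fun N => \sum_(m < N) u ^+ m * fcoef g m : R[i]) @ \oo --> cauchy_transform g u.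
Proof.
move=> gi u1; apply/cvgCP => e e0.
set K := mean g / (1 - cmod u).
have K0 : 0 <= K by rewrite divr_ge0 ?mean_ge0// subr_ge0 ltW.
have cg : (fun n => cmod u ^+ n * K : R) @ \oo --> (0 : R).
  rewrite -(mul0r K); apply: cvgM; last exact: cvg_cst.
  have := @cvg_geometric R 1 (cmod u); rewrite ger0_norm ?cmod_ge0// => /(_ u1).
  by apply: cvg_trans; apply: near_eq_cvg; near=> n; rewrite /geometric /= mul1r.
near=> n; rewrite cmodBC; apply: le_lt_trans (cauchy_transform_series n gi u1) _.
by near: n; exact: (cvgr_lt _ cg _ e0).
Unshelve. all: by end_near. Qed.

(* The reflection of the analytic function [u |-> cauchy_transform a u] in the
   circle has only nonpositive frequencies. *)
Lemma reflected_fcoef g (q : R) : cintegrable mu T2 g -> 0 <= q -> q < 1 ->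
  ccontinuous (fun t => cauchy_transform g (q%:C * (cis t)^-1)) /\
  forall k, fcoef (fun t => cauchy_transform g (q%:C * (cis t)^-1)) k =
            if k == 0%N then fcoef g 0 else 0.
Proof.
move=> gi q0 q1; set b := fun t => _.
have mT : measurable (T2 : set mR) by exact: measurable_itv.
have uq t : cmod (q%:C * (cis t)^-1) = q by rewrite cmodM cmod_cisV mulr1 cmodR ger0_norm.
have u1 t : cmod (q%:C * (cis t)^-1) < 1 by rewrite uq.
have cb : ccontinuous b.
  pose K := mean g / ((1 - q) * (1 - q)).
  have K0 : 0 <= K by rewrite divr_ge0 ?mean_ge0// mulr_ge0// subr_ge0 ltW.
  have cV := @ccontinuous_cisV R.
  have lip s t : cmod (b s - b t) <= K * (`|Re (cis s)^-1 - Re (cis t)^-1| + `|Im (cis s)^-1 - Im (cis t)^-1|).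
    apply: le_trans (cauchy_transform_lipschitz gi (u1 s) (u1 t)) _.
    rewrite !uq mulrC ler_wpM2l// -mulrBr cmodM cmodR ger0_norm//.
    apply: (@le_trans _ _ (cmod ((cis s)^-1 - (cis t)^-1))).
      by rewrite ler_piMl ?cmod_ge0// ltW.
    by apply: le_trans (cmod_ReIm _) _; rewrite cReD cImD cReN cImN.
  have key t (e : R) : 0 < e -> \forall s \near t, cmod (b s - b t) < e.
    move=> e0; have K1 : 0 < K + 1 by lra.
    have e1 : 0 < e / (K + 1) / 2 by rewrite !divr_gt0.
    have [/(_ t) /cvgrPdist_lt /(_ _ e1) h1 /(_ t) /cvgrPdist_lt /(_ _ e1) h2] := cV.
    near=> s; apply: le_lt_trans (lip s t) _.
    have n1 : `|Re (cis s)^-1 - Re (cis t)^-1| < e / (K + 1) / 2 by rewrite distrC; near: s.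
    have n2 : `|Im (cis s)^-1 - Im (cis t)^-1| < e / (K + 1) / 2 by rewrite distrC; near: s.
    apply: (@le_lt_trans _ _ (K * (e / (K + 1)))).
      by rewrite ler_wpM2l// [leRHS]splitr lerD ?ltW.
    by rewrite mulrA ltr_pdivrMr//; nra.
  split => t; apply/cvgrPdist_lt => e /(key t); apply: filterS => s.
  - by apply: le_lt_trans; rewrite -cReN -cReD (le_trans (cmod_Re _))// cmodBC.
  - by apply: le_lt_trans; rewrite -cImN -cImD (le_trans (cmod_Im _))// cmodBC.
split => // k; have bi : cintegrable mu T2 b by exact: ccontinuous_cintegrable.
(* The Taylor polynomial [s] has exactly the claimed coefficients, and it is within a constant times
   q^(n+1) of [b] uniformly in t. *)
apply: (@eq_geometric _ _ _ (mean g / (1 - q)) q) => // n.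
pose s t := \sum_(m < n.+1) (q%:C * (cis t)^-1) ^+ m * fcoef g m.
have cs : ccontinuous s.
  apply: ccontinuous_sum => m; apply: ccontinuousM; last exact: ccontinuous_cst.
  by apply: ccontinuousX; apply: ccontinuousM; [exact: ccontinuous_cst|exact: ccontinuous_cisV].
have si : cintegrable mu T2 s by exact: ccontinuous_cintegrable.
have -> : (if k == 0%N then fcoef g 0 else 0) = fcoef s k.
  have iX m : cintegrable mu T2 (fun t => (cis t)^-1 ^+ m).
    by apply: ccontinuous_cintegrable; apply: ccontinuousX; exact: ccontinuous_cisV.
  rewrite [RHS](_ : _ = \sum_(m < n.+1) (q%:C ^+ m * fcoef g m) *
      (((2 * pi)^-1)%:C * cintegral mu T2 (fun t => (cis t)^-1 ^+ (m + k)))); last first.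
    rewrite /fcoef [X in _ * X](_ : _ = cintegral mu T2 (fun t => \sum_(m < n.+1)
      (q%:C ^+ m * fcoef g m) * (cis t)^-1 ^+ (m + k))); last first.
      apply: eq_cintegral => t _; rewrite /s mulr_suml; apply: eq_bigr => m _.
      by rewrite exprMn exprD; ring.
    rewrite (cintegral_sum (mu := mu) mT); last by move=> m; exact: (cintegrableZ (mu := mu)).
    rewrite mulr_sumr; apply: eq_bigr => m _.
    by rewrite (cintegralZ (mu := mu) mT)// mulrCA.
  rewrite big_ord_recl /= big1 ?addr0; last first.
    by move=> m _; rewrite cintegral_cisVX /= !mulr0.
  rewrite cintegral_cisVX add0n mul1r; case: eqP => _; last by rewrite !mulr0.
  by rewrite pi2CV mulVf ?mulr1// pi2C_neq0.
have isb : cintegrable mu T2 (fun t => b t - s t) by exact: (cintegrableB (mu := mu)).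
rewrite -(fcoefB k bi si); apply: le_trans (cmod_fcoef k isb) _.
have h : \int[mu]_(t in T2) cmod (b t - s t) <= \int[mu]_(t in T2) (q ^+ n.+1 * (mean g / (1 - q))).
  apply: le_Rintegral => //; first exact: (integrable_cmod (mu := mu)).
    by apply: continuous_integrable => t; exact: cvg_cst.
  by move=> t _; have := cauchy_transform_series n.+1 gi (u1 t); rewrite uq.
apply: le_trans (ler_wpM2l (@pi2V_ge0 R) h) _.
rewrite Rintegral_itv_cst ?(ltW (@pi2_gt0 _))// subr0 mulrCA mulVf ?mulr1//.
by rewrite gt_eqF// pi2_gt0.
Unshelve. all: by end_near. Qed.

Lemma sqr_integrableD (f g : R -> R[i]) : cmeasurable T2 f -> cmeasurable T2 g ->
  mu.-integrable T2 (EFin \o (fun t => cmod (f t) ^+ 2)) ->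
  mu.-integrable T2 (EFin \o (fun t => cmod (g t) ^+ 2)) ->
  mu.-integrable T2 (EFin \o (fun t => cmod (f t + g t) ^+ 2)).
Proof.
move=> mf mg f2 g2; have mT : measurable (T2 : set mR) by exact: measurable_itv.
have := integrableRZ (mu := mu) mT 2 (integrableRD (mu := mu) mT f2 g2).
apply: le_integrable => //.
  apply/measurable_EFinP; apply: measurable_funX; apply: cmeasurable_cmod => //.
  exact: cmeasurableD.
move=> t _; rewrite /= lee_fin ger0_norm ?sqr_ge0// ger0_norm; last first.
  by rewrite mulr_ge0// addr_ge0// sqr_ge0.
have := cmodD (f t) (g t); have := cmod_ge0 (f t); have := cmod_ge0 (g t).
have := cmod_ge0 (f t + g t).
set x := cmod _; set y := cmod _; set z := cmod _ => x0 y0 z0 h.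
have : x ^+ 2 <= (z + y) ^+ 2 by rewrite ler_sqr ?nnegrE// addr_ge0.
by have := sqr_ge0 (y - z); nra.
Qed.

(** Carries approach regions from the ellipse to the disc. From joukowski v - joukowski w0 = (v -
    w0)(1 - 1/(v w0)) / 2 and |1 - 1/(v w0)| >= 1 - 1/rho, distances in [v] are at most 2 / (1 -
    1/rho) times those in z. *)
Lemma approach_region_joukowski v (t0 M : R) : 0 <= M -> 1 <= cmod v ->
  approach_region theta (ellipse_point theta t0) M (joukowski v) ->
  [/\ cmod v < rho,
    cmod (v / rho%:C - cis t0) <= 2 / (1 - rho^-1) * M * (1 - cmod (v / rho%:C)) &
    cmod (v - rho%:C * cis t0) <= 2 / (1 - rho^-1) * cmod (joukowski v - ellipse_point theta t0)].
Proof.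
move=> M0 v1 [/(ellipse_joukowski theta1 v1) vr hM]; have r1 := rho_gt1 theta1.
have r0 := rho_gt0 theta1; have v0 : v != 0 by rewrite -cmod_gt0 (lt_le_trans ltr01).
have cv0 : 0 < cmod v by rewrite cmod_gt0.
set w0 := rho%:C * cis t0; have w00 : w0 != 0 by exact: cisr_neq0.
have cw0 : cmod w0 = rho by exact: cmod_cisr.
have s0 : 0 < 1 - rho^-1 by rewrite subr_gt0 invf_lt1.
set s := 1 - rho^-1 in s0 *.
have sc : s <= cmod (1 - (v * w0)^-1).
  apply: le_trans (cmod_ler_dist _ _); rewrite cmod1 /s lerD2l lerN2.
  by rewrite cmodV cmodM cw0 lef_pV2 ?posrE ?mulr_gt0// ler_peMl// ltW.
have h1 : cmod (v - w0) <= 2 / s * cmod (joukowski v - ellipse_point theta t0).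
  rewrite ellipse_pointE// -/w0 joukowskiB// cmodM cmodV cmod2 cmodM.
  set x := cmod (v - w0); set c := cmod (1 - _) in sc *.
  have -> : 2 / s * (x * c / 2) = x * (c / s) by field; rewrite gt_eqF.
  by rewrite ler_peMr ?cmod_ge0// ler_pdivlMr// mul1r.
(* [w] is the radial projection of [v] to the circle of radius rho. As a test point on the boundary
   it shows that [joukowski v] is at distance at most rho - |v| from it. *)
split => //; pose k : R := rho / cmod v; pose w := k%:C * v.
have k0 : 0 < k by rewrite divr_gt0.
have k1 : 1 < k by rewrite ltr_pdivlMr// mul1r.
have cw : cmod w = rho by rewrite cmodM cmodR gtr0_norm// divfK ?gt_eqF.
have wn0 : w != 0 by rewrite -cmod_gt0 cw.
have vw : cmod (v - w) = rho - cmod v.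
  have -> : v - w = (1 - k)%:C * v by rewrite /w; apply: eqc; rewrite ?cReD ?cImD ?cReN ?cImN ?cReM ?cImM /=; ring.
  rewrite cmodM cmodR ltr0_norm ?subr_lt0// opprB mulrBl mul1r divfK// gt_eqF//.
have h2 : cmod (joukowski v - joukowski w) <= rho - cmod v.
  rewrite joukowskiB// !cmodM cmodV cmod2 vw -mulrA ler_piMr ?subr_ge0 ?(ltW vr)//.
  rewrite ler_pdivrMr// mul1r (le_trans (cmodB _ _))// cmod1.
  have : cmod (v * w)^-1 <= 1.
    have c1 : 1 <= cmod (v * w) by rewrite cmodM cw; nra.
    by rewrite cmodV invf_le1// (lt_le_trans ltr01 c1).
  lra.
have h3 := hM _ (ellipse_boundary_joukowski theta1 cw).
have -> : v / rho%:C - cis t0 = (v - w0) / rho%:C.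
  by rewrite mulrBl /w0 mulrAC divff ?mul1r// rhoC_neq0.
rewrite !cmodM cmodV cmod_rho// -[X in _ * (X - _)](divff (lt0r_neq0 r0)) -mulrBl mulrA.
rewrite ler_pM2r ?invr_gt0//; apply: le_trans h1 _.
rewrite -(mulrA (2 / s)); apply: ler_wpM2l; first by rewrite divr_ge0// ltW.
by apply: le_trans h3 _; rewrite ler_wpM2l.
Qed.

Lemma ae_neq (c : R) : {ae mu, forall x : R, x != c}.
Proof.
exists [set c]; split; [exact: measurable_set1|exact: lebesgue_measure_set1|].
by move=> x /= /negP; rewrite negbK => /eqP.
Qed.

(* The boundary function is [f] plus the reflection [t |-> A (q (cis t)^-1)] of
   its analytic extension [A], with [q = rho^-2]; the reflection has no positive
   frequencies, so it adds only a constant to the Cauchy integral. *)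
Theorem szego_of_coefs (a : nat -> R[i]) (B : R) :
  (forall n, \sum_(k < n) cmod (a k) ^+ 2 <= B) ->
  exists2 F, szego_space theta F & forall v, 1 <= cmod v -> cmod v < rho ->
    (fun N => \sum_(k < N) a k * ((v / rho%:C) ^+ k + (v * rho%:C)^-1 ^+ k) : R[i]) @ \oo
      --> F (joukowski v).
Proof.
move=> aB; have [f [mf f2 fa f0]] := riesz_fischer aB.
have mT : measurable (T2 : set mR) by exact: measurable_itv.
have r1 := rho_gt1 theta1; have r0 := rho_gt0 theta1.
(* For v = rho zeta on the boundary circle, the second pole 1 / (v rho) is q / zeta. *)
pose q : R := (rho * rho)^-1.
have q0 : 0 <= q by rewrite invr_ge0 mulr_ge0 ?ltW.
have q1 : q < 1 by rewrite invf_lt1 ?mulr_gt0//; nra.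
have fi := sqr_cintegrable erefl mf f2.
pose b t := cauchy_transform f (q%:C * (cis t)^-1).
have [cb fb] := reflected_fcoef fi q0 q1; rewrite -/b in cb fb.
have bi : cintegrable mu T2 b by exact: ccontinuous_cintegrable.
have mb : cmeasurable T2 b by exact: ccontinuous_cmeasurable.
have b2 : mu.-integrable T2 (EFin \o (fun t => cmod (b t) ^+ 2)).
  by apply: continuous_integrable; exact: ccontinuous_sqr.
pose g t := f t + b t.
have mg : cmeasurable T2 g by exact: cmeasurableD.
have gi : cintegrable mu T2 g by exact: (cintegrableD (mu := mu)).
have g2 : mu.-integrable T2 (EFin \o (fun t => cmod (g t) ^+ 2)) by exact: sqr_integrableD.
have cTb u : cmod u < 1 -> cauchy_transform b u = a 0%N.
  move=> u1; apply: (cvgC_unique (cauchy_transform_cvg bi u1)).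
  apply: cvg_near_cst; near=> N; have -> : N = N.-1.+1 by rewrite prednK//; near: N; exact: nbhs_infty_gt.
  rewrite big_ord_recl fb /= mul1r fa big1 ?addr0// => m _.
  by rewrite fb mulr0.
pose F := cauchy_integral theta g.
(* The reflection contributes [a 0] to each of the two transforms, while [fcoef g 0] is 2 [a 0], so
   all the constants cancel. *)
have FE v : 1 <= cmod v -> cmod v < rho ->
    F (joukowski v) = cauchy_transform f (v / rho%:C) + cauchy_transform f ((v * rho%:C)^-1).
  move=> v1 vr; have u1 := cmod_div_rho theta1 vr; have u2 := cmod_inv_rho theta1 v1.
  rewrite /F cauchy_integralE// !cauchy_transformD// !cTb// fcoefD// fb fa /=; ring.
exists F; last first.
  move=> v v1 vr; rewrite FE//.
  have := cvgCD (FF := eventually_filter) (cauchy_transform_cvg fi (cmod_div_rho theta1 vr))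
    (cauchy_transform_cvg fi (cmod_inv_rho theta1 v1)).
  apply: cvg_trans; apply: near_eq_cvg; near=> N.
  rewrite -big_split /=; apply: eq_bigr => k _.
  by rewrite fa mulrDr ![a k * _]mulrC.
split; first exact: cauchy_integral_holomorphic.
exists g; split => //; last by apply/(szego_norm2_fin theta1 mg).
case: mg => mg1 mg2; split => //.
(* Fatou's theorem concerns the open parameter interval; its two endpoints form a null set. *)
have := aeI (aeI (ae_neq 0) (ae_neq (2 * pi))) (fatou_nontangential fi f0).
apply: (aeS (mu := mu)) => t [[t0 tp] hf].
rewrite in_itv /= => /andP[t00 t2p].
have {}hf := hf _; have tI : t \in `]0, (2 * pi)[.
  by rewrite in_itv /= !lt_neqAle eq_sym t0 t00 tp t2p.
have {}hf := hf tI.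
move=> M; apply/cvgCP => e e0.
pose N := Num.max M 0; have N0 : 0 <= N by rewrite le_max lexx orbT.
pose s := 1 - rho^-1; have s0 : 0 < s by rewrite subr_gt0 invf_lt1.
have e3 : 0 < e / 3 by rewrite divr_gt0.
have [d d0 hd] := hf (2 / s * N) _ e3.
(* Lipschitz constant of the reflected part in z: 2/s converts distances in z into distances in [v],
   and s and 1 - q bound from below the distances of the two arguments from the unit circle. *)
pose K := 2 / s * (mean f / (s * (1 - q))).
have K0 : 0 <= K.
  by rewrite mulr_ge0 ?divr_ge0 ?mean_ge0 ?mulr_ge0 ?(ltW s0)// subr_ge0 ltW.
have K1 : 0 < K + 1 by lra.
(* The first bound forces 1 - |v / rho| < d through the factor 2/s; the second makes the reflected
   part vary by less than e / 3. *)
apply/nbhsC; exists (Num.min (d * s / 2) (e / 3 / (K + 1))).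
  by rewrite lt_min; apply/andP; split; apply: divr_gt0 => //; exact: mulr_gt0.
move=> z; rewrite lt_min => /andP[z1 z2] zR.
have [v v1 zv] := joukowski_ex z; rewrite {z}zv in z1 z2 zR *.
have {}zR : approach_region theta (ellipse_point theta t) N (joukowski v).
  case: zR => zE zw; split => // w wb; apply: le_trans (zw w wb) _.
  by rewrite ler_wpM2r ?cmod_ge0// le_max lexx.
have [vr h1 h2] := approach_region_joukowski N0 v1 zR.
rewrite -/s in h1 h2; set x := cmod (joukowski v - _) in z1 z2 h2 *.
have v0 : v != 0 by rewrite -cmod_gt0 (lt_le_trans ltr01).
set w0 := rho%:C * cis t in h2 *; have w00 : w0 != 0 by exact: cisr_neq0.
have cw0 : cmod w0 = rho by exact: cmod_cisr.
have u1 := cmod_div_rho theta1 vr; have u2 := cmod_inv_rho theta1 v1.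
have hA : cmod (cauchy_transform f (v / rho%:C) - f t) <= e / 3.
  apply: hd => //; apply: (@le_lt_trans _ _ (2 / s * x)).
    apply: le_trans h2; rewrite cmodM cmodV cmod_rho//.
    rewrite -[X in X - _](divff (lt0r_neq0 r0)) -mulrBl ler_pdivrMr//.
    have := cmod_ler_dist w0 v; rewrite cw0 cmodBC => h; apply: le_trans h _.
    by rewrite ler_peMr ?cmod_ge0// ltW.
  rewrite (_ : 2 / s * x = x / (s / 2)); last by field; rewrite gt_eqF.
  by rewrite ltr_pdivrMr ?divr_gt0// mulrA.
have qE : q%:C * (cis t)^-1 = (w0 * rho%:C)^-1.
  rewrite /q realCV ?mulf_neq0 ?gt_eqF// /w0 rmorphM !invfM; ring.
have u3 : cmod (w0 * rho%:C)^-1 < 1 by apply: cmod_inv_rho => //; rewrite cw0 ltW.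
have hB : cmod (cauchy_transform f ((v * rho%:C)^-1) - b t) <= K * x.
  rewrite /b qE; apply: le_trans (cauchy_transform_lipschitz fi u2 u3) _.
  have -> : K * x = 2 / s * x * (mean f / (s * (1 - q))) by rewrite /K; ring.
  apply: ler_pM; rewrite ?cmod_ge0//.
  - by rewrite divr_ge0 ?mean_ge0// mulr_ge0// subr_ge0 ltW.
  - apply: le_trans h2; have rC := rhoC_neq0 theta1.
    have -> : (v * rho%:C)^-1 - (w0 * rho%:C)^-1 = (w0 - v) * (v * (w0 * rho%:C))^-1.
      by move: w0 w00 {cw0 qE u3} => y y0; move: rho%:C rC => r rn; field; rewrite rn v0 y0.
    have c1 : 1 <= cmod (v * (w0 * rho%:C)) by rewrite cmodM cmodM cw0 cmod_rho//; nra.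
    by rewrite cmodM cmodBC ler_piMr ?cmod_ge0// cmodV invf_le1// (lt_le_trans ltr01 c1).
  - have sq0 : 0 < s * (1 - q) by rewrite mulr_gt0// subr_gt0.
    have uu0 : 0 < (1 - cmod (v * rho%:C)^-1) * (1 - cmod (w0 * rho%:C)^-1).
      by rewrite mulr_gt0 ?subr_gt0.
    rewrite ler_wpM2l ?mean_ge0// lef_pV2 ?posrE//.
    apply: ler_pM; rewrite ?(ltW s0) ?subr_ge0 ?(ltW q1)//.
      rewrite /s lerD2l lerN2 cmodV cmodM cmod_rho// lef_pV2 ?posrE ?mulr_gt0 ?cmod_gt0//.
      by rewrite ler_peMl// ltW.
    by rewrite lerD2l lerN2 cmodV cmodM cmod_rho// cw0.
rewrite -/F FE// /g.
have -> : cauchy_transform f (v / rho%:C) + cauchy_transform f ((v * rho%:C)^-1) - (f t + b t) =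
  (cauchy_transform f (v / rho%:C) - f t) + (cauchy_transform f ((v * rho%:C)^-1) - b t) by ring.
apply: le_lt_trans (cmodD _ _) _.
have : x * (K + 1) < e / 3 by rewrite -ltr_pdivlMr.
have : 0 <= x by exact: cmod_ge0.
by move: hA hB; set X := cmod _; set Y := cmod _; nra.
Unshelve. all: by end_near. Qed.

Theorem szego_coefs F : szego_space theta F -> exists (a : nat -> R[i]) (B : R),
  (forall n, \sum_(k < n) cmod (a k) ^+ 2 <= B) /\
  forall v, 1 <= cmod v -> cmod v < rho ->
    (fun N => \sum_(k < N) a k * ((v / rho%:C) ^+ k + (v * rho%:C)^-1 ^+ k) : R[i]) @ \oo
      --> F (joukowski v).
Proof.
move=> [_ [g [[mg1 mg2 _] gn FE]]].
have mT : measurable (T2 : set mR) by exact: measurable_itv.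
have mg : cmeasurable T2 g by [].
have g2 : mu.-integrable T2 (EFin \o (fun t => cmod (g t) ^+ 2)).
  by apply/(szego_norm2_fin theta1 mg).
have gi := sqr_cintegrable erefl mg g2.
(* At index 0 the two transforms give the mean of [g] twice and the kernel removes it once, while
   v^0 + v^-0 is 2; hence the half. *)
pose a k := if k == 0%N then fcoef g 0 / 2%:R else fcoef g k.
exists a, (\int[mu]_(t in T2) (cmod (g t) ^+ 2) / (2 * pi)); split.
  move=> n; rewrite ler_pdivlMr ?pi2_gt0// mulrC; apply: le_trans (bessel n mg g2).
  rewrite ler_pM2l ?pi2_gt0//; apply: ler_sum => k _; rewrite /a; case: eqP => [->|//].
  rewrite cmodM cmodV cmod2 exprMn ler_piMr ?sqr_ge0//.
  by rewrite exprn_ile1// invf_le1// ler1n.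
move=> v v1 vr; have u1 := cmod_div_rho theta1 vr; have u2 := cmod_inv_rho theta1 v1.
rewrite FE; last exact/(ellipse_joukowski theta1 v1).
rewrite cauchy_integralE//.
have := cvgC_subr (FF := eventually_filter) (y := fcoef g 0)
  (cvgCD (FF := eventually_filter) (cauchy_transform_cvg gi u1) (cauchy_transform_cvg gi u2)).
apply: cvg_trans; apply: near_eq_cvg; near=> N.
have -> : N = N.-1.+1 by rewrite prednK//; near: N; exact: nbhs_infty_gt.
rewrite !big_ord_recl /= !expr0 !mul1r /a /=.
have -> : \sum_(i < N.-1) fcoef g (bump 0 i) * ((v / rho%:C) ^+ bump 0 i + (v * rho%:C)^-1 ^+ bump 0 i) =
  \sum_(i < N.-1) (v / rho%:C) ^+ bump 0 i * fcoef g (bump 0 i) +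
  \sum_(i < N.-1) (v * rho%:C)^-1 ^+ bump 0 i * fcoef g (bump 0 i).
  by rewrite -big_split /=; apply: eq_bigr => k _; rewrite mulrDr ![fcoef g _ * _]mulrC.
have -> : fcoef g 0 / 2%:R * (1 + 1) = fcoef g 0 by have t0 := @two_neq0 R; field.
ring.
Unshelve. all: by end_near. Qed.

End SzegoSpace.

(** * Chebyshev and Jacobi expansions *)

Section Chebyshev.
Context {R : realType}.
Implicit Types (p q : {poly R}) (x t : R).
Local Notation mu := (@lebesgue_measure R).
Local Notation mR := (measurableTypeR R).
Local Notation P1 := `[0%R, pi%R]%classic.

(* [tau n] is twice the n-th Chebyshev polynomial of the first kind, so that
   [tau n] at [(v + 1/v) / 2] is [v ^ n + v ^ (-n)] for every n. *)
Fixpoint tau2 n : {poly R} * {poly R} :=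
  if n is m.+1 then let: (a, b) := tau2 m in (b, 2 *: ('X * b) - a)
  else (2%:P, 2 *: 'X).

Definition tau n := (tau2 n).1.

Lemma tau0 : tau 0 = 2%:P. Proof. by []. Qed.
Lemma tau1 : tau 1 = 2 *: 'X. Proof. by []. Qed.
Lemma tauSS n : tau n.+2 = 2 *: ('X * tau n.+1) - tau n.
Proof. by rewrite /tau /=; case: (tau2 n). Qed.

Lemma tau_ind (P : nat -> Prop) : P 0%N -> P 1%N -> (forall n, P n -> P n.+1 -> P n.+2) ->
  forall n, P n.
Proof.
move=> P0 P1' PS n; suff: P n /\ P n.+1 by case.
by elim: n => [|n [h1 h2]]; split => //; exact: PS.
Qed.

Lemma tau_cos n t : (tau n).[cos t] = 2 * cos (n%:R * t).
Proof.
elim/tau_ind: n => [||n h1 h2].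
- by rewrite tau0 hornerC mul0r cos0 mulr1.
- by rewrite tau1 hornerZ hornerX mul1r.
- rewrite tauSS hornerD hornerN hornerZ mulrC hornerM hornerX h1 h2.
  have -> : n.+2%:R * t = n.+1%:R * t + t by rewrite -[n.+2]addn1 natrD; ring.
  have -> : n%:R * t = n.+1%:R * t - t by rewrite -[n.+1]addn1 natrD; ring.
  by rewrite cosB cosD; ring.
Qed.

Lemma tau_cis n t : ((tau n).[cos t])%:C = cis t ^+ n + (cis t)^-1 ^+ n :> R[i].
Proof.
rewrite tau_cos exprVn cisX -conj_cis; apply: eqc; rewrite ?cReD ?cImD /=; ring.
Qed.

Lemma size_tau n : size (tau n) = n.+1.
Proof.
elim/tau_ind: n => [||n h1 h2].
- by rewrite tau0 size_polyC pnatr_eq0.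
- by rewrite tau1 size_scale ?pnatr_eq0// size_polyX.
- have n0 : tau n.+1 != 0 by rewrite -size_poly_eq0 h2.
  have sX : size (2 *: ('X * tau n.+1)) = n.+3.
    by rewrite size_scale ?pnatr_eq0// mulrC size_mulX// h2.
  by rewrite tauSS size_polyDl ?sX// size_polyN h1.
Qed.

(** A multiple of [b n] cancels the top coefficient. Serves for the Chebyshev family as well as for
    the Jacobi family. *)
Lemma degree_basis (b : nat -> {poly R}) : (forall k, size (b k) = k.+1) ->
  forall n p, (size p <= n)%N -> exists c : nat -> R, p = \sum_(j < n) c j *: b j.
Proof.
move=> sb; elim=> [|n IH] p sp.
  exists (fun=> 0); rewrite big_ord0; apply/eqP; rewrite -size_poly_eq0; lia.
have ln : (b n)`_n != 0.
  by have := sb n; rewrite -[n in _`_n]/(n.+1.-1) => {1}<-; rewrite -/(lead_coef (b n)) lead_coef_eq0 -size_poly_eq0 sb.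
pose c := p`_n / (b n)`_n.
have [|d hd] := IH (p - c *: b n).
  apply/leq_sizeP => j; rewrite leq_eqVlt => /predU1P[<-|nj].
    by rewrite coefB coefZ /c divfK// subrr.
  rewrite coefB coefZ !nth_default ?mulr0 ?subrr// ?sb//; exact: leq_trans sp nj.
exists (fun j => if (j < n)%N then d j else c).
rewrite big_ord_recr /= ltnn -[LHS](subrK (c *: b n)) hd; congr (_ + _).
by apply: eq_bigr => i _; rewrite ltn_ord.
Qed.

(** The Chebyshev coefficient of [p] before normalisation: x = cos t turns the weight 1 / sqrt(1 -
    x^2) into dt. *)
Definition chebI p (j : nat) : R := \int[mu]_(t in P1) (p.[cos t] * cos (j%:R * t)).

Lemma continuous_poly_cos p : continuous (fun t => p.[cos t]).
Proof. by move=> t; apply: continuous_comp; [exact: continuous_cos|exact: continuous_horner]. Qed.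

Lemma continuous_cosn (n : nat) : continuous (fun t : R => cos (n%:R * t)).
Proof.
move=> x; apply: continuous_comp; last exact: continuous_cos.
by apply: cvgM; [exact: cvg_cst|exact: cvg_id].
Qed.

Lemma continuousM_R (f g : R -> R) : continuous f -> continuous g -> continuous (fun t => f t * g t).
Proof. by move=> cf cg t; apply: cvgM; [exact: cf|exact: cg]. Qed.

Lemma chebI_integrand_continuous p (j : nat) : continuous (fun t : R => p.[cos t] * cos (j%:R * t)).
Proof. by apply: continuousM_R; [exact: continuous_poly_cos|exact: continuous_cosn]. Qed.

Lemma chebID p q j : chebI (p + q) j = chebI p j + chebI q j.
Proof.
rewrite /chebI -RintegralD//; try by apply: continuous_integrable; exact: chebI_integrand_continuous.
by apply: eq_Rintegral => t _; rewrite hornerD mulrDl.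
Qed.

Lemma chebIZ c p j : chebI (c *: p) j = c * chebI p j.
Proof.
rewrite /chebI -RintegralZl//; last by apply: continuous_integrable; exact: chebI_integrand_continuous.
by apply: eq_Rintegral => t _; rewrite hornerZ mulrA.
Qed.

Lemma chebI_sum n (c : nat -> R) (b : nat -> {poly R}) j :
  chebI (\sum_(k < n) c k *: b k) j = \sum_(k < n) c k * chebI (b k) j.
Proof.
elim: n => [|n IH]; last by rewrite !big_ord_recr /= chebID chebIZ IH.
rewrite !big_ord0 /chebI; have := @chebIZ 0 0 j; rewrite scale0r mul0r /chebI => ->//.
Qed.

Lemma Rintegral_cosn_pi (n : nat) : \int[mu]_(t in P1) cos (n%:R * t) = if n == 0%N then pi else 0 :> R.
Proof.
case: n => [|n] /=.
  rewrite (_ : Rintegral _ _ _ = \int[mu]_(t in P1) 1); last first.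
    by apply: eq_Rintegral => t _; rewrite mul0r cos0.
  by rewrite Rintegral_itv_cst ?ltW ?pi_gt0// mul1r subr0.
rewrite Rintegral_cosn ?pi_gt0// mulr0 sin0 subr0.
suff -> : sin (n.+1%:R * pi) = 0 :> R by rewrite mulr0.
elim: n => [|n IH]; first by rewrite mul1r sinpi.
by rewrite -[n.+2]addn1 natrD mulrDl mul1r sinD IH sinpi mulr0 mul0r addr0.
Qed.

Lemma chebI_tau k j : chebI (tau k) j =
  if k == j then (if j == 0%N then 2 * pi else pi) else 0.
Proof.
have cc (a b : nat) : mu.-integrable P1 (EFin \o (fun t : R => cos (a%:R * t))).
  by apply: continuous_integrable; exact: continuous_cosn.
wlog kj : k j / (j <= k)%N.
  move=> h; have [jk|kj] := leqP j k; first exact: h.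
  rewrite (_ : chebI (tau k) j = chebI (tau j) k); last first.
    by apply: eq_Rintegral => t _; rewrite !tau_cos; ring.
  rewrite (h _ _ (ltnW kj)) eq_sym; case: eqP => // ->//.
have -> : chebI (tau k) j = \int[mu]_(t in P1) (cos ((k + j)%:R * t) + cos ((k - j)%:R * t)).
  apply: eq_Rintegral => t _.
  have hD : (k + j)%:R * t = k%:R * t + j%:R * t by rewrite natrD mulrDl.
  have hB : (k - j)%:R * t = k%:R * t - j%:R * t by rewrite natrB// mulrBl.
  rewrite tau_cos hD hB cosD cosB; ring.
rewrite RintegralD//; try exact: (cc _ 0%N).
rewrite !Rintegral_cosn_pi subn_eq0 addn_eq0.
have -> : (k == j) = (k <= j)%N by rewrite eqn_leq kj andbT.
case: (posnP j) => [j0|j0]; first by rewrite j0 leqn0 andbT; case: eqP => _; ring.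
by case: (k == 0%N); rewrite /= add0r.
Qed.

Lemma cheb_expansion n p : (size p <= n)%N ->
  p = \sum_(j < n) (chebI p j / (if (j : nat) == 0%N then 2 * pi else pi)) *: tau j.
Proof.
move=> sp; have [c hc] := degree_basis size_tau sp; rewrite {1}hc.
apply: eq_bigr => j _; congr (_ *: _); rewrite hc chebI_sum (bigD1 j) //= big1; last first.
  by move=> k kj; rewrite chebI_tau (negbTE (kj : (k != j :> nat))) mulr0.
rewrite addr0 chebI_tau eqxx mulfK//; have := @pi_gt0 R => p0.
by case: ifP => _; rewrite ?mulf_neq0 ?pnatr_eq0// gt_eqF.
Qed.

Lemma chebI_large p j : (size p <= j)%N -> chebI p j = 0.
Proof.
move=> sp; have [c ->] := degree_basis size_tau sp; rewrite chebI_sum big1// => k _.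
by rewrite chebI_tau ltn_eqF ?mulr0.
Qed.

(** Since 1 - cos^2 t = (1 - cos 2t) / 2, multiplication by 1 - X^2 is a second difference with step
    2 on the coefficients. Solving it for the lowest index lets it run down from above the degree,
    where everything vanishes. *)
Lemma chebI_recurrence p j :
  chebI p j = 2 * chebI p j.+2 - chebI p j.+4 - 4 * chebI ((1 - 'X^2) * p) j.+2.
Proof.
have ic (n : nat) : mu.-integrable P1 (EFin \o (fun t : R => p.[cos t] * cos (n%:R * t))).
  by apply: continuous_integrable; exact: chebI_integrand_continuous.
have iB (a b : R) (f g : R -> R) : mu.-integrable P1 (EFin \o f) -> mu.-integrable P1 (EFin \o g) ->
    \int[mu]_(t in P1) (a * f t + b * g t) = a * \int[mu]_(t in P1) f t + b * \int[mu]_(t in P1) g t.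
  by move=> fi gi; rewrite RintegralD ?RintegralZl//; exact: (integrableRZ (mu := mu)).
have -> : chebI ((1 - 'X^2) * p) j.+2 =
    \int[mu]_(t in P1) (1 * (2^-1 * (p.[cos t] * cos (j.+2%:R * t)) + (- 4^-1) * (p.[cos t] * cos (j.+4%:R * t))) +
       (- 4^-1) * (p.[cos t] * cos (j%:R * t))).
  apply: eq_Rintegral => t _; rewrite hornerM hornerD hornerN hornerC hornerXn.
  have -> : j.+4%:R * t = j.+2%:R * t + 2 * t by rewrite -[j.+4]/(2 + j.+2)%N natrD; ring.
  have -> : j%:R * t = j.+2%:R * t - 2 * t by rewrite -[j.+2]/(2 + j)%N natrD; ring.
  have c2 : cos (2 * t) = 2 * cos t ^+ 2 - 1 by rewrite (_ : 2 * t = t + t) ?cosD -?expr2 ?sin2cos2; ring.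
  by rewrite cosD cosB c2; field.
rewrite !iB//; last first.
  by apply: (integrableRD (mu := mu)) => //; exact: (integrableRZ (mu := mu)).
by rewrite /chebI; field.
Qed.

(** Steps of two from [j] to beyond [n] accumulate the geometric series D (r^j + r^(j+2) + ...); [m]
    in the proof counts these steps. *)
Lemma downward_bound (x : nat -> R) (n : nat) (D r : R) : 0 <= r -> r < 1 -> 0 <= D ->
  (forall j, (n < j)%N -> x j = 0) -> (forall j, `|x j| <= `|x j.+2| + D * r ^+ j) ->
  forall j, `|x j| <= D / (1 - r ^+ 2) * r ^+ j.
Proof.
move=> r0 r1 D0 x0 hx; have r2 : 0 < 1 - r ^+ 2 by rewrite subr_gt0 exprn_ilt1.
suff H m j : (n < j + 2 * m)%N -> `|x j| <= D / (1 - r ^+ 2) * r ^+ j.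
  by move=> j; apply: (H n.+1); lia.
elim: m j => [|m IH] j jm.
  rewrite x0 ?normr0; last by lia.
  by rewrite mulr_ge0 ?divr_ge0 ?exprn_ge0 ?(ltW r2).
apply: le_trans (hx j) _; apply: (@le_trans _ _ (D / (1 - r ^+ 2) * r ^+ j.+2 + D * r ^+ j)).
  by rewrite lerD2r; apply: IH; lia.
rewrite -[j.+2]addn2 exprD le_eqVlt; apply/orP; left; apply/eqP; field; exact: lt0r_neq0.
Qed.

(** The second difference is undone by two downward summations, first for c j - c (j+2), then for c
    j. Each costs a factor 1 / (1 - r^2), and none of the constants depends on the degree. *)
Lemma chebI_descent p (H r : R) : 0 <= r -> r < 1 -> 0 <= H ->
  (forall j, `|chebI ((1 - 'X^2) * p) j| <= H * r ^+ j) ->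
  forall j, `|chebI p j| <= 4 / (1 - r ^+ 2) ^+ 2 * H * r ^+ j.
Proof.
move=> r0 r1 H0 hH; set c := chebI p.
have r2 : 0 < 1 - r ^+ 2 by rewrite subr_gt0 exprn_ilt1.
have c0 j : (size p < j)%N -> c j = 0 by move=> h; apply: chebI_large; exact: ltnW.
have he j : `|c j - c j.+2| <= 4 * H / (1 - r ^+ 2) * r ^+ j.
  apply: (@downward_bound (fun j => c j - c j.+2) (size p)) => //; first by rewrite mulr_ge0.
    by move=> k hk; rewrite !c0 ?subrr//; lia.
  move=> k; rewrite {1}/c chebI_recurrence -/c.
  have -> : 2 * c k.+2 - c k.+4 - 4 * chebI ((1 - 'X^2) * p) k.+2 - c k.+2 =
    (c k.+2 - c k.+4) - 4 * chebI ((1 - 'X^2) * p) k.+2 by ring.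
  apply: le_trans (ler_normB _ _) _; rewrite lerD2l normrM ger0_norm// -mulrA ler_wpM2l//.
  apply: le_trans (hH _) _; rewrite ler_wpM2l// -[k.+2]addn2 exprD ler_piMr ?exprn_ge0//.
  by rewrite exprn_ile1// ltW.
move=> j; have := @downward_bound c (size p) (4 * H / (1 - r ^+ 2)) r r0 r1.
rewrite divr_ge0 ?mulr_ge0 ?(ltW r2)// => /(_ isT c0) h.
apply: le_trans (h _ j) _.
  move=> k; rewrite -lerBlDl; apply: le_trans (he k).
  by rewrite lerBlDr -{1}(subrK (c k.+2) (c k)) ler_normD.
by rewrite le_eqVlt; apply/orP; left; apply/eqP; field; exact: lt0r_neq0.
Qed.

Lemma chebI_descent_iter p N (H r : R) : 0 <= r -> r < 1 -> 0 <= H ->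
  (forall j, `|chebI ((1 - 'X^2) ^+ N * p) j| <= H * r ^+ j) ->
  forall j, `|chebI p j| <= (4 / (1 - r ^+ 2) ^+ 2) ^+ N * H * r ^+ j.
Proof.
move=> r0 r1; elim: N H => [|N IH] H H0 h.
  by move=> j; have := h j; rewrite !expr0 !mul1r.
have r2 : 0 < 1 - r ^+ 2 by rewrite subr_gt0 exprn_ilt1.
have k0 : 0 <= 4 / (1 - r ^+ 2) ^+ 2 by rewrite divr_ge0// sqr_ge0.
rewrite exprSr -mulrA; apply: IH; first by rewrite mulr_ge0.
by apply: chebI_descent => // j; rewrite mulrA -exprS.
Qed.

Lemma antiderivative (q : {poly R}) : exists Q : {poly R}, Q^`() = q.
Proof.
exists (\poly_(i < (size q).+1) (q`_i.-1 / i%:R)); apply/polyP => i.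
rewrite coef_deriv coef_poly ltnS; case: ltnP => h; last by rewrite nth_default// mul0rn.
by rewrite /= -(mulr_natr (q`_i / _)) divfK// pnatr_eq0.
Qed.

(* Both sides are the increment of a polynomial antiderivative over [-1, 1]. *)
Lemma Rintegral_poly_cos (q : {poly R}) :
  \int[mu]_(t in P1) (q.[cos t] * sin t) = \int[mu]_(x in `[(-1), 1]) q.[x].
Proof.
have [Q Qq] := antiderivative q.
have dQ (x : R) : is_derive x (1 : R) (horner Q) q.[x] by rewrite -Qq; exact: is_derive_poly.
have l11 : (-1 : R) < 1 by lra.
rewrite (Rintegral_FTC l11 dQ); last exact: continuous_horner.
have dF (t : R) : is_derive t (1 : R) (fun t => - Q.[cos t]) (q.[cos t] * sin t).
  have h1 := is_derive_cos t; have h2 := is_derive_poly Q (cos t).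
  have h3 := is_deriveN (is_derive1_comp h2 h1).
  have -> : q.[cos t] * sin t = - (Q^`().[cos t] * - sin t) by rewrite Qq mulrN opprK.
  have -> : (fun t => - Q.[cos t]) = - (horner Q \o cos) by apply/funext.
  exact: h3.
rewrite (Rintegral_FTC (@pi_gt0 R) dF); last first.
  by apply: continuousM_R; [exact: continuous_poly_cos|exact: continuous_sin].
by rewrite cospi cos0 opprK addrC.
Qed.

End Chebyshev.

(** * Triangular matrices with geometric decay acting on l^2 *)

Section UpperTriangular.
Context {R : realType}.

Lemma geometric_tail (q : R) N M : 0 <= q -> q < 1 ->
  \sum_(N <= n < M) q ^+ n <= q ^+ N / (1 - q).
Proof.
move=> q0 q1; have q1' : 0 < 1 - q by rewrite subr_gt0.
rewrite ler_pdivlMr//; have [NM|MN] := leqP N M; last first.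
  by rewrite big_geq ?mul0r ?exprn_ge0// ltnW.
suff -> : (\sum_(N <= n < M) q ^+ n) * (1 - q) = q ^+ N - q ^+ M by rewrite gerBl exprn_ge0.
elim: M NM => [|M IH]; first by rewrite leqn0 => /eqP ->; rewrite big_geq// mul0r subrr.
rewrite leq_eqVlt => /predU1P[->|NM]; first by rewrite big_geq// mul0r subrr.
by rewrite big_nat_recr//= mulrDl IH// exprS; ring.
Qed.

(** The inner sums satisfy X n = y n + r X (n+1). Convexity gives (y + rX)^2 <= y^2 / (1 - r) + r
    X^2, the difference being a multiple of a square; summing over n, the last term is absorbed on
    the left. *)
Lemma upper_young (r : R) (y : nat -> R) N : 0 <= r -> r < 1 ->
  \sum_(n < N) (\sum_(n <= k < N) y k * r ^+ (k - n)) ^+ 2 <=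
  (1 - r) ^- 2 * \sum_(k < N) y k ^+ 2.
Proof.
move=> r0 r1; have r1' : 0 < 1 - r by rewrite subr_gt0.
pose X n := \sum_(n <= k < N) y k * r ^+ (k - n); rewrite -/X.
have XN : X N = 0 by rewrite /X big_geq.
have XS n : (n < N)%N -> X n = y n + r * X n.+1.
  move=> nN; rewrite /X big_ltn// subnn expr0 mulr1 mulr_sumr; congr (_ + _).
  rewrite !big_nat; apply: eq_bigr => k /andP[nk _].
  by rewrite mulrCA -exprS; congr (_ * _ ^+ _); lia.
have X2 (n : 'I_N) : X n ^+ 2 <= (1 - r)^-1 * y n ^+ 2 + r * X n.+1 ^+ 2.
  rewrite XS// -subr_ge0.
  have -> : (1 - r)^-1 * y n ^+ 2 + r * X n.+1 ^+ 2 - (y n + r * X n.+1) ^+ 2 =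
    r / (1 - r) * (y n - (1 - r) * X n.+1) ^+ 2 by field; exact: lt0r_neq0.
  by rewrite mulr_ge0 ?sqr_ge0// divr_ge0// ltW.
have XS2 : \sum_(n < N) X n.+1 ^+ 2 <= \sum_(n < N) X n ^+ 2.
  have := @big_ord_recl R 0 +%R N (fun k : 'I_N.+1 => X k ^+ 2).
  rewrite big_ord_recr /= XN expr0n addr0 => ->.
  by rewrite lerDr sqr_ge0.
rewrite -/X expr2 invfM -mulrA ler_pdivlMl// mulrBl mul1r lerBlDr.
apply: le_trans (ler_sum _ (fun n _ => X2 n)) _.
by rewrite big_split /= -!mulr_sumr lerD2l ler_wpM2l.
Qed.

(** Truncated at [N], all sums are dominated by those of [upper_young], uniformly in [N]. The limit
    is then taken for a fixed number [M] of components, which preserves the bound. *)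
Lemma upper_triangular_l2 (r K B : R) (a : nat -> R[i]) (e : nat -> nat -> R) :
  0 <= r -> r < 1 -> 0 <= K -> (forall N, \sum_(k < N) cmod (a k) ^+ 2 <= B) ->
  (forall k n, (k < n)%N -> e k n = 0) ->
  (forall k n, (n <= k)%N -> `|e k n| <= K * r ^+ (k - n)) ->
  exists b : nat -> R[i],
    (forall n, (fun N => \sum_(k < N) a k * (e k n)%:C : R[i]) @ \oo --> b n) /\
    (forall N, \sum_(n < N) cmod (b n) ^+ 2 <= K ^+ 2 * ((1 - r) ^- 2 * B)).
Proof.
move=> r0 r1 K0 aB e0 eK; have r1' : 0 < 1 - r by rewrite subr_gt0.
pose X N n := \sum_(n <= k < N) cmod (a k) * r ^+ (k - n).
have X0 N n : 0 <= X N n by apply: sumr_ge0 => k _; rewrite mulr_ge0 ?cmod_ge0 ?exprn_ge0.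
have XB N : \sum_(n < N) X N n ^+ 2 <= (1 - r) ^- 2 * B.
  apply: le_trans (upper_young _ _ r0 r1) _.
  by rewrite ler_wpM2l ?exprn_ge0 ?invr_ge0 ?exprn_ge0 ?(ltW r1').
have aX N n : \sum_(k < N) cmod (a k * (e k n)%:C) <= K * X N n.
  rewrite -(big_mkord xpredT (fun k => cmod (a k * (e k n)%:C))) /=.
  have z i j : (j <= n)%N -> \sum_(i <= k < j) cmod (a k * (e k n)%:C) = 0.
    move=> jn; rewrite big_nat big1// => k /andP[_ kj].
    by rewrite e0 ?mulr0 ?cmod0//; exact: leq_trans kj jn.
  have [Nn|nN] := leqP N n; first by rewrite z// mulr_ge0.
  rewrite (@big_cat_nat _ _ _ n)//= ?(ltnW nN)// z// add0r mulr_sumr.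
  rewrite !big_nat; apply: ler_sum => k /andP[nk _].
  by rewrite cmodM cmodR mulrCA ler_wpM2l ?cmod_ge0 ?eK.
have XB1 N n : X N n <= 1 + (1 - r) ^- 2 * B.
  have [Nn|nN] := leqP N n.
    rewrite {1}/X big_geq// addr_ge0//; apply: le_trans (XB 0%N).
    by rewrite big_ord0.
  apply: (@le_trans _ _ (1 + X N n ^+ 2)); first by have := X0 N n; nra.
  rewrite lerD2l; apply: le_trans (XB N); rewrite (bigD1 (Ordinal nN))//= lerDl.
  by apply: sumr_ge0 => k _; exact: sqr_ge0.
have /choice[b hb] : forall n, exists l : R[i],
    (fun N => \sum_(k < N) a k * (e k n)%:C : R[i]) @ \oo --> l.
  move=> n; apply: (@csum_cvg R (fun k => a k * (e k n)%:C) (K * (1 + (1 - r) ^- 2 * B))) => N.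
  by apply: le_trans (aX N n) _; rewrite ler_wpM2l.
exists b; split => // M.
pose s N n := cmod (\sum_(k < N) a k * (e k n)%:C) ^+ 2 : R.
have cv : (fun N => \sum_(n < M) s N n) @ \oo --> \sum_(n < M) cmod (b n) ^+ 2.
  elim: M => [|M IH].
    rewrite big_ord0 (_ : (fun N => _) = fun=> 0); first exact: cvg_cst.
    by apply/funext => N; rewrite big_ord0.
  rewrite big_ord_recr (_ : (fun N => _) = (fun N => \sum_(n < M) s N n + s N M)); last first.
    by apply/funext => N; rewrite big_ord_recr.
  by apply: cvgD => //; exact: cvgC_cmod_sqr.
rewrite -(cvg_lim (@Rhausdorff R) cv); apply: limr_le; first by apply/cvg_ex; eexists; exact: cv.
near=> N; have MN : (M <= N)%N by near: N; exists M.
apply: (@le_trans _ _ (\sum_(n < N) (K * X N n) ^+ 2)).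
  rewrite -(big_mkord xpredT (s N)) -(big_mkord xpredT (fun n => (K * X N n) ^+ 2)).
  rewrite [leRHS](@big_cat_nat _ _ _ M)//=.
  apply: (@le_trans _ _ (\sum_(0 <= n < M) (K * X N n) ^+ 2)); last first.
    by rewrite lerDl; apply: sumr_ge0 => k _; exact: sqr_ge0.
  apply: ler_sum => n _; rewrite /s lerXn2r ?nnegrE ?cmod_ge0 ?mulr_ge0//.
  by apply: le_trans (aX N n); exact: cmod_sum.
have -> : \sum_(n < N) (K * X N n) ^+ 2 = K ^+ 2 * \sum_(n < N) X N n ^+ 2.
  by rewrite mulr_sumr; apply: eq_bigr => n _; rewrite exprMn.
by rewrite ler_wpM2l ?sqr_ge0.
Unshelve. all: by end_near. Qed.

End UpperTriangular.

(** * Moments against the Jacobi weight *)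

Section JacobiWeight.
Context {R : realType}.
Local Notation mu := (@lebesgue_measure R).
Local Notation mR := (measurableTypeR R).
Local Notation I1 := `]-1, 1[%classic.
Implicit Types (q : {poly R}) (x : R).
Variables alpha beta : R.
Local Notation w := (jacobi_weight alpha beta).

Lemma itv11P x : I1 x -> -1 < x /\ x < 1.
Proof. by rewrite /= in_itv /= => /andP. Qed.

Lemma measurable_itv11 : measurable (I1 : set mR).
Proof. exact: measurable_itv. Qed.

Lemma jacobi_weight_gt0 x : I1 x -> 0 < w x.
Proof. by move=> /itv11P[h1 h2]; rewrite mulr_gt0// powR_gt0//; lra. Qed.

Lemma jacobi_weight_ge0 x : 0 <= w x.
Proof. by rewrite mulr_ge0// powR_ge0. Qed.

Lemma measurable_jacobi_weight (D : set mR) : measurable_fun D (w : mR -> mR).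
Proof.
have mp (c : R) (u : mR -> mR) : measurable_fun setT u -> measurable_fun setT (fun x : mR => u x `^ c : mR).
  by move=> um; exact: (measurableT_comp (measurable_powR c) um).
apply: (measurable_funS measurableT) => //.
apply: measurable_funM; apply: mp.
- by apply: measurable_funB.
- by apply: measurable_funD.
Qed.

Lemma measurable_horner q (D : set mR) : measurable_fun D (horner q : mR -> mR).
Proof.
apply: (measurable_funS measurableT) => //.
exact: continuous_measurable_fun (@continuous_horner _ q).
Qed.

Lemma horner_bounded q : exists2 B : R, 0 <= B & forall x, `|x| <= 1 -> `|q.[x]| <= B.
Proof.
exists (\sum_(i < size q) `|q`_i|); first by apply: sumr_ge0.
move=> x x1; rewrite horner_coef (le_trans (ler_norm_sum _ _ _))//.
apply: ler_sum => i _; rewrite normrM normrX ler_piMr// exprn_ile1//.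
Qed.

Lemma itv11_norm_le1 x : I1 x -> `|x| <= 1.
Proof. by move=> /itv11P[h1 h2]; rewrite ler_norml; apply/andP; split; lra. Qed.

Hypothesis iw : mu.-integrable I1 (EFin \o w).

Lemma integrable_horner_weight q : mu.-integrable I1 (EFin \o (fun x => q.[x] * w x)).
Proof.
have [B B0 qB] := horner_bounded q.
apply: (le_integrable measurable_itv11 _ _ (integrableRZ (mu := mu) measurable_itv11 B iw)).
  apply/measurable_EFinP; apply: measurable_funM; first exact: measurable_horner.
  exact: measurable_jacobi_weight.
move=> x Ix; rewrite /= lee_fin !normrM ler_wpM2r// (le_trans (qB _ (itv11_norm_le1 Ix)))//.
exact: ler_norm.
Qed.

Definition jacobi_moment q : R := \int[mu]_(x in I1) (q.[x] * w x).
Local Notation jI := jacobi_moment.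

Lemma jacobi_momentD p q : jI (p + q) = jI p + jI q.
Proof.
rewrite /jI -RintegralD//; try exact: integrable_horner_weight.
by apply: eq_Rintegral => x _; rewrite hornerD mulrDl.
Qed.

Lemma jacobi_momentZ c q : jI (c *: q) = c * jI q.
Proof.
rewrite /jI -RintegralZl//; last exact: integrable_horner_weight.
by apply: eq_Rintegral => x _; rewrite hornerZ -mulrA.
Qed.

Lemma jacobi_moment_sum n (c : nat -> R) (b : nat -> {poly R}) :
  jI (\sum_(k < n) c k *: b k) = \sum_(k < n) c k * jI (b k).
Proof.
elim: n => [|n IH]; last by rewrite !big_ord_recr /= jacobi_momentD jacobi_momentZ IH.
by rewrite !big_ord0 -(scale0r (0 : {poly R})) jacobi_momentZ mul0r.
Qed.

Lemma le_jacobi_moment p q : (forall x, `|x| <= 1 -> p.[x] <= q.[x]) -> jI p <= jI q.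
Proof.
move=> pq; apply: le_Rintegral => //; try exact: integrable_horner_weight.
by move=> x Ix; rewrite ler_wpM2r ?jacobi_weight_ge0// pq// itv11_norm_le1.
Qed.

Lemma tau_le2 n x : `|x| <= 1 -> `|(tau n).[x]| <= 2.
Proof.
rewrite ler_norml => x1; rewrite -[x](@acosK R) ?in_itv//= tau_cos normrM ger0_norm// -[leRHS]mulr1.
by rewrite ler_wpM2l// ler_norml cos_geN1 cos_le1.
Qed.

(** Pointwise |tau k * q| <= 2 |q| <= 1 + q^2. For q = [p n] the right side does not depend on n, by
    normalisation. *)
Lemma tau_jacobi_moment_bound k q : `|jI (tau k * q)| <= jI (1 + q * q).
Proof.
have h (c : R) : `|c| = 1 -> jI (c *: (tau k * q)) <= jI (1 + q * q).
  move=> c1; apply: le_jacobi_moment => x x1.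
  rewrite hornerD hornerC hornerZ !hornerM; apply: le_trans (ler_norm _) _.
  rewrite !normrM c1 mul1r -expr2 -real_normK ?num_real//.
  apply: le_trans (ler_wpM2r (normr_ge0 _) (tau_le2 k x1)) _.
  by have := sqr_ge0 (`|q.[x]| - 1); nra.
rewrite ler_norml; have := h 1; have := h (-1); rewrite normrN1 normr1 !jacobi_momentZ mulN1r mul1r.
by move=> /(_ erefl) h1 /(_ erefl) ->; rewrite andbT lerNl.
Qed.

(** For 0 < y <= 2 write y^m = y^(m - c) y^c and bound the first factor by 2^(m - c); this is used
    for y = 1 - x and y = 1 + x. *)
Lemma jacobi_weight_lower m x : alpha <= m%:R -> beta <= m%:R -> I1 x ->
  (1 - x ^+ 2) ^+ m <= 2 `^ (m%:R - alpha) * 2 `^ (m%:R - beta) * w x.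
Proof.
move=> am bm /itv11P[x1 x2].
have h (c y : R) : c <= m%:R -> 0 < y -> y <= 2 -> y ^+ m <= 2 `^ (m%:R - c) * y `^ c.
  move=> cm y0 y2; rewrite -powR_mulrn ?(ltW y0)// -{1}(subrK c m%:R) powRD; last first.
    by apply/implyP => _; rewrite gt_eqF.
  rewrite ler_wpM2r ?powR_ge0//; apply: ge0_ler_powR; rewrite ?nnegrE ?subr_ge0//; exact: ltW.
rewrite (_ : 1 - x ^+ 2 = (1 - x) * (1 + x)); last by ring.
rewrite exprMn /jacobi_weight mulrACA; apply: ler_pM; try (by rewrite exprn_ge0//; lra).
- by apply: h => //; lra.
- by apply: h => //; lra.
Qed.

(* On the unit circle [|p| <= 1 + p^2] and one factor [sin t] out of
   [(sin t)^(2m+2)] turn [chebI] into an integral over [-1, 1]. *)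
Lemma chebI_jacobi_moment m p j : alpha <= m%:R -> beta <= m%:R ->
  `|chebI ((1 - 'X^2) ^+ m.+1 * p) j| <=
  2 `^ (m%:R - alpha) * 2 `^ (m%:R - beta) * jI (1 + p * p).
Proof.
move=> am bm; set C := _ * _ `^ _.
pose Q : {poly R} := (1 + p * p) * (1 - 'X^2) ^+ m.
have Qx x : Q.[x] = (1 + p.[x] ^+ 2) * (1 - x ^+ 2) ^+ m.
  by rewrite hornerM hornerD hornerM horner_exp hornerD hornerN hornerXn !hornerC expr2.
have iQ : mu.-integrable `[(-1), 1] (EFin \o horner Q).
  by apply: continuous_integrable; exact: continuous_horner.
apply: (@le_trans _ _ (\int[mu]_(t in `[0, pi]) (Q.[cos t] * sin t))).
  have i1 : continuous (fun t : R => ((1 - 'X^2) ^+ m.+1 * p).[cos t] * cos (j%:R * t)).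
    exact: chebI_integrand_continuous.
  have i2 : continuous (fun t => Q.[cos t] * sin t).
    by apply: continuousM_R; [exact: continuous_poly_cos|exact: continuous_sin].
  apply: le_trans (le_normr_Rintegral _ _) _ => //; first exact: continuous_integrable.
  apply: le_Rintegral => //.
  - by have := integrable_norm (continuous_integrable 0 pi i1).
  - exact: continuous_integrable.
  move=> t0; rewrite /= in_itv /=; move: (t0 : R) => {t0} t /andP[t0 tp].
  have s0 : 0 <= sin t by apply: sin_ge0_pi; rewrite t0 tp.
  rewrite Qx hornerM horner_exp hornerD hornerN hornerXn hornerC -sin2cos2.
  set y := p.[cos t]; set A := (sin t ^+ 2) ^+ m.
  have A0 : 0 <= A by rewrite exprn_ge0 ?sqr_ge0.
  rewrite exprS -/A !normrM (ger0_norm A0) ger0_norm ?sqr_ge0//.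
  apply: (@le_trans _ _ (sin t * A * (1 + y ^+ 2) * 1)); last by rewrite mulr1 [leRHS]mulrC mulrA (mulrAC (sin t)).
  apply: ler_pM; rewrite ?mulr_ge0 ?sqr_ge0 ?ler_norml ?cos_geN1 ?cos_le1//.
  apply: ler_pM; rewrite ?mulr_ge0 ?sqr_ge0//.
    by rewrite -mulrA ler_piMl ?sin_le1// mulr_ge0.
  by rewrite -(@real_normK _ y) ?num_real//; have := sqr_ge0 (`|y| - 1); have := sqr_ge0 `|y|; nra.
rewrite Rintegral_poly_cos -Rintegral_itv_obnd_cbnd ; last first.
  by apply: integrableS iQ => //; apply: subset_itvr; rewrite bnd_simp.
rewrite -Rintegral_itv_bndo_bndc; last first.
  apply: integrableS iQ => //; by apply: subset_itv; rewrite bnd_simp.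
rewrite /jI -RintegralZl//; last exact: integrable_horner_weight.
apply: le_Rintegral => //.
- apply: integrableS iQ => //; by apply: subset_itv; rewrite bnd_simp.
- exact: (integrableRZ (mu := mu)) (integrable_horner_weight _).
move=> x Ix; rewrite Qx hornerD hornerM hornerC -expr2 mulrCA.
by rewrite ler_wpM2l ?addr_ge0 ?sqr_ge0// jacobi_weight_lower.
Qed.

End JacobiWeight.

(** The real-valued integral takes the default value 0 when the extended one is infinite, so a
    nonzero value certifies finiteness. *)
Lemma integrable_of_Rintegral_neq0 {R : realType} d (T : measurableType d)
    (mu : {measure set T -> \bar R}) (D : set T) (u : T -> R) :
  measurable_fun D u -> (forall x, D x -> 0 <= u x) ->
  \int[mu]_(x in D) u x != 0 -> mu.-integrable D (EFin \o u).
Proof.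
move=> mu_ u0 iu; apply/integrableP; split; first exact/measurable_EFinP.
rewrite (eq_integral (EFin \o u)); last first.
  by move=> x /set_mem Dx; rewrite /= ger0_norm// u0.
move: iu; rewrite /Rintegral /=; have : (0 <= \int[mu]_(x in D) (u x)%:E)%E.
  by apply: integral_ge0 => x Dx; rewrite lee_fin u0.
by case: integral => [r _ _||]; [exact: ltry|rewrite /= eqxx|].
Qed.

Lemma cmeasurable_cvg {R : realType} d (T : measurableType d) (D : set T)
    (f_ : nat -> T -> R[i]) (f : T -> R[i]) :
  (forall n, cmeasurable D (f_ n)) -> (forall x, D x -> (fun n => f_ n x) @ \oo --> f x) ->
  cmeasurable D f.
Proof.
move=> mf ff; split.
- apply: (measurable_fun_cvg (h := fun n x => complex.Re (f_ n x))); first by move=> n; case: (mf n).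
  by move=> x Dx; have := cvgC_Re (FF := eventually_filter) (ff _ Dx).
- apply: (measurable_fun_cvg (h := fun n x => complex.Im (f_ n x))); first by move=> n; case: (mf n).
  by move=> x Dx; have := cvgC_Im (FF := eventually_filter) (ff _ Dx).
Qed.

(** * Change of basis between Chebyshev and Jacobi polynomials *)

Section JacobiPolynomials.
Context {R : realType}.
Local Notation mu := (@lebesgue_measure R).
Local Notation mR := (measurableTypeR R).
Local Notation I1 := `]-1, 1[%classic.
Variables (alpha beta : R) (p : nat -> {poly R}).
Hypothesis onp : orthonormal_jacobi alpha beta p.
Local Notation w := (jacobi_weight alpha beta).
Local Notation jI := (jacobi_moment alpha beta).

(** Read off from the normalisation of [p 0], a nonzero constant whose square has integral 1 against
    the weight. *)
Lemma jacobi_weight_integrable : mu.-integrable I1 (EFin \o w).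
Proof.
have [sp _ op] := onp; have /size_poly1P[c c0 pc] : size (p 0) == 1%N by rewrite sp.
have i0 : mu.-integrable I1 (EFin \o (fun x => (p 0).[x] * (p 0).[x] * w x)).
  apply: integrable_of_Rintegral_neq0.
  - apply: measurable_funM; last exact: measurable_jacobi_weight.
    by apply: measurable_funM; exact: measurable_horner.
  - by move=> x _; rewrite mulr_ge0 ?jacobi_weight_ge0// -expr2 sqr_ge0.
  - by rewrite op oner_neq0.
have := integrableRZ (mu := mu) (measurable_itv11 (R := R)) (c * c)^-1 i0.
by apply: eq_integrable => //= x _; rewrite pc hornerC mulKf// mulf_neq0.
Qed.
Let iw := jacobi_weight_integrable.

Lemma jacobi_moment_ortho k m : jI (p k * p m) = (k == m)%:R.
Proof.
by have [_ _ <-] := onp; apply: eq_Rintegral => x _; rewrite hornerM.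
Qed.

(** By orthonormality, the coefficient of [p n] in the Jacobi expansion of [tau k]. *)
Definition tau_moment k n : R := jI (tau k * p n).

Lemma tau_moment_bound k n : `|tau_moment k n| <= jI 1 + 1.
Proof.
apply: le_trans (tau_jacobi_moment_bound iw _ _) _.
by rewrite jacobi_momentD// jacobi_moment_ortho eqxx.
Qed.

Lemma tau_moment_lower k n : (k < n)%N -> tau_moment k n = 0.
Proof.
move=> kn; have [sp _ _] := onp; have [c hc] := degree_basis sp (n := k.+1) (eq_leq (size_tau _)).
rewrite /tau_moment hc mulr_suml.
rewrite (eq_bigr (fun j : 'I_k.+1 => c j *: (p j * p n))); last by move=> j _; rewrite scalerAl.
rewrite (jacobi_moment_sum iw k.+1 c (fun j => p j * p n)) big1// => j _.
by rewrite jacobi_moment_ortho ltn_eqF ?mulr0//; exact: leq_trans (ltn_ord j) kn.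
Qed.

Definition tau_coef n j : R := chebI (p n) j / (if j == 0%N then 2 * pi else pi).

Lemma tau_coef_expansion n N : (n < N)%N -> p n = \sum_(j < N) tau_coef n j *: tau j.
Proof. by move=> nN; have [sp _ _] := onp; apply: cheb_expansion; rewrite sp. Qed.

Lemma tau_coef_lower n j : (n < j)%N -> tau_coef n j = 0.
Proof. by move=> nj; have [sp _ _] := onp; rewrite /tau_coef chebI_large ?mul0r// sp. Qed.

(** The two change of basis matrices are inverse to each other; by triangularity the product is a
    finite sum as soon as [N] exceeds n. *)
Lemma tau_coef_moment n m N : (n < N)%N ->
  \sum_(j < N) tau_coef n j * tau_moment j m = (n == m)%:R.
Proof.
move=> nN; rewrite -jacobi_moment_ortho (tau_coef_expansion nN) mulr_suml.
rewrite (eq_bigr (fun j : 'I_N => tau_coef n j *: (tau j * p m))); last by move=> j _; rewrite scalerAl.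
by rewrite (jacobi_moment_sum iw N (tau_coef n) (fun j => tau j * p m)).
Qed.

Lemma size_1subX2_exp N (q : {poly R}) : (size ((1 - 'X^2) ^+ N * q)%R <= size q + 2 * N)%N.
Proof.
have s3 : (size (1 - 'X^2 : {poly R})%R <= 3)%N.
  by apply: leq_trans (size_polyD _ _) _; rewrite size_polyN size_polyXn size_poly1.
elim: N => [|N IH]; first by rewrite expr0 mul1r muln0 addn0.
rewrite exprS -mulrA; apply: leq_trans (size_polyMleq _ _) _.
by rewrite -subn1 leq_subLR; apply: leq_trans (leq_add s3 IH) _; lia.
Qed.

(** The coefficients of (1 - X^2)^N [p n] are bounded independently of n and vanish above the degree
    n + 2N, so they are at most C s^(n + 2N) r^i with r = 1/s. N descents then give the bound for
    [p n] itself. *)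
Lemma tau_coef_bound (s : R) : 1 < s -> exists2 K : R, 0 <= K &
  forall n j, (j <= n)%N -> `|tau_coef n j| <= K * s ^+ (n - j).
Proof.
move=> s1; have s0 : 0 < s by exact: lt_trans s1.
have [m [am bm]] : exists m : nat, alpha <= m%:R /\ beta <= m%:R.
  exists (Num.trunc `|alpha| + Num.trunc `|beta|).+1.
  have h (c : R) : c <= (Num.trunc `|c|).+1%:R.
    by rewrite (le_trans (ler_norm _))// ltW// truncnS_gt.
  by split; apply: le_trans (h _) _; rewrite ler_nat; lia.
set C := 2 `^ (m%:R - alpha) * 2 `^ (m%:R - beta) * (jI 1 + 1).
have C0 : 0 <= C.
  rewrite !mulr_ge0 ?powR_ge0//; apply: le_trans (tau_moment_bound 0 0); exact: normr_ge0.
pose N := m.+1; pose r := s^-1.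
have r0 : 0 < r by rewrite invr_gt0.
have r1 : r < 1 by rewrite invf_lt1.
have r2 : 0 < 1 - r ^+ 2 by rewrite subr_gt0 exprn_ilt1// ltW.
(* The first factor is the cost of N descents; s^(2N) pays for the degree added by (1 - X^2)^N. *)
pose K := (4 / (1 - r ^+ 2) ^+ 2) ^+ N * (C * s ^+ (2 * N)).
have K0 : 0 <= K.
  by rewrite mulr_ge0 ?exprn_ge0 ?divr_ge0 ?sqr_ge0// mulr_ge0 ?exprn_ge0// ltW.
exists K => // n j jn.
have H j' : `|chebI (p n) j'| <= K * s ^+ n * r ^+ j'.
  rewrite (_ : K * s ^+ n = (4 / (1 - r ^+ 2) ^+ 2) ^+ N * (C * s ^+ (2 * N) * s ^+ n)); last first.
    by rewrite /K; ring.
  have C1 : 0 <= C * s ^+ (2 * N) * s ^+ n.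
    by rewrite mulr_ge0 ?exprn_ge0 ?(ltW s0)// mulr_ge0 ?exprn_ge0 ?(ltW s0).
  apply: chebI_descent_iter => //; first exact: ltW.
  move=> i; have [ij|ji] := leqP i (n + 2 * N).
    apply: le_trans (chebI_jacobi_moment iw (p n) i am bm) _.
    rewrite jacobi_momentD// jacobi_moment_ortho eqxx -/C.
    rewrite (_ : C * s ^+ (2 * N) * s ^+ n * r ^+ i = C * (s ^+ (n + 2 * N) * r ^+ i)); last first.
      by rewrite exprD; ring.
    rewrite ler_peMr// /r exprVn -exprB ?unitfE ?gt_eqF//.
    by rewrite exprn_ege1// ltW.
  rewrite chebI_large; first by rewrite normr0 mulr_ge0 ?exprn_ge0 ?(ltW r0).
  have [sp _ _] := onp; apply: leq_trans (size_1subX2_exp _ _) _; rewrite sp.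
  by move: ji; clear; lia.
rewrite /tau_coef normrM.
have -> : s ^+ (n - j) = s ^+ n * r ^+ j by rewrite exprB ?unitfE ?gt_eqF// exprVn.
rewrite mulrA -[leRHS]mulr1; apply: ler_pM => //.
have pi1 : 1 <= pi :> R by apply: le_trans (pi_ge2 R); rewrite ler1n.
by rewrite ger0_norm ?invr_ge0; case: ifP => _; rewrite ?invf_le1//; lra.
Qed.

(** Termwise integration: as |tau k| <= 2 on the interval, the partial sums are at most 2B / (1 -
    q), and |p n| times the weight is integrable. *)
Lemma jacobi_series_coef (a : nat -> R[i]) (B q : R) (F : R -> R[i]) n :
  0 <= q -> q < 1 -> (forall k, cmod (a k) <= B) ->
  (forall x : R, I1 x ->
    (fun N => \sum_(k < N) a k * (q ^+ k * (tau k).[x])%:C : R[i]) @ \oo --> F x) ->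
  cintegrable mu I1 (jacobi_integrand alpha beta p F n) /\
  (fun N => \sum_(k < N) a k * (q ^+ k * tau_moment k n)%:C : R[i]) @ \oo -->
    cintegral mu I1 (jacobi_integrand alpha beta p F n).
Proof.
move=> q0 q1 aB FE; have q1' : 0 < 1 - q by rewrite subr_gt0.
have B0 : 0 <= B by apply: le_trans (aB 0%N); exact: cmod_ge0.
pose g N (x : R) := \sum_(k < N) a k * (q ^+ k * (tau k).[x])%:C : R[i].
have mh k : cmeasurable (I1 : set mR) (fun x => (q ^+ k * (tau k).[x])%:C : R[i]).
  apply: cmeasurable_real; apply: measurable_funM; first exact: measurable_cst.
  exact: measurable_horner.
have mg N : cmeasurable (I1 : set mR) (g N).
  apply: cmeasurable_sum => k; apply: cmeasurableM; first exact: cmeasurable_cst.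
  exact: mh.
have mpw : measurable_fun (I1 : set mR) (fun x : mR => (p n).[x] * w x).
  by apply: measurable_funM; [exact: measurable_horner|exact: measurable_jacobi_weight].
have ipw := integrable_horner_weight iw (p n).
pose G (x : R) := 2 * B / (1 - q) * `|(p n).[x] * w x|.
have iG : mu.-integrable I1 (EFin \o G).
  apply: (integrableRZ (mu := mu)); first exact: measurable_itv11.
  by have := integrable_norm ipw.
have [|||||h1 h2] := @cdominated_convergence R _ mR mu I1 measurable_itv11
    (fun N => jacobi_integrand alpha beta p (g N) n) (jacobi_integrand alpha beta p F n) (EFin \o G).
- by move=> N; apply: cmeasurableM; [exact: mg|exact: cmeasurable_real].
- apply: cmeasurableM; last exact: cmeasurable_real.
  by apply: (cmeasurable_cvg (f_ := g)) => // x Ix; exact: FE.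
- apply: aeW => x Ix; have := cvgC_mulr (FF := eventually_filter) (y := ((p n).[x] * w x)%:C) (FE x Ix).
  by apply.
- exact: iG.
- move=> N x Ix; rewrite lee_fin cmodM cmodR ler_wpM2r//.
  apply: le_trans (cmod_sum _ _ _) _.
  apply: (@le_trans _ _ (\sum_(k < N) 2 * B * q ^+ k)).
    apply: ler_sum => k _; rewrite cmodM cmodR normrM (ger0_norm (exprn_ge0 _ q0)).
    rewrite (_ : 2 * B * q ^+ k = B * (q ^+ k * 2)); last by ring.
    apply: ler_pM; rewrite ?cmod_ge0 ?mulr_ge0 ?exprn_ge0//.
    by rewrite ler_wpM2l ?exprn_ge0// tau_le2// itv11_norm_le1.
  rewrite -mulr_sumr ler_wpM2l ?mulr_ge0//.
  by have := geometric_tail 0 N q0 q1; rewrite big_mkord expr0 mul1r.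
split => //; rewrite (_ : (fun N => _) = (fun N => cintegral mu I1 (jacobi_integrand alpha beta p (g N) n)))//.
apply/funext => N; pose h k (x : R) := ((tau k * p n).[x] * w x)%:C : R[i].
have ih k : cintegrable mu I1 (h k).
  by apply: cintegrableR; exact: integrable_horner_weight.
rewrite (@eq_cintegral _ _ _ mu I1 _ (fun x => \sum_(k < N) (a k * (q ^+ k)%:C) * h k x)); last first.
  move=> x _; rewrite /jacobi_integrand /g mulr_suml; apply: eq_bigr => k _.
  rewrite /h hornerM -!mulrA; congr (_ * _); rewrite -!rmorphM /=; congr (_%:C); ring.
rewrite (cintegral_sum (mu := mu)) //; last first.
  by move=> k; apply: (cintegrableZ (mu := mu)) => //; exact: measurable_itv11.
rewrite [RHS](eq_bigr (fun k : 'I_N => a k * (q ^+ k * tau_moment k n)%:C))// => k _.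
have -> := @cintegralZ R _ mR mu I1 measurable_itv11 (a k * (q ^+ k)%:C) (h k) (ih k).
by rewrite /h cintegralR -mulrA -rmorphM.
Qed.

End JacobiPolynomials.

(** * Vanishing moments *)

Section ZeroMoments.
Context {R : realType}.
Implicit Types (x c u y : R).

Lemma bernoulli_ineq u M : -1 <= u -> 1 + M%:R * u <= (1 + u) ^+ M.
Proof.
move=> u1; elim: M => [|M IH]; first by rewrite mul0r addr0 expr0.
rewrite exprS; apply: le_trans (ler_wpM2l _ IH); last lra.
rewrite -natr1 -subr_ge0 (_ : _ - _ = M%:R * u ^+ 2); last by ring.
by rewrite mulr_ge0 ?sqr_ge0.
Qed.

(** Bernoulli's inequality gives the lower bound 1 - (2y)^n. *)
Lemma cvg_step_lt y : 0 <= y -> y < 2^-1 -> (fun n => (1 - y ^+ n) ^+ (2 ^ n)) @ \oo --> (1 : R).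
Proof.
move=> y0 y2; have y1 n : y ^+ n <= 1 by rewrite exprn_ile1//; lra.
apply: (@squeeze_cvgr _ _ _ _ (fun n => 1 - (2 * y) ^+ n) (fun=> 1)); last exact: cvg_cst.
  near=> n; apply/andP; split; last by rewrite exprn_ile1 ?subr_ge0 ?gerBl ?exprn_ge0.
  have := @bernoulli_ineq (- y ^+ n) (2 ^ n)%N; rewrite lerN2 y1 => /(_ isT).
  by rewrite mulrN natrX -exprMn.
have h : (fun n => (2 * y) ^+ n) @ \oo --> (0 : R).
  by apply: cvg_expr; rewrite ger0_norm; lra.
by have := cvgB (cvg_cst (1 : R)) h; rewrite subr0; apply.
Unshelve. all: by end_near. Qed.

(** Bernoulli's inequality gives (2y)^n <= (1 + y^n)^(2^n), and the product (1 - y^n)(1 + y^n) is at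
    most 1; hence the upper bound (2y)^-n. *)
Lemma cvg_step_gt y : 2^-1 < y -> y <= 1 -> (fun n => (1 - y ^+ n) ^+ (2 ^ n)) @ \oo --> (0 : R).
Proof.
move=> y2 y1'; have y0 : 0 < y by lra.
have y1 n : y ^+ n <= 1 by rewrite exprn_ile1// ltW.
apply: (@squeeze_cvgr _ _ _ _ (fun=> 0) (fun n => (2 * y)^-1 ^+ n)); last 2 first.
- exact: cvg_cst.
- apply: cvg_expr; rewrite ger0_norm; last by rewrite invr_ge0; lra.
  by rewrite invf_lt1; lra.
near=> n; rewrite exprn_ge0 ?subr_ge0//= exprVn -div1r ler_pdivlMr; last first.
  by rewrite exprn_gt0//; lra.
apply: (@le_trans _ _ ((1 - y ^+ n) ^+ (2 ^ n) * (1 + y ^+ n) ^+ (2 ^ n))).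
  rewrite ler_wpM2l ?exprn_ge0 ?subr_ge0//.
  apply: le_trans (bernoulli_ineq _ _); last by rewrite (le_trans _ (exprn_ge0 _ (ltW y0)))//; lra.
  by rewrite exprMn natrX lerDr.
rewrite -exprMn exprn_ile1//.
  by rewrite mulr_ge0 ?subr_ge0// addr_ge0// exprn_ge0// ltW.
rewrite (_ : (1 - y ^+ n) * (1 + y ^+ n) = 1 - (y ^+ n) ^+ 2); last by ring.
by rewrite gerBl sqr_ge0.
Unshelve. all: by end_near. Qed.

End ZeroMoments.

(** * Lebesgue measure on Borel sets and its completion *)

Section CompletedMeasure.
Context {R : realType}.
Local Notation mu := (@lebesgue_measure R).
Local Notation mR := (measurableTypeR R).
Local Notation cmu := (@completed_lebesgue_measure R).
Local Notation cR := (caratheodory_type (wlength (@idfun R))^*%mu).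
Local Notation I1 := (`]-1, 1[%classic).
Implicit Types (f g F : R -> R[i]).

Lemma completed_measurable (A : set mR) : measurable A -> measurable (A : set cR).
Proof. exact: sub_caratheodory. Qed.

Lemma completed_measurable_fun d (T : measurableType d) (D : set mR) (u : mR -> T) :
  measurable D -> measurable_fun D u -> measurable_fun (D : set cR) (u : cR -> T).
Proof. by move=> mD mu_ _ Y mY; apply: completed_measurable; exact: mu_. Qed.

(** A set of the completed sigma-algebra is a Borel set together with a negligible one; if its
    measure is zero, so is that of the Borel part. *)
Lemma completed_negligible (N : set R) :
  cmu.-negligible (N : set cR) <-> mu.-negligible (N : set mR).
Proof.
split=> [[A [mA A0 NA]]|[A [mA A0 NA]]]; last first.
  by exists A; split => //; exact: completed_measurable.
have := mA; rewrite -/(measurable _) -[measurable]completed_caratheodory_measurable.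
rewrite g_sigma_completed_algebra_genE => -[/= X mX [N' N'0] XA].
have X0 : mu X = 0%E.
  apply/eqP; rewrite eq_le measure_ge0 andbT -A0; apply: le_outer_measure.
  by rewrite -XA; exact: subsetUl.
apply: (@negligibleS _ mR _ mu A N NA); rewrite -XA.
by apply: (@negligibleU _ mR _ mu) => //; exists X; split.
Qed.

Lemma completed_ae (P : R -> Prop) : {ae cmu, forall x, P x} <-> {ae mu, forall x, P x}.
Proof. exact: completed_negligible. Qed.

(** The identity is measurable from the completed to the Borel sigma-algebra, and the Borel measure
    is the image of the completed one under it. *)
Lemma completed_ge0_integral (D : set mR) (g : mR -> \bar R) : measurable D ->
  measurable_fun D g -> (forall x, D x -> (0 <= g x)%E) ->
  (\int[cmu]_(x in D) g x = \int[mu]_(x in D) g x)%E.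
Proof.
move=> mD mg g0; have mid : measurable_fun [set: cR] (fun x : cR => x : mR).
  exact: (completed_measurable_fun (D := setT) measurableT (@measurable_id _ mR _)).
rewrite -[LHS]/(\int[cmu]_(x in (fun x : cR => x : mR) @^-1` D) (g \o (fun x : cR => x : mR)) x)%E.
rewrite -(ge0_integral_pushforward mid)//; last by move=> x /set_mem; exact: g0.
Qed.

Lemma completed_integral (D : set mR) (u : mR -> R) : measurable D ->
  mu.-integrable D (EFin \o u) ->
  cmu.-integrable D (EFin \o u) /\ \int[cmu]_(x in D) u x = \int[mu]_(x in D) u x.
Proof.
move=> mD /integrableP[mu_ uoo]; split.
  apply/integrableP; split; first exact: completed_measurable_fun.
  rewrite (@completed_ge0_integral D (fun x => `|(EFin \o u) x|)%E)//.
  exact: (measurableT_comp (@abse_measurable R setT) mu_).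
rewrite /Rintegral; congr fine; rewrite integralE [RHS]integralE; congr (_ - _)%E.
- by apply: completed_ge0_integral => //; exact: measurable_funepos.
- by apply: completed_ge0_integral => //; exact: measurable_funeneg.
Qed.

Lemma completed_cintegral (D : set mR) f : measurable D -> cintegrable mu D f ->
  cintegrable cmu D f /\ cintegral cmu D f = cintegral mu D f.
Proof.
move=> mD [f1 f2]; have [g1 h1] := completed_integral mD f1.
have [g2 h2] := completed_integral mD f2; split; first by split.
by rewrite /cintegral h1 h2.
Qed.

(** Completeness carries measurability across almost everywhere equality, so [v] may be an arbitrary
    modification of [u] on a null set. *)
Lemma ae_completed_integral (D : set cR) (u v : cR -> R) : measurable D ->
  {ae cmu, forall x, D x -> u x = v x} -> cmu.-integrable D (EFin \o u) ->
  cmu.-integrable D (EFin \o v) /\ \int[cmu]_(x in D) v x = \int[cmu]_(x in D) u x.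
Proof.
move=> mD uv /integrableP[mu_ uoo].
have uv' : ae_eq cmu D (EFin \o u) (EFin \o v).
  by apply: aeS uv => x h Dx /=; rewrite h.
have mv : measurable_fun D (EFin \o v).
  exact: (ae_measurable_fun (@completed_lebesgue_measure_is_complete R) uv').
split; last by rewrite /Rintegral; congr fine; apply/esym/ae_eq_integral.
apply/integrableP; split => //; move: uoo; rewrite -(@ae_eq_integral _ _ _ cmu D (abse \o (EFin \o v)) (abse \o (EFin \o u)))//.
- exact: (measurableT_comp (@abse_measurable R setT) mu_).
- exact: (measurableT_comp (@abse_measurable R setT) mv).
- by apply: aeS uv => x h Dx /=; rewrite h.
Qed.

Lemma ae_cintegral (D : set cR) f g : measurable D ->
  {ae cmu, forall x, D x -> f x = g x} -> cintegrable cmu D f ->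
  cintegrable cmu D g /\ cintegral cmu D g = cintegral cmu D f.
Proof.
move=> mD fg [f1 f2].
have [g1 e1] := @ae_completed_integral D _ (fun x => complex.Re (g x)) mD
  (aeS (fun x h Dx => congr1 (@complex.Re R) (h Dx)) fg) f1.
have [g2 e2] := @ae_completed_integral D _ (fun x => complex.Im (g x)) mD
  (aeS (fun x h Dx => congr1 (@complex.Im R) (h Dx)) fg) f2.
by split; [split|rewrite /cintegral e1 e2].
Qed.

Lemma completed_measurable_itv11 : measurable (I1 : set cR).
Proof. exact: (completed_measurable (@measurable_itv11 R)). Qed.

Lemma completed_integrable_horner (q : {poly R}) (h : cR -> R) : cmu.-integrable I1 (EFin \o h) ->
  cmu.-integrable I1 (EFin \o (fun x => q.[x] * h x)).
Proof.
move=> ih; have [B B0 qB] := horner_bounded q.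
have mI := completed_measurable_itv11.
apply: (le_integrable mI _ _ (integrableRZ (mu := cmu) mI B ih)).
  apply/measurable_EFinP; apply: measurable_funM.
    exact: (completed_measurable_fun (@measurable_itv11 R) (@measurable_horner R q _)).
  by have /integrableP[/measurable_EFinP] := ih.
move=> x Ix; rewrite /= lee_fin !normrM ler_wpM2r// (le_trans (qB _ (itv11_norm_le1 Ix)))//.
exact: ler_norm.
Qed.

(* [(1 - y^n)^(2^n)] tends to 1 for [0 <= y < 1/2] and to 0 for [1/2 < y <= 1], so
   the integrals of [h] over half-lines vanish too. *)
Lemma ae0_of_moments (h : R -> R) : cmu.-integrable I1 (EFin \o h) ->
  (forall q : {poly R}, \int[cmu]_(x in I1) (q.[x] * h x) = 0) ->
  {ae cmu, forall x, I1 x -> h x = 0}.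
Proof.
move=> ih mom; have mI := completed_measurable_itv11.
have mh : measurable_fun (I1 : set cR) h by have /integrableP[/measurable_EFinP] := ih.
have qh0 (q : {poly R}) : (\int[cmu]_(x in I1) (q.[x] * h x)%:E = 0)%E.
  rewrite -[LHS]fineK; first by rewrite -/(Rintegral _ _ _) mom.
  exact: (integrable_fin_num mI (completed_integrable_horner q ih)).
(* The sets over which [h] integrates to zero form a Dynkin class. It will contain the open left
   half-lines, which are stable under intersection and generate the Borel sets. *)
pose G := [set A : set R | measurable (A : set cR) /\ (\int[cmu]_(x in I1 `&` A) (h x)%:E = 0)%E].
have ihA (A : set cR) : measurable A -> cmu.-integrable (I1 `&` A) (EFin \o h).
  by move=> mA; apply: integrableS ih => //; exact: measurableI.
have GT : G setT.
  split; first exact: measurableT.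
  by rewrite setIT -[RHS](qh0 1); apply: eq_integral => x _; rewrite hornerC mul1r.
have dG : dynkin G.
  split => //.
  - move=> A [mA A0]; have mA' := measurableC mA; split => //.
    have := integral_setU cmu (measurableI _ _ mI mA) (measurableI _ _ mI mA') (f := EFin \o h).
    rewrite -setIUr setUv setIT A0 add0e => <-//.
    + by have [_ <-] := GT; rewrite setIT.
    + exact/measurable_EFinP.
    + by apply/disj_setPS => x [[_ Ax] [_ /(_ Ax)]].
  - move=> F tF GF; have mF k : measurable (F k : set cR) by case: (GF k).
    have mU : measurable (\bigcup_k F k : set cR) by exact: bigcupT_measurable.
    split => //; rewrite setI_bigcupr integral_bigcup.
    + by apply: eseries0 => i _ _; case: (GF i).
    + by apply: trivIset_setIl.
    + by move=> k; exact: measurableI.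
    + by rewrite -setI_bigcupr; exact: ihA.
have rG : @RGenInftyO.G R `<=` G.
  move=> _ [c ->]; have mc : measurable (`]-oo, c[%classic : set cR).
    by apply: completed_measurable; exact: measurable_itv.
  (* With this scale the affine map [y] sends (-1, 1) into [0, 1] and [c] to 1/2, so the polynomials
     [q n] tend to the indicator of x < c except at [c] itself. *)
  split => //; pose K := 2 * (2 + `|c|); have K0 : 0 < K by rewrite mulr_gt0// ltr_wpDr.
  pose q n : {poly R} := (1 - ((2^-1 - c / K)%:P + K^-1 *: 'X) ^+ n) ^+ (2 ^ n).
  pose y (x : R) := 2^-1 + (x - c) / K.
  have qE n x : (q n).[x] = (1 - y x ^+ n) ^+ (2 ^ n).
    rewrite /q horner_exp hornerD hornerN horner_exp hornerD hornerZ hornerX !hornerC.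
    by congr ((1 - _ ^+ _) ^+ _); rewrite /y; ring.
  have yI x : I1 x -> 0 <= y x <= 1.
    move=> /itv11P[x1 x2].
    have xc : `|(x - c) / K| <= 2^-1.
      rewrite normrM normfV (gtr0_norm K0) ler_pdivrMr// /K mulKf//.
      by rewrite (le_trans (ler_normB _ _))// lerD2r ler_norml; lra.
    by move: xc; rewrite ler_norml /y => /andP[h1 h2]; apply/andP; split; lra.
  have pw (x : R) : x != c -> I1 x ->
      (fun n => ((q n).[x] * h x)%:E) @ \oo --> ((EFin \o h) \_ `]-oo, c[) x.
    move=> xc Ix; have /andP[y0 y1] := yI _ Ix.
    have fc (l : R) : (fun n => (1 - y x ^+ n) ^+ (2 ^ n)) @ \oo --> l ->
        (fun n => ((q n).[x] * h x)%:E) @ \oo --> (l * h x)%:E.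
      move=> hl; apply/fine_cvgP; split; first by near=> n.
      rewrite (_ : _ \o _ = (fun n => (1 - y x ^+ n) ^+ (2 ^ n) * h x)).
        by apply: cvgM => //; exact: cvg_cst.
      by apply/funext => n /=; rewrite qE.
    rewrite patchE; case: ifPn => [/set_mem|/negP xc']; rewrite /= ?in_itv /=.
      move=> xc'; have y2 : y x < 2^-1 by rewrite /y gtrDl pmulr_llt0 ?invr_gt0// subr_lt0.
      by have := fc _ (cvg_step_lt y0 y2); rewrite mul1r.
    have {}xc' : c < x.
      rewrite lt_neqAle eq_sym xc /= leNgt; apply/negP => h'; apply: xc'.
      by rewrite inE /= in_itv /=.
    have y2 : 2^-1 < y x by rewrite /y ltrDl divr_gt0// subr_gt0.
    by have := fc _ (cvg_step_gt y2 y1); rewrite mul0r.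
  rewrite integral_mkcondr.
  have [|||||_ _] := @dominated_convergence _ cR R cmu I1 mI (fun n x => ((q n).[x] * h x)%:E)
    ((EFin \o h) \_ `]-oo, c[%classic) (EFin \o (fun x => `|h x|)).
  - by move=> n; have /integrableP[] := completed_integrable_horner (q n) ih.
  - apply/(measurable_restrict _ mc mI); have /integrableP[] := ihA _ mc; by [].
  - have hc : {ae cmu, forall x : R, x != c} by apply/completed_ae; exact: ae_neq.
    exact: (@aeS R _ cR cmu _ _ pw hc).
  - by have := integrable_norm ih.
  - apply: aeW => x n Ix; rewrite lee_fin normrM ler_piMl// qE.
    have /andP[y0 y1] := yI _ Ix.
    have y2 : 0 <= 1 - y x ^+ n by rewrite subr_ge0 exprn_ile1.
    by rewrite ger0_norm ?exprn_ge0// exprn_ile1// gerBl exprn_ge0.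
  move=> cv; rewrite -(cvg_lim (@ereal_hausdorff R) cv).
  rewrite (_ : (fun n => _) = cst 0%E); first exact: lim_cst.
  by apply/funext => n; rewrite qh0.
have bG : <<s @RGenInftyO.G R >> `<=` G.
  rewrite -setI_closed_g_dynkin_g_sigma_algebra; first exact: smallest_sub.
  move=> _ _ [a ->] [b ->]; exists (Num.min a b); apply/seteqP; split => x /=.
    by rewrite !in_itv /= lt_min => -[-> ->].
  by rewrite !in_itv /= lt_min => /andP[].
(* A Lebesgue measurable set differs from a Borel set by a null set, which does not affect the
   integral. *)
have H (E : set cR) : E `<=` (I1 : set cR) -> measurable E ->
    (\int[cmu]_(x in E) (EFin \o h) x = \int[cmu]_(x in E) cst 0 x)%E.
  move=> EI mE; rewrite integral0.
  have := mE; rewrite -/(measurable _) -[measurable]completed_caratheodory_measurable.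
  rewrite g_sigma_completed_algebra_genE => -[/= X mX [N' N'0] XE].
  have {}N'0 : cmu.-negligible (N' : set cR) by apply/completed_negligible.
  have mN : measurable (N' : set cR) by exact: completed_lebesgue_measure_is_complete.
  have N0 : cmu N' = 0%E by have /(measure_negligible mN) := N'0.
  have [mX' X0] : G X.
    apply: bG; have : ((R.-ocitv).-measurable).-sigma.-measurable X by exact: mX.
    by rewrite (RGenInftyO.measurableE R).
  have E1 := negligible_integral mN mE (integrableS mI mE EI ih) N0.
  have E2 := negligible_integral mN (measurableI _ _ mI mX') (ihA _ mX') N0.
  rewrite E1 -[RHS]X0 E2; congr (integral _ _ _); apply/seteqP; split => x [].
    move=> Ex Nx; split => //; split; first exact: EI.
    by move: Ex; rewrite -XE => -[].
  by move=> [Ix Xx] Nx; split => //; rewrite -XE; left.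
have := integral_ae_eq mI ih (measurable_cst (0%E : \bar R)) H.
by apply: aeS => x hx Ix; have := hx Ix; case.
Unshelve. all: by end_near. Qed.

End CompletedMeasure.

(** * Jacobi coefficients of Szego functions *)

Section Series.
Context {R : realType}.

Lemma nneseries_bounded (u : nat -> R) : (forall n, 0 <= u n) ->
  (\sum_(0 <= n <oo) (u n)%:E < +oo)%E <-> exists B : R, forall N, \sum_(n < N) u n <= B.
Proof.
move=> u0; have u0' n : (0%N <= n)%N -> true -> (0 <= (u n)%:E)%E by rewrite lee_fin.
split=> [uoo|[B uB]].
  exists (fine (\sum_(0 <= n <oo) (u n)%:E)) => N.
  rewrite -lee_fin fineK; last by rewrite ge0_fin_numE// nneseries_ge0.
  by rewrite -sumEFin -(big_mkord xpredT (fun n => (u n)%:E)); exact: nneseries_lim_ge.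
apply: (@le_lt_trans _ _ B%:E); last exact: ltry.
apply: lime_le; first exact: is_cvg_nneseries.
by apply: nearW => N; rewrite sumEFin lee_fin big_mkord.
Qed.

Lemma sqr_bounded (a : nat -> R[i]) (B : R) k :
  (forall N, \sum_(k < N) cmod (a k) ^+ 2 <= B) -> cmod (a k) <= 1 + B.
Proof.
move=> aB; have : cmod (a k) ^+ 2 <= B.
  apply: le_trans (aB k.+1); rewrite big_ord_recr /= lerDr.
  by apply: sumr_ge0 => j _; exact: sqr_ge0.
by have := sqr_ge0 (cmod (a k) - 1); have := cmod_ge0 (a k); nra.
Qed.

End Series.

Section JacobiCoefficients.
Context {R : realType}.
Local Notation cmu := (@completed_lebesgue_measure R).
Local Notation cR := (caratheodory_type (wlength (@idfun R))^*%mu).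
Local Notation I1 := (`]-1, 1[%classic).
Variables (alpha beta : R) (p : nat -> {poly R}).
Local Notation w := (jacobi_weight alpha beta).
Local Notation ji := (jacobi_integrand alpha beta p).
Local Notation coef := (jacobi_coef alpha beta p).
Implicit Types (f g : R -> R[i]).

Let mI : measurable (I1 : set cR) := @completed_measurable_itv11 R.

Lemma ae_jacobi_coef f g : {ae cmu, forall x, I1 x -> f x = g x} ->
  (forall n, cintegrable cmu I1 (ji f n)) ->
  (forall n, cintegrable cmu I1 (ji g n)) /\ forall n, coef g n = coef f n.
Proof.
move=> fg fi; have h n : {ae cmu, forall x, I1 x -> ji f n x = ji g n x}.
  apply: (@aeS R _ cR cmu _ _ _ fg) => x h Ix; by rewrite /jacobi_integrand h.
split=> n; have [g1 e1] := ae_cintegral mI (h n) (fi n); first exact: g1.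
exact: e1.
Qed.

Hypothesis onp : orthonormal_jacobi alpha beta p.

Lemma jacobi_coef_inj f g : (forall n, cintegrable cmu I1 (ji f n)) ->
  (forall n, cintegrable cmu I1 (ji g n)) -> (forall n, coef f n = coef g n) ->
  {ae cmu, forall x, I1 x -> f x = g x}.
Proof.
move=> fi gi fg; have [sp _ _] := onp.
pose h x := (f x - g x) * (w x)%:C.
have hq n x : (p n).[x]%:C * h x = ji f n x - ji g n x.
  have pw : ((p n).[x] * w x)%:C = (p n).[x]%:C * (w x)%:C :> R[i] by exact: rmorphM.
  by rewrite /jacobi_integrand /h -mulrBl pw mulrCA.
have ihp n : cintegrable cmu I1 (fun x => (p n).[x]%:C * h x).
  have := @cintegrableB R _ cR cmu I1 mI _ _ (fi n) (gi n).
  by apply: (eq_cintegrable (mu := cmu) mI) => x _; rewrite hq.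
have hp0 n : cintegral cmu I1 (fun x => (p n).[x]%:C * h x) = 0.
  rewrite (@eq_cintegral R _ cR cmu I1 _ (fun x => ji f n x - ji g n x)); last by move=> x _; exact: hq.
  by rewrite (@cintegralB R _ cR cmu I1 mI)// -/(coef f n) -/(coef g n) fg subrr.
(* Dividing by the nonzero constant [p 0] turns integrability of the integrand of index 0 into that
   of (f - g) w. *)
have ih : cintegrable cmu I1 h.
  have /size_poly1P[k k0 pk] : size (p 0) == 1%N by rewrite sp.
  have := @cintegrableZ R _ cR cmu I1 mI (k%:C)^-1 _ (ihp 0%N).
  apply: (eq_cintegrable (mu := cmu) mI) => x _; rewrite pk hornerC mulKf//.
  by apply: contra k0 => /eqP[->].
have hq0 (q : {poly R}) : cintegral cmu I1 (fun x => q.[x]%:C * h x) = 0.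
  have [k hk] := degree_basis sp (leqnn (size q)).
  rewrite (@eq_cintegral R _ cR cmu I1 _
    (fun x => \sum_(j < size q) (k j)%:C * ((p j).[x]%:C * h x))); last first.
    move=> x _; rewrite {1}hk horner_sum rmorph_sum /= mulr_suml; apply: eq_bigr => j _.
    by rewrite hornerZ rmorphM /= mulrA.
  rewrite (@cintegral_sum R _ cR cmu I1 mI) => [|j]; last exact: (@cintegrableZ R _ cR cmu I1 mI).
  by rewrite big1// => j _; rewrite (@cintegralZ R _ cR cmu I1 mI)// hp0 mulr0.
have [ih1 ih2] := ih.
have h1 : {ae cmu, forall x, I1 x -> complex.Re (h x) = 0}.
  apply: ae0_of_moments => // q; have := congr1 (@complex.Re R) (hq0 q); rewrite /= => <-.
  by apply: eq_Rintegral => x _; rewrite [RHS]cReM /= mul0r subr0.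
have h2 : {ae cmu, forall x, I1 x -> complex.Im (h x) = 0}.
  apply: ae0_of_moments => // q; have := congr1 (@complex.Im R) (hq0 q); rewrite /= => <-.
  by apply: eq_Rintegral => x _; rewrite [RHS]cImM /= mul0r addr0.
apply: (@aeS R _ cR cmu _ _ _ (@aeI R _ cR cmu _ _ h1 h2)) => x [x1 x2] Ix.
have : h x = 0 by apply: eqc; rewrite ?x1 ?x2.
move=> /eqP; rewrite mulf_eq0 subr_eq0 => /orP[/eqP//|/eqP[w0]].
by have := jacobi_weight_gt0 alpha beta Ix; rewrite w0 ltxx.
Qed.

End JacobiCoefficients.

(** * From Szego functions to Jacobi coefficients and back *)

Section JacobiSzego.
Context {R : realType}.
Local Notation mu := (@lebesgue_measure R).
Local Notation cmu := (@completed_lebesgue_measure R).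
Local Notation I1 := (`]-1, 1[%classic).
Variables (theta alpha beta : R) (p : nat -> {poly R}).
Hypothesis theta1 : 1 < theta.
Hypothesis onp : orthonormal_jacobi alpha beta p.
Local Notation rho := (Num.sqrt theta).
Local Notation ji := (jacobi_integrand alpha beta p).
Local Notation coef := (jacobi_coef alpha beta p).
Local Notation d := (tau_moment alpha beta p).
Local Notation c := (tau_coef p).
Implicit Types (F : R[i] -> R[i]) (a : nat -> R[i]).

Let r1 : 1 < rho := rho_gt1 theta1.
Let r0 : 0 < rho := rho_gt0 theta1.

Lemma rhoV_gt0 : 0 < rho^-1. Proof. by rewrite invr_gt0. Qed.
Lemma rhoV_lt1 : rho^-1 < 1. Proof. by rewrite invf_lt1. Qed.

Lemma rhoX2 n : rho ^+ n ^+ 2 = theta ^+ n.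
Proof. by rewrite -exprM mulnC exprM sqr_sqrtr// ltW// (lt_trans _ theta1). Qed.

(** For x = cos t take v = [cis t]: then [joukowski v] is x, and (v / rho)^k + (v rho)^-k is rho^-k
    [tau k] at x. *)
Lemma szego_jacobi_coef a (B : R) F n : (forall N, \sum_(k < N) cmod (a k) ^+ 2 <= B) ->
  (forall v, 1 <= cmod v -> cmod v < rho ->
    (fun N => \sum_(k < N) a k * ((v / rho%:C) ^+ k + (v * rho%:C)^-1 ^+ k) : R[i]) @ \oo
      --> F (joukowski v)) ->
  cintegrable cmu I1 (ji (fun x => F x%:C) n) /\
  (fun N => \sum_(k < N) a k * (rho^-1 ^+ k * d k n)%:C : R[i]) @ \oo -->
    coef (fun x => F x%:C) n.
Proof.
move=> aB FE; have rC : rho%:C != 0 :> R[i] := rhoC_neq0 theta1.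
have FS (x : R) : I1 x ->
    (fun N => \sum_(k < N) a k * (rho^-1 ^+ k * (tau k).[x])%:C : R[i]) @ \oo --> F x%:C.
  move=> Ix; pose t := acos x.
  have xt : cos t = x by apply: acosK; move: (itv11_norm_le1 Ix); rewrite ler_norml in_itv.
  have := FE (cis t); rewrite cmod_cis => /(_ (lexx _) r1).
  have -> : joukowski (cis t) = x%:C.
    have := tau_cis 1 t; rewrite tau1 hornerZ hornerX xt !expr1 /joukowski => <-.
    by rewrite twoC -realCV ?pnatr_eq0// -rmorphM /= mulrC mulKf// pnatr_eq0.
  rewrite (_ : (fun N => \sum_(k < N) a k * (_ + _)) =
    (fun N => \sum_(k < N) a k * (rho^-1 ^+ k * (tau k).[x])%:C)); first by apply.
  apply/funext => N; apply: eq_bigr => k _; congr (_ * _).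
  rewrite -{1}xt [RHS]rmorphM /= tau_cis rmorphXn /= realCV ?gt_eqF// exprMn invfM exprMn.
  by rewrite mulrDr (mulrC (cis t ^+ k)) (mulrC ((cis t)^-1 ^+ k)).
have aB' k : cmod (a k) <= 1 + B by exact: sqr_bounded.
have [h1 h2] := jacobi_series_coef onp n (ltW rhoV_gt0) rhoV_lt1 aB' FS.
have [h3 h4] := completed_cintegral (@measurable_itv11 R) h1.
split; first exact: h3.
have E : coef (fun x => F x%:C) n = cintegral mu I1 (ji (fun x => F x%:C) n) := h4.
by rewrite E.
Qed.

Lemma jacobi_coefs_of_szego F : szego_space theta F ->
  (forall n, cintegrable cmu I1 (ji (fun x => F x%:C) n)) /\
  exists B : R, forall N, \sum_(n < N) cmod (coef (fun x => F x%:C) n) ^+ 2 * theta ^+ n <= B.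
Proof.
move=> /(szego_coefs theta1)[a [B [aB FE]]]; have SJ n := szego_jacobi_coef n aB FE.
split; first by move=> n; have [] := SJ n.
(* Conjugation by the weights rho^k turns the bounded triangular matrix [d] into one with decay
   rho^-(k - n). *)
pose e k n := rho ^+ n * (rho^-1 ^+ k * d k n).
pose K := jacobi_moment alpha beta 1 + 1.
have K0 : 0 <= K := le_trans (normr_ge0 _) (tau_moment_bound onp 0 0).
have e0 k n : (k < n)%N -> e k n = 0 by move=> kn; rewrite /e (tau_moment_lower onp)// !mulr0.
have eK k n : (n <= k)%N -> `|e k n| <= K * rho^-1 ^+ (k - n).
  move=> nk; rewrite /e mulrA normrM mulrC ler_pM//; first exact: (tau_moment_bound onp).
  rewrite ger0_norm ?mulr_ge0 ?exprn_ge0 ?(ltW r0) ?(ltW rhoV_gt0)//.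
  by rewrite -{1}(subnK nk) exprD mulrCA -exprMn divff ?expr1n ?mulr1// gt_eqF.
have [b [bE bB]] := upper_triangular_l2 (ltW rhoV_gt0) rhoV_lt1 K0 aB e0 eK.
have bn n : b n = coef (fun x => F x%:C) n * (rho ^+ n)%:C.
  have [_ h] := SJ n; have h' := cvgC_mulr (FF := eventually_filter) (y := (rho ^+ n)%:C) h.
  have hb := bE n; rewrite (_ : (fun N => \sum_(k < N) a k * (e k n)%:C) =
    (fun N => (\sum_(k < N) a k * (rho^-1 ^+ k * d k n)%:C) * (rho ^+ n)%:C)) in hb.
    exact: cvgC_unique hb h'.
  apply/funext => N; rewrite mulr_suml; apply: eq_bigr => k _.
  by rewrite -mulrA -rmorphM /=; congr (_ * _%:C); rewrite mulrC.
exists (K ^+ 2 * ((1 - rho^-1) ^- 2 * B)) => N; apply: le_trans (bB N).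
apply: ler_sum => n _; rewrite bn cmodM exprMn cmodR ger0_norm ?exprn_ge0 ?(ltW r0)//.
by rewrite rhoX2.
Qed.

(** [F] is built from the Chebyshev coefficients [b], which are infinite sums over n. That its
    Jacobi coefficients are again [a] is an exchange of two infinite sums, obtained by comparison
    with the truncations [bN N]. *)
Lemma szego_of_jacobi_coefs a (B : R) : (forall N, \sum_(n < N) cmod (a n) ^+ 2 * theta ^+ n <= B) ->
  exists2 F, szego_space theta F &
    forall n, cintegrable cmu I1 (ji (fun x => F x%:C) n) /\ coef (fun x => F x%:C) n = a n.
Proof.
move=> aB; pose y n := a n * (rho ^+ n)%:C.
have yB N : \sum_(n < N) cmod (y n) ^+ 2 <= B.
  apply: le_trans (aB N); apply: ler_sum => n _.
  by rewrite cmodM exprMn cmodR ger0_norm ?exprn_ge0 ?(ltW r0)// rhoX2.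
(* Any rate strictly between 1 and rho would do: below rho so that r = s / rho < 1, above 1 for the
   coefficient bound and for the convergence of the powers of 1/s in the final error estimate. *)
pose s := (1 + rho) / 2; have r1' : 1 < rho by exact: r1.
have s1 : 1 < s by rewrite /s; lra.
have s0 : 0 < s by lra.
have sr : s < rho by rewrite /s; lra.
have [K K0 cK] := tau_coef_bound onp s1.
pose r := s / rho; have rr0 : 0 <= r by rewrite divr_ge0// ltW.
have rr_gt0 : 0 < r by rewrite divr_gt0.
have rr1 : r < 1 by rewrite ltr_pdivrMr// mul1r.
pose e n j := rho ^+ j * (rho^-1 ^+ n * c n j).
have e0 n j : (n < j)%N -> e n j = 0 by move=> nj; rewrite /e (tau_coef_lower onp)// !mulr0.
have eK n j : (j <= n)%N -> `|e n j| <= K * r ^+ (n - j).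
  move=> jn; rewrite /e mulrA normrM ger0_norm ?mulr_ge0 ?exprn_ge0 ?(ltW r0) ?(ltW rhoV_gt0)//.
  rewrite (_ : rho ^+ j * rho^-1 ^+ n = rho^-1 ^+ (n - j)); last first.
    by rewrite -{1}(subnK jn) exprD mulrCA -exprMn divff ?expr1n ?mulr1// gt_eqF.
  rewrite /r exprMn mulrA [leRHS]mulrC ler_wpM2l ?exprn_ge0 ?(ltW rhoV_gt0)//.
  exact: cK.
have [b [bE bB]] := upper_triangular_l2 rr0 rr1 K0 yB e0 eK.
have [F sF FE] := szego_of_coefs theta1 bB; exists F => // m.
have [h1 h2] := szego_jacobi_coef m bB FE; split => //; apply: cvgC_unique h2 _.
pose S N := \sum_(k < N) b k * (rho^-1 ^+ k * d k m)%:C : R[i].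
pose bN N j := \sum_(n < N) y n * (e n j)%:C : R[i].
(* With finite sums the order may be exchanged, the weights cancel, and the inverse matrices leave
   only n = m; no error arises once N > m. *)
have SN N : (m < N)%N -> \sum_(j < N) bN N j * (rho^-1 ^+ j * d j m)%:C = a m.
  move=> mN.
  transitivity (\sum_(n < N) \sum_(j < N) a n * (c n j * d j m)%:C).
    rewrite exchange_big /=; apply: eq_bigr => j _; rewrite mulr_suml; apply: eq_bigr => n _.
    rewrite /y /e -!mulrA -!rmorphM /=; congr (_ * _%:C).
    have rn k : rho ^+ k * rho^-1 ^+ k = 1 by rewrite -exprMn divff ?expr1n// gt_eqF.
    transitivity ((rho ^+ n * rho^-1 ^+ n) * (rho ^+ j * rho^-1 ^+ j) * (c n j * d j m)); first by ring.
    by rewrite !rn !mul1r /tau_coef mulrA.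
  rewrite (bigD1 (Ordinal mN))//= [X in _ + X]big1 ?addr0.
    by rewrite -mulr_sumr -rmorph_sum /= (tau_coef_moment onp)// eqxx mulr1.
  move=> n nm; rewrite -mulr_sumr -rmorph_sum /= (tau_coef_moment onp)//.
  by rewrite (negbTE (nm : n != m :> nat)) mulr0.
pose Kd := jacobi_moment alpha beta 1 + 1.
have Kd0 : 0 <= Kd := le_trans (normr_ge0 _) (tau_moment_bound onp 0 0).
have B0 : 0 <= 1 + B := le_trans (cmod_ge0 _) (sqr_bounded 0 yB).
have sV : 0 <= s^-1 by rewrite invr_ge0 ltW.
have sV1 : s^-1 < 1 by rewrite invf_lt1.
have tail N j : (j < N)%N -> cmod (b j - bN N j) <= (1 + B) * K / (1 - r) * r ^+ N * r ^- j.
  move=> jN; apply: (cvgC_le (bE j)); near=> M; have NM : (N <= M)%N by near: M; exists N.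
  rewrite /bN -(big_mkord xpredT (fun n => y n * (e n j)%:C)).
  rewrite -(big_mkord xpredT (fun n => y n * (e n j)%:C)) (@big_cat_nat _ _ _ N 0 M)//=.
  rewrite addrAC subrr add0r; apply: le_trans (cmod_sum _ _ _) _.
  apply: (@le_trans _ _ (\sum_(N <= n < M) (1 + B) * K * r ^- j * r ^+ n)).
    rewrite !big_nat; apply: ler_sum => n /andP[Nn _].
    have jn : (j <= n)%N by rewrite ltnW// (leq_trans jN).
    rewrite cmodM cmodR; apply: (@le_trans _ _ ((1 + B) * (K * r ^+ (n - j)))).
      by apply: ler_pM; rewrite ?cmod_ge0 ?eK//; exact: sqr_bounded.
    rewrite exprB ?unitfE ?gt_eqF// le_eqVlt; apply/orP; left; apply/eqP; ring.
  rewrite -mulr_sumr (_ : _ * K / (1 - r) * _ * _ = (1 + B) * K * r ^- j * (r ^+ N / (1 - r))); last by ring.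
  by rewrite ler_wpM2l ?geometric_tail// !mulr_ge0 ?invr_ge0 ?exprn_ge0.
(* The tail of [b j] costs r^N r^-j and the term carries rho^-j. As r rho = s, the product is r^N
   s^-j, summable over j. *)
have SB N : (m < N)%N -> cmod (S N - a m) <= (1 + B) * K / (1 - r) * Kd / (1 - s^-1) * r ^+ N.
  move=> mN; rewrite -(SN N mN) /S -sumrB; apply: le_trans (cmod_sum _ _ _) _.
  pose C := (1 + B) * K / (1 - r) * r ^+ N * Kd.
  have C0 : 0 <= C by rewrite /C !mulr_ge0 ?exprn_ge0// invr_ge0 subr_ge0 ltW.
  apply: (@le_trans _ _ (\sum_(j < N) C * s^-1 ^+ j)).
    apply: ler_sum => j _; rewrite -mulrBl cmodM cmodR normrM.
    rewrite (ger0_norm (exprn_ge0 _ (ltW rhoV_gt0))).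
    have -> : C * s^-1 ^+ j = ((1 + B) * K / (1 - r) * r ^+ N * r ^- j) * (rho^-1 ^+ j * Kd).
      have inv_div (x z : R) : z != 0 -> x^-1 = (x / z)^-1 * z^-1.
        by move=> z0; rewrite invf_div mulrAC divff ?mul1r.
      rewrite (inv_div s rho) ?gt_eqF//.
      have mul_perm (A X Y Z : R) : A * Z * (X * Y) = A * X * (Y * Z) by ring.
      by rewrite -/r exprMn (exprVn r); exact: mul_perm.
    apply: ler_pM; rewrite ?cmod_ge0 ?mulr_ge0 ?exprn_ge0 ?(ltW rhoV_gt0) ?tail//.
    by rewrite ler_wpM2l ?exprn_ge0 ?(ltW rhoV_gt0)//; exact: (tau_moment_bound onp).
  have := geometric_tail 0 N sV sV1; rewrite big_mkord expr0 mul1r => gt.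
  rewrite -mulr_sumr (_ : _ * K / _ * Kd / _ * _ = C * (1 - s^-1)^-1); last by rewrite /C; ring.
  by rewrite ler_wpM2l.
apply/cvgCP => eps eps0.
have : (fun N => (1 + B) * K / (1 - r) * Kd / (1 - s^-1) * r ^+ N) @ \oo --> (0 : R).
  rewrite -(mulr0 ((1 + B) * K / (1 - r) * Kd / (1 - s^-1))); apply: cvgM; first exact: cvg_cst.
  by apply: cvg_expr; rewrite ger0_norm.
move=> /cvgrPdist_lt/(_ _ eps0) hN; near=> N.
apply: le_lt_trans (SB N _) _; first by near: N; exists m.+1.
by apply: le_lt_trans (ler_norm _) _; rewrite -normrN -sub0r; near: N.
Unshelve. all: by end_near. Qed.

End JacobiSzego.

Theorem theorem4 (R : realType) (theta alpha beta : R) (p : nat -> {poly R})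
    (f : R -> R[i]) :
  1 < theta -> - 2^-1 <= alpha -> - 2^-1 <= beta ->
  orthonormal_jacobi alpha beta p ->
  (has_jacobi_coefs alpha beta p f /\
   (\sum_(0 <= k <oo)
      (cmod (jacobi_coef alpha beta p f k) ^+ 2 * theta ^+ k)%:E < +oo)%E)
  <->
  (exists2 F : R[i] -> R[i], szego_space theta F &
     {ae lebesgue_measure, forall x : R, x \in `]-1, 1[ -> f x = F x%:C}).
Proof.
move=> theta1 _ _ onp; have t0 n : 0 <= theta ^+ n by rewrite exprn_ge0// ltW// (lt_trans _ theta1).
have u0 (a : nat -> R[i]) n : 0 <= cmod (a n) ^+ 2 * theta ^+ n by rewrite mulr_ge0 ?sqr_ge0.
split=> [[fi /(nneseries_bounded (u0 _))[B fB]]|[F sF fF]].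
  have [F sF FE] := szego_of_jacobi_coefs theta1 onp fB; exists F => //.
  have h := jacobi_coef_inj onp fi (fun n => proj1 (FE n)) (fun n => esym (proj2 (FE n))).
  by apply/completed_ae; exact: h.
have [Fi [B FB]] := jacobi_coefs_of_szego theta1 onp sF.
(* On the completed measure almost everywhere equality suffices to pass measurability, integrability
   and the coefficients from [F] to [f]. *)
have {}fF : {ae @completed_lebesgue_measure R, forall x, `]-1, 1[%classic x -> F x%:C = f x}.
  apply/completed_ae; apply: (@aeS R _ _ _ _ _ _ fF) => x h Ix; exact/esym/h.
have [fi fE] := ae_jacobi_coef fF Fi; split => //.
by apply/(nneseries_bounded (u0 _)); exists B => N; under eq_bigr do rewrite fE.
Qed.
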